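(* For $\nu>0$ let $(q_t,z_t,p_t,(p_z)_t)_{t\ge0}$ be the process defined by $$\begin{cases}\dot q=M^{-1}p\\ \dot z=M_z^{-1}p_z\\ \dot p=-\nabla_qV(q)-\nabla_qV_{\mathrm{fix},\nu}(q)-\gamma\dot q+\sigma\dot W-\nabla_q\xi\,\dot\lambda\\ \dot p_z=-\gamma_z\dot z+\sigma_z\dot W_z+\frac{\dot\lambda}{\nu}\\ \xi(q)=\frac z\nu\end{cases}$$ and let $(p_\nu)_t=M_\nu(q_t)M^{-1}p_t$. When $\nu\to0$, the evolution law of the processes $\{p_t,q_t\}_{t\ge0}$ or $\{(p_\nu)_t,q_t\}_{t\ge0}$ converges (in the sense of probability distributions on continuous paths endowed with the uniform convergence) towards the process solving the original Langevin dynamics $$\dot q=M^{-1}p,\qquad \dot p=-\nabla_qV(q)-\gamma\dot q+\sigma\dot W .$$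
   Context: $M$ ($d\times d$) and $M_z$ ($n\times n$) are symmetric positive definite, $\beta>0$, $V:\mathbb{R}^d\to\mathbb{R}$ and $\xi:\mathbb{R}^d\to\mathbb{R}^n$ are smooth; $(\nabla_q\xi)_{ji}=\partial\xi_i/\partial q_j$, and $\nabla_q^T\xi$ is the transpose. $M_\nu(q)=M+\nu^2\nabla_q\xi\,M_z\nabla_q^T\xi$ and $V_{\mathrm{fix},\nu}(q)=\frac1{2\beta}\ln\det M_\nu(q)$. $\dot W,\dot W_z$ are independent standard white noises in $\mathbb{R}^d$, $\mathbb{R}^n$; $\gamma,\gamma_z$ are symmetric non-negative with $\sigma\sigma^T=\frac2\beta\gamma$, $\sigma_z\sigma_z^T=\frac2\beta\gamma_z$. $\lambda\in\mathbb{R}^n$ is the Lagrange multiplier process associated with the constraints, adapted to the noise. The constraints imply $\nabla_q^T\xi M^{-1}p=\frac1\nu M_z^{-1}p_z$, so $(z,p_z)$ is determined by $(p,q)$. Standing assumption: the usual global Lipschitz conditions on the Hamiltonian and on $\xi$ hold, ensuring well-posedness of the stochastic differential equations considered. *)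

(* Defs.v *)
From HB Require Import structures.
From mathcomp Require Export all_boot all_order all_algebra.
From mathcomp Require Export all_classical all_reals all_analysis.

Set Implicit Arguments.
Unset Strict Implicit.
Unset Printing Implicit Defensive.

Import Order.TTheory GRing.Theory Num.Theory.
Import numFieldNormedType.Exports.

Local Open Scope classical_set_scope.
Local Open Scope ring_scope.

Section calculus.
Context {R : realType} {d : nat}.

Definition sym_pos_def (A : 'M[R]_d) : Prop :=
  A^T = A /\ forall x : 'cV[R]_d, x != 0 -> 0 < (x^T *m A *m x) 0 0.

Definition sym_nonneg (A : 'M[R]_d) : Prop :=
  A^T = A /\ forall x : 'cV[R]_d, 0 <= (x^T *m A *m x) 0 0.

Definition partial (i : 'I_d) (f : 'cV[R]_d -> R) : 'cV[R]_d -> R :=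
  fun q => 'D_(delta_mx i 0) f q.

Definition grad (f : 'cV[R]_d -> R) (q : 'cV[R]_d) : 'cV[R]_d :=
  \col_i partial i f q.

Definition gradmx {n : nat} (xi : 'cV[R]_d -> 'cV[R]_n) (q : 'cV[R]_d) :
    'M[R]_(d, n) :=
  \matrix_(j, i) partial j (fun q' => xi q' i 0) q.

(* C^infinity: every iterated partial derivative is differentiable. *)
Definition smooth (f : 'cV[R]_d -> R) : Prop :=
  forall (s : seq 'I_d) (q : 'cV[R]_d), differentiable (foldr partial f s) q.

Definition hamiltonian (M : 'M[R]_d) (V : 'cV[R]_d -> R) (p q : 'cV[R]_d) : R :=
  2^-1 * (p^T *m invmx M *m p) 0 0 + V q.

Definition hamiltonian_field (M : 'M[R]_d) (V : 'cV[R]_d -> R)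
    (x : 'cV[R]_d * 'cV[R]_d) : 'cV[R]_d * 'cV[R]_d :=
  (- grad (hamiltonian M V x.1) x.2,
   grad (fun p => hamiltonian M V p x.2) x.1).

Definition M_nu {n : nat} (M : 'M[R]_d) (Mz : 'M[R]_n)
    (xi : 'cV[R]_d -> 'cV[R]_n) (nu : R) (q : 'cV[R]_d) : 'M[R]_d :=
  M + nu ^+ 2 *: (gradmx xi q *m Mz *m (gradmx xi q)^T).

Definition V_fix {n : nat} (M : 'M[R]_d) (Mz : 'M[R]_n) (beta : R)
    (xi : 'cV[R]_d -> 'cV[R]_n) (nu : R) (q : 'cV[R]_d) : R :=
  (2 * beta)^-1 * ln (\det (M_nu M Mz xi nu q)).

(* Coordinatewise Lebesgue integral of b over [0, t]. *)
Definition time_integral (b : R -> 'cV[R]_d) (t : R) : 'cV[R]_d :=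
  \col_i Rintegral lebesgue_measure `[0, t] (fun s => b s i 0).

(* I is the Riemann-Stieltjes integral of A against dg over [a, b]: the limit,
   as the mesh tends to 0, of the sums over tagged partitions.  The integral of
   the constraint force is of this kind: along a path with q' = M^-1 p, the
   integrand gradmx xi q is continuously differentiable in time, so that its
   integral against the continuous path lambda exists path by path (integration
   by parts) and there is no distinction between Ito and Stratonovich. *)
Definition is_stieltjes_integral {n : nat} (A : R -> 'M[R]_(d, n))
    (g : R -> 'cV[R]_n) (a b : R) (I : 'cV[R]_d) : Prop :=
  forall e : R, 0 < e -> exists2 delta : R, 0 < delta &
    forall (s : seq R) (c : nat -> R), itv_partition a b s ->
    let x := nth b (a :: s) in
    (forall k, (k < size s)%N ->
       x k <= c k <= x k.+1 /\ x k.+1 - x k < delta) ->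
    `|\sum_(0 <= k < size s) A (c k) *m (g (x k.+1) - g (x k)) - I| < e.

End calculus.

Section processes.
Context {R : realType} {dT : measure_display} {T : measurableType dT}.
Variable P : probability T R.

Definition is_filtration (F : R -> set (set T)) : Prop :=
  [/\ forall t, 0 <= t -> sigma_algebra setT (F t),
      forall t, 0 <= t -> F t `<=` measurable &
      forall s t : R, 0 <= s -> s <= t -> F s `<=` F t].

Variable F : R -> set (set T).

(* A process is a function of the time t, meaningful for 0 <= t, and of w. *)
Definition adapted {m : nat} (X : R -> T -> 'cV[R]_m) : Prop :=
  forall t, 0 <= t -> forall (i : 'I_m) (B : set R), measurable B ->
    F t ((fun w => X t w i 0) @^-1` B).

Definition continuous_adapted {m : nat} (X : R -> T -> 'cV[R]_m) : Prop :=
  adapted X /\ forall w, {within `[0, +oo[, continuous (X ^~ w)}.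

(* Standard F-Brownian motion in R^m.  The product formula says at once that
   the coordinates of B_t - B_s are N(0, t - s), mutually independent, and
   independent of F_s.  The second parameter of normal_prob is the standard
   deviation. *)
Definition brownian_motion {m : nat} (B : R -> T -> 'cV[R]_m) : Prop :=
  [/\ continuous_adapted B,
      {ae P, forall w, B 0 w = 0} &
      forall s t : R, 0 <= s -> s < t ->
      forall (A : set T) (C : 'I_m -> set R), F s A ->
        (forall i, measurable (C i)) ->
        P (A `&` [set w | forall i, C i ((B t w - B s w) i 0)]) =
        (P A * \prod_(i < m) normal_prob 0 (Num.sqrt (t - s)) (C i))%E].

Definition langevin_process {d : nat} (M : 'M[R]_d) (V : 'cV[R]_d -> R)
    (gamma sigma : 'M[R]_d) (W q p : R -> T -> 'cV[R]_d) : Prop :=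
  [/\ is_filtration F,
      brownian_motion W,
      continuous_adapted q /\ continuous_adapted p,
      {ae P, forall w, forall t, 0 <= t ->
        q t w = q 0 w + time_integral (fun s => invmx M *m p s w) t} &
      {ae P, forall w, forall t, 0 <= t ->
        p t w = p 0 w
          + time_integral (fun s => - grad V (q s w)
                                    - gamma *m (invmx M *m p s w)) t
          + sigma *m W t w}].

(* The constrained dynamics with mass ratio nu, where qdot and zdot are
   replaced by M^-1 p and Mz^-1 pz in the friction terms.  Two independent
   standard Brownian motions W, Wz are a standard Brownian motion (W, Wz) in
   R^(d + n); the initial data, being F_0-measurable, are independent of it. *)
Record constrained_process {d n : nat} (M : 'M[R]_d) (Mz : 'M[R]_n) (beta : R)
    (V : 'cV[R]_d -> R) (xi : 'cV[R]_d -> 'cV[R]_n)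
    (gamma sigma : 'M[R]_d) (gammaz sigmaz : 'M[R]_n) (nu : R)
    (W : R -> T -> 'cV[R]_d) (Wz : R -> T -> 'cV[R]_n)
    (q : R -> T -> 'cV[R]_d) (z : R -> T -> 'cV[R]_n)
    (p : R -> T -> 'cV[R]_d) (pz : R -> T -> 'cV[R]_n)
    (lambda : R -> T -> 'cV[R]_n) : Prop := {
  cp_filtration : is_filtration F ;
  cp_noise : brownian_motion (fun t w => col_mx (W t w) (Wz t w)) ;
  cp_q_adapted : continuous_adapted q ;
  cp_z_adapted : continuous_adapted z ;
  cp_p_adapted : continuous_adapted p ;
  cp_pz_adapted : continuous_adapted pz ;
  cp_lambda_adapted : continuous_adapted lambda ;
  cp_q : {ae P, forall w, forall t, 0 <= t ->
    q t w = q 0 w + time_integral (fun s => invmx M *m p s w) t} ;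
  cp_z : {ae P, forall w, forall t, 0 <= t ->
    z t w = z 0 w + time_integral (fun s => invmx Mz *m pz s w) t} ;
  (* p_t = p_0 + (drift) + sigma W_t - (integral of grad xi(q) dlambda),
     solved for the last term. *)
  cp_p : {ae P, forall w, forall t, 0 <= t ->
    is_stieltjes_integral (fun s => gradmx xi (q s w)) (lambda ^~ w) 0 t
      (p 0 w
        + time_integral (fun s => - grad V (q s w)
                                  - grad (V_fix M Mz beta xi nu) (q s w)
                                  - gamma *m (invmx M *m p s w)) t
        + sigma *m W t w
        - p t w)} ;
  cp_pz : {ae P, forall w, forall t, 0 <= t ->
    pz t w = pz 0 w
      + time_integral (fun s => - (gammaz *m (invmx Mz *m pz s w))) t
      + sigmaz *m Wz t w
      + nu^-1 *: (lambda t w - lambda 0 w)} ;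
  cp_constraint : {ae P, forall w, forall t, 0 <= t ->
    xi (q t w) = nu^-1 *: z t w} }.

End processes.

(* Continuous paths on [0, +oo[ are functions on R that are continuous within
   [0, +oo[, with the uniform convergence on the compact subsets of [0, +oo[;
   this topology ignores the values at negative times. *)
Definition path_space {R : realType} (E : uniformType) :=
  {family compactly_in (`[0, +oo[ : set R), R -> E}.

Definition continuous_paths {R : realType} (E : uniformType) :
    set (@path_space R E) :=
  [set x | {within `[0, +oo[, continuous (x : R -> E)}].

(* Weak convergence, as nu tends to 0 from above, of the laws of the random
   elements X nu of C to the law of X0: convergence of the expectations of the
   bounded continuous functions on C.  The X nu may live on different
   probability spaces. *)
Definition cvg_in_law {R : realType} {S : topologicalType} (C : set S)
    {dT : R -> measure_display} {T : forall nu, measurableType (dT nu)}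
    (P : forall nu, probability (T nu) R) (X : forall nu, T nu -> S)
    {dT0 : measure_display} {T0 : measurableType dT0}
    (P0 : probability T0 R) (X0 : T0 -> S) : Prop :=
  forall f : S -> R, {within C, continuous f} ->
    (exists K, forall x, C x -> `|f x| <= K) ->
    'E_(P nu)[fun w => f (X nu w)]%E @[nu --> 0^'+] -->
      'E_P0[fun w => f (X0 w)]%E.

(* Main.v *)
(** For each path of the noise the statement is deterministic.  Differentiating
    the constraint in time gives [pz = nu Mz grad xi(q)^T M^-1 p], so the equation
    of [pz], solved for [lambda], shows that [lambda_t - lambda_0 = O(nu)] as long
    as [p, q] and the noise stay bounded.  The integrand [grad xi(q_t)] of the
    constraint force is Lipschitz in time, so Abel summation bounds its Stieltjes
    integral by a multiple of [sup |lambda_t - lambda_0|], again [O(nu)]; and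
    [grad V_fix = O(nu^2)] on balls, since [V_fix] depends on [nu] through
    [nu ^+ 2] only.  Thus [(p, q)] solves the Langevin equation driven by the same
    noise up to an error [O(nu)], which, the Langevin drift being globally
    Lipschitz, puts it within [C (2^-k + nu)] of the [k]-th Picard iterate,
    uniformly over bounded initial data and noise.  The bounds on balls suffice
    because the a priori bound on approximate solutions keeps the path inside a
    ball fixed in advance.

    The probability spaces vary with [nu], but the law of the noise does not, and
    the noise is independent of the initial data.  Hence the mean of a bounded
    continuous functional of the [k]-th Picard iterate is the mean of one and the
    same continuous function of the initial data, to which the hypothesis on the
    initial laws applies.  The approximation by Picard iterates is uniform, so it
    is compatible with test functionals that are uniformly continuous; a bounded
    continuous functional reduces to these by inf-convolution. *)

Require Import Defs.
From mathcomp Require Import ring lra measurable_realfun.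

Set Implicit Arguments.
Unset Strict Implicit.
Unset Printing Implicit Defensive.

Import Order.TTheory GRing.Theory Num.Theory.
Import numFieldNormedType.Exports.

Local Open Scope classical_set_scope.
Local Open Scope ring_scope.

(** * Continuous paths and their integrals *)

(** Picard iterates stand in for the solution map of the Langevin equation. The noise being
    additive, an iterate is an explicit continuous function of the initial datum and of the noise
    path, without any stochastic integral, and both processes are compared with it as given
    trajectories. The obstacle is that for each [nu] everything lives on its own space, with no
    coupling to the limit: only laws can be compared. Independence is therefore exploited through
    codes. Rounding the increments of a path on a grid leaves finitely many values, for which the
    product formula in [brownian_motion] yields finite sums; dominated convergence then removes the
    rounding. The same codes make path functionals measurable. [Wz] has no counterpart in the limit.
    It enters only through a bound on its size, and as the law of the joint noise is the same for
    every [nu], the space at [nu = 1] provides a tail bound that is uniform in [nu]. *)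

Section matrix_norm.
Context {R : realType}.

Lemma mx_norm_coord {m n : nat} (A : 'M[R]_(m, n)) i j : `|A i j| <= `|A|.
Proof.
rewrite [leRHS]/Num.norm /= mx_normrE.
by apply: (le_bigmax _ (fun ij : 'I_m * 'I_n => `|A ij.1 ij.2|) (i, j)).
Qed.

Lemma mx_norm_le {m n : nat} (A : 'M[R]_(m, n)) e : 0 <= e ->
  (forall i j, `|A i j| <= e) -> `|A| <= e.
Proof.
move=> e0 Ae; rewrite [leLHS]/Num.norm /= mx_normrE.
by apply: bigmax_le => // -[i j] _; exact: Ae.
Qed.

Lemma mulmx_norm {m n k : nat} (A : 'M[R]_(m, n)) (B : 'M[R]_(n, k)) :
  `|A *m B| <= n%:R * `|A| * `|B|.
Proof.
apply: mx_norm_le => [|i j]; first by rewrite !mulr_ge0.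
rewrite mxE (le_trans (ler_norm_sum _ _ _))//.
rewrite -mulrA mulr_natl -[X in _ *+ X]card_ord -sumr_const ler_sum// => l _.
by rewrite normrM ler_pM// mx_norm_coord.
Qed.

Lemma mx_norm_trmx {m n : nat} (A : 'M[R]_(m, n)) : `|A^T| = `|A|.
Proof.
apply/le_anti/andP; split; apply: mx_norm_le => // i j.
  by rewrite mxE mx_norm_coord.
by rewrite -[A]trmxK mxE trmxK mx_norm_coord.
Qed.

Lemma mx_continuous {U : topologicalType} {m n : nat} (f : U -> 'M[R]_(m, n)) u :
  (forall i j, {for u, continuous (fun v => f v i j)}) -> {for u, continuous f}.
Proof.
move=> cf; apply/cvgrPdist_lt => e e0.
have H i j : \forall v \near u, `|f u i j - f v i j| < e.
  by have /cvgrPdist_lt/(_ e e0) := cf i j.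
have {}H : \forall v \near u, forall ij, `|f u ij.1 ij.2 - f v ij.1 ij.2| < e.
  by apply: filter_forall => -[i j]; exact: H.
apply: filterS H => v H.
rewrite [ltLHS]/Num.norm /= mx_normrE.
by apply: bigmax_lt => // ij _; rewrite !mxE.
Qed.

Lemma mulmx_continuous {U : topologicalType} {m n k : nat}
    (f : U -> 'M[R]_(m, n)) (g : U -> 'M[R]_(n, k)) u :
  {for u, continuous f} -> {for u, continuous g} ->
  {for u, continuous (fun v => f v *m g v)}.
Proof.
move=> cf cg; apply: mx_continuous => i j.
rewrite (_ : (fun _ => _) = (fun v => \sum_l f v i l * g v l j)); last first.
  by apply/funext => v; rewrite mxE.
apply: (cvg_big (op := +%R) (x0 := 0)) => [|l _]; first exact: add_continuous.
apply: cvgM.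
  exact: (continuous_comp cf (@coord_continuous R m n i l (f u))).
exact: (continuous_comp cg (@coord_continuous R n k l j (g u))).
Qed.

Lemma trmx_continuous {U : topologicalType} {m n : nat}
    (f : U -> 'M[R]_(m, n)) u :
  {for u, continuous f} -> {for u, continuous (fun v => (f v)^T)}.
Proof.
move=> cf; apply: mx_continuous => i j.
rewrite (_ : (fun _ => _) = (fun v => f v j i)); last first.
  by apply/funext => v; rewrite mxE.
exact: (continuous_comp cf (@coord_continuous R m n j i (f u))).
Qed.

End matrix_norm.

Section paths.
Context {R : realType}.
Local Notation mu := (@lebesgue_measure R).

(* Paths live on [0, +oo[: continuity there is continuity on R of the path frozen
   at its initial value before time 0, so that no subspace topology is needed. *)
Definition positive_part (E : Type) (x : R -> E) : R -> E :=
  fun t => x (Num.max 0 t).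

Definition cpath (E : topologicalType) (x : R -> E) : Prop :=
  continuous (positive_part x).

Lemma max0_continuous : continuous (fun t : R => Num.max 0 t).
Proof.
by move=> t; apply: (@continuous_max R R); [exact: cst_continuous|exact: cvg_id].
Qed.

Lemma positive_partE (E : Type) (x : R -> E) t : 0 <= t -> positive_part x t = x t.
Proof. by move=> t0; rewrite /positive_part max_r. Qed.

Lemma cpathP (E : topologicalType) (x : R -> E) :
  cpath x <-> {within `[0, +oo[, continuous x}.
Proof.
split=> [cx|cx].
  apply: (subspace_eq_continuous (f := positive_part x)).
    by move=> t; rewrite inE/= in_itv/= andbT => t0; rewrite positive_partE.
  exact: continuous_subspaceT.
move=> t; move/subspace_continuousP : cx => /(_ (Num.max 0 t)).
rewrite /= in_itv/= andbT le_max lexx => /(_ isT) cx.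
apply: (cvg_comp (fun t : R => Num.max 0 t) x _ cx).
move=> A; rewrite /within/= => HA.
have /= := max0_continuous HA; apply: (@filterS _ (nbhs t)) => s; apply.
by rewrite in_itv/= andbT le_max lexx.
Qed.

Lemma cpath_comp (E G : topologicalType) (f : E -> G) (x : R -> E) :
  continuous f -> cpath x -> cpath (f \o x).
Proof. by move=> cf cx t; exact: (continuous_comp (cx t) (cf _)). Qed.

Lemma cpath_eq (E : topologicalType) (x y : R -> E) :
  (forall t, 0 <= t -> x t = y t) -> cpath x -> cpath y.
Proof.
move=> xy; suff xyE : positive_part x = positive_part y by rewrite /cpath xyE.
by apply/funext => t; rewrite /positive_part xy// le_max lexx.
Qed.

Lemma cpath_continuous (E : topologicalType) (x : R -> E) : continuous x -> cpath x.
Proof. by move=> cx t; exact: (continuous_comp (@max0_continuous t) (cx _)). Qed.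

Lemma cpath_bounded (E : normedModType R) (x : R -> E) (t : R) : cpath x ->
  exists2 K, 0 <= K & forall s, 0 <= s <= t -> `|x s| <= K.
Proof.
move=> cx.
have : compact (positive_part x @` `[0, t]).
  by apply: continuous_compact; [exact: continuous_subspaceT|exact: segment_compact].
move=> /compact_bounded[K [_ HK]].
exists (Num.max 0 K + 1); first by rewrite addr_ge0// le_max lexx.
move=> s /andP[s0 st]; apply: HK.
  by rewrite (@le_lt_trans _ _ (Num.max 0 K)) ?ltrDl// le_max lexx orbT.
by exists s; [rewrite /= in_itv/= s0 st|rewrite positive_partE].
Qed.

Lemma cpath_integrable (f : R -> R) (t : R) : cpath f ->
  mu.-integrable `[0, t] (EFin \o f).
Proof.
move=> cf; apply: (@eq_integrable _ _ _ mu `[0, t] _ (EFin \o positive_part f)) => //.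
  by move=> s; rewrite inE/= in_itv/= => /andP[s0 _]; rewrite positive_partE.
apply: continuous_compact_integrable; first exact: segment_compact.
exact: continuous_subspaceT.
Qed.

Lemma cpath_integral (f : R -> R) : cpath f ->
  cpath (fun t => Rintegral mu `[0, t] f).
Proof.
move=> cf; apply/cpathP/subspace_continuousP => t /=.
rewrite in_itv/= andbT => t0.
(* On [[0, t + 1]] the time t is not a right end point, so its neighbourhoods there and in [[0,
   +oo[] agree. *)
have t10 : 0 <= t + 1 by rewrite addr_ge0.
have /subspace_continuousP := parameterized_integral_continuous t10
  (cpath_integrable (t + 1) cf).
move=> /(_ t); rewrite /= in_itv/= t0 lerDl ler01 => /(_ isT) H.
move=> A /H; rewrite /within/= => HA.
have : \forall s \near t, s < t + 1 by apply: lt_nbhsl; rewrite ltrDl.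
move: HA; apply: (@filterS2 _ (nbhs t)) => s HA st.
by rewrite in_itv/= andbT => s0; apply: HA; rewrite in_itv/= s0 ltW.
Qed.
End paths.

Section time_integral.
Context {R : realType}.
Local Notation mu := (@lebesgue_measure R).

Lemma cpath_coord {m n : nat} (b : R -> 'M[R]_(m, n)) i j :
  cpath b -> cpath (fun s => b s i j).
Proof. exact: (cpath_comp (@coord_continuous R m n i j)). Qed.

Lemma cpath_mx {m n : nat} (b : R -> 'M[R]_(m, n)) :
  (forall i j, cpath (fun s => b s i j)) -> cpath b.
Proof. by move=> cb t; apply: mx_continuous => i j; exact: cb. Qed.

Lemma cpathD {V : normedModType R} (x y : R -> V) :
  cpath x -> cpath y -> cpath (fun t => x t + y t).
Proof. by move=> cx cy t; exact: (cvgD (cx t) (cy t)). Qed.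

Lemma cpathN {V : normedModType R} (x : R -> V) :
  cpath x -> cpath (fun t => - x t).
Proof. by move=> cx t; exact: (cvgN (cx t)). Qed.

Lemma cpathB {V : normedModType R} (x y : R -> V) :
  cpath x -> cpath y -> cpath (fun t => x t - y t).
Proof. by move=> cx cy t; exact: (cvgB (cx t) (cy t)). Qed.

Lemma cpath_norm {V : normedModType R} (x : R -> V) :
  cpath x -> cpath (fun t => `|x t|).
Proof. by move=> cx t; exact: (cvg_norm (cx t)). Qed.

Lemma cpath_pair {V W : topologicalType} (x : R -> V) (y : R -> W) :
  cpath x -> cpath y -> cpath (fun t => (x t, y t)).
Proof. by move=> cx cy t; exact: (cvg_pair (cx t) (cy t)). Qed.

Lemma cpath_fst {V W : topologicalType} (x : R -> V * W) :
  cpath x -> cpath (fun t => (x t).1).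
Proof. by apply: cpath_comp => u; exact: cvg_fst. Qed.

Lemma cpath_snd {V W : topologicalType} (x : R -> V * W) :
  cpath x -> cpath (fun t => (x t).2).
Proof. by apply: cpath_comp => u; exact: cvg_snd. Qed.

Lemma cpath_mulmx {m n k : nat} (A : R -> 'M[R]_(m, n)) (B : R -> 'M[R]_(n, k)) :
  cpath A -> cpath B -> cpath (fun t => A t *m B t).
Proof. by move=> cA cB t; exact: (mulmx_continuous (cA t) (cB t)). Qed.

Lemma cpath_cst {E : topologicalType} (a : E) : cpath (fun _ : R => a).
Proof. by apply: cpath_continuous; exact: cst_continuous. Qed.

Lemma cpath_time_integral {d : nat} (b : R -> 'cV[R]_d) :
  cpath b -> cpath (time_integral b).
Proof.
move=> cb; apply: cpath_mx => i j.
apply: (cpath_eq (x := fun t => Rintegral mu `[0, t] (fun s => b s i 0))).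
  by move=> t _; rewrite mxE.
by apply: cpath_integral; exact: cpath_coord.
Qed.

Lemma time_integralB {d : nat} (b c : R -> 'cV[R]_d) t : cpath b -> cpath c ->
  time_integral (fun s => b s - c s) t = time_integral b t - time_integral c t.
Proof.
move=> cb cc; apply/matrixP => i j; rewrite !mxE.
rewrite -RintegralB//; try exact/cpath_integrable/cpath_coord.
by apply: eq_Rintegral => s _; rewrite !mxE.
Qed.

Lemma time_integral_le {d : nat} (b : R -> 'cV[R]_d) (h : R -> R) t :
  cpath b -> cpath h -> 0 <= t -> (forall s, 0 <= s <= t -> `|b s| <= h s) ->
  `|time_integral b t| <= Rintegral mu `[0, t] h.
Proof.
move=> cb ch t0 bh.
have h0 s : s \in `[0, t] -> 0 <= h s.
  by rewrite in_itv => st; exact: le_trans (bh s st).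
apply: mx_norm_le => [|i j]; first exact: Rintegral_ge0.
rewrite mxE (le_trans (le_normr_Rintegral _ _))//.
  exact/cpath_integrable/cpath_coord.
apply: le_Rintegral => //; first exact/cpath_integrable/cpath_norm/cpath_coord.
  exact/cpath_integrable.
move=> s /=; rewrite in_itv => st; apply: le_trans (bh s st).
exact: mx_norm_coord.
Qed.

Lemma time_integral_le_cst {d : nat} (b : R -> 'cV[R]_d) K t :
  cpath b -> 0 <= t -> (forall s, 0 <= s <= t -> `|b s| <= K) ->
  `|time_integral b t| <= K * t.
Proof.
move=> cb t0 bK; apply: (le_trans (time_integral_le (h := cst K) cb _ t0 bK)).
  exact: cpath_cst.
rewrite /cst Rintegral_cst//= lebesgue_measure_itv/= lte_fin.
case: ltP => [_|t0']; first by rewrite /= subr0.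
by have -> : t = 0 by apply/le_anti/andP.
Qed.

Lemma integral_exp_le (L m t : R) : 0 < L -> 0 <= m -> 0 <= t ->
  Rintegral mu `[0, t] (fun s => m * expR (L * s)) <= m / L * expR (L * t).
Proof.
move=> L0 m0; rewrite le_eqVlt => /predU1P[<-|t0].
  by rewrite set_itv1 Rintegral_set1 mulr_ge0 ?expR_ge0// divr_ge0// ltW.
pose G s : R := m / L * expR (L * s).
have dG (s : R) : is_derive s 1 G (m * expR (L * s)).
  rewrite /G; apply: is_derive_eq.
  by rewrite /GRing.scale/= mulr1; field; rewrite gt_eqF.
have H1 : {within `[0, t], continuous (fun s : R => m * expR (L * s))}.
  apply: continuous_subspaceT => s.
  apply: cvgM; first exact: cvg_cst.
  apply: (continuous_comp (f := fun s => L * s)); last exact: continuous_expR.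
  by apply: cvgM; [exact: cvg_cst|exact: cvg_id].
have H2 : derivable_oo_LRcontinuous G 0 t.
  have cG s : G @ s --> G s.
    by apply/differentiable_continuous/derivable1_diffP; have [] := dG s.
  split.
  + by move=> s _; have [] := dG s.
  + exact/cvg_at_right_filter/cG.
  + exact/cvg_at_left_filter/cG.
have H3 : {in `]0, t[, derive1 G =1 (fun s : R => m * expR (L * s))}.
  by move=> s _; rewrite derive1E; have [_ ->] := dG s.
rewrite /Rintegral (continuous_FTC2 t0 H1 H2 H3).
by rewrite -EFinB /= /G gerBl// mulr_ge0 ?expR_ge0// divr_ge0// ltW.
Qed.

Lemma time_integral_le_exp {d : nat} (b : R -> 'cV[R]_d) (L m t : R) :
  0 < L -> 0 <= m -> cpath b -> 0 <= t ->
  (forall s, 0 <= s <= t -> `|b s| <= m * expR (L * s)) ->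
  `|time_integral b t| <= m / L * expR (L * t).
Proof.
move=> L0 m0 cb t0 bm.
apply: (le_trans (time_integral_le cb _ t0 bm)); last exact: integral_exp_le.
apply: cpath_continuous => s.
apply: cvgM; first exact: cvg_cst.
apply: (continuous_comp (f := fun s => L * s)); last exact: continuous_expR.
by apply: cvgM; [exact: cvg_cst|exact: cvg_id].
Qed.

Lemma derive_time_integral {d : nat} (b : R -> 'cV[R]_d) (t : R) i :
  cpath b -> 0 < t ->
  is_derive t 1 (fun s => time_integral b s i 0) (b t i 0).
Proof.
move=> cb t0.
have -> : (fun s => time_integral b s i 0) =
    (fun s => Rintegral mu `[0, s] (fun r => b r i 0)).
  by apply/funext => s; rewrite mxE.
have cbi := cpath_coord (i := i) (j := 0) cb.
have [] := @continuous_FTC1_closed R (fun r => b r i 0) 0 t (t + 1).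
- by rewrite ltrDl.
- exact: cpath_integrable.
- by [].
- move/cpathP : cbi => /continuous_within_itvcyP[+ _]; apply.
  by rewrite in_itv/= t0.
- by move=> ? H; split=> //; rewrite -H derive1E.
Qed.

End time_integral.

(** * Picard iterates and approximate solutions *)

Section picard.
Context {R : realType} {d : nat}.
Local Notation E := ('cV[R]_d * 'cV[R]_d)%type.

Definition pair_integral (y : R -> E) (t : R) : E :=
  (time_integral (fun s => (y s).1) t, time_integral (fun s => (y s).2) t).

Lemma pair_norm_le (V W : normedModType R) (x : V * W) e :
  (`|x| <= e) = (`|x.1| <= e) && (`|x.2| <= e).
Proof. by rewrite [in LHS]/Num.norm/= ge_max. Qed.

Lemma cpath_pair_integral (y : R -> E) : cpath y -> cpath (pair_integral y).
Proof.
by move=> cy; apply: cpath_pair; apply: cpath_time_integral;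
  [exact: cpath_fst|exact: cpath_snd].
Qed.

Lemma pair_integralB (y z : R -> E) t : cpath y -> cpath z ->
  pair_integral (fun s => y s - z s) t = pair_integral y t - pair_integral z t.
Proof.
move=> cy cz; rewrite /pair_integral.
rewrite (time_integralB t (cpath_fst cy) (cpath_fst cz)).
by rewrite (time_integralB t (cpath_snd cy) (cpath_snd cz)).
Qed.

Lemma pair_integral_le_exp (y : R -> E) (L m t : R) : 0 < L -> 0 <= m -> cpath y -> 0 <= t ->
  (forall s, 0 <= s <= t -> `|y s| <= m * expR (L * s)) ->
  `|pair_integral y t| <= m / L * expR (L * t).
Proof.
move=> L0 m0 cy t0 ym; rewrite pair_norm_le; apply/andP; split=> /=.
  apply: time_integral_le_exp => // [|s st]; first exact: cpath_fst.
  by have := ym _ st; rewrite pair_norm_le => /andP[].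
apply: time_integral_le_exp => // [|s st]; first exact: cpath_snd.
by have := ym _ st; rewrite pair_norm_le => /andP[].
Qed.

Lemma pair_integral_le_cst (y : R -> E) (K t : R) : cpath y -> 0 <= t ->
  (forall s, 0 <= s <= t -> `|y s| <= K) -> `|pair_integral y t| <= K * t.
Proof.
move=> cy t0 yK; rewrite pair_norm_le; apply/andP; split=> /=.
  apply: time_integral_le_cst => // [|s st]; first exact: cpath_fst.
  by have := yK _ st; rewrite pair_norm_le => /andP[].
apply: time_integral_le_cst => // [|s st]; first exact: cpath_snd.
by have := yK _ st; rewrite pair_norm_le => /andP[].
Qed.

Variables (B : E -> E) (L : R).
Hypothesis L0 : 0 < L.
Hypothesis BL : forall x y, `|B x - B y| <= L * `|x - y|.

Lemma lipschitz_cont : continuous B.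
Proof.
move=> x; apply/cvgrPdist_lt => e e0.
have : \forall y \near x, `|x - y| < e / L.
  by have /cvgrPdist_lt/(_ (e / L)) := @cvg_id _ (nbhs x); apply; exact: divr_gt0.
apply: (@filterS _ (nbhs x)) => y xy.
by rewrite (le_lt_trans (BL _ _))// mulrC -ltr_pdivlMr.
Qed.

Definition picard_step (x : E) (w y : R -> E) (t : R) : E :=
  x + pair_integral (fun s => B (y s)) t + w t.

Fixpoint picard (x : E) (w : R -> E) (k : nat) : R -> E :=
  if k is k'.+1 then picard_step x w (picard x w k') else fun=> x.

Lemma cpath_picard_step (x : E) (w y : R -> E) : cpath w -> cpath y -> cpath (picard_step x w y).
Proof.
move=> cw cy; apply: cpathD => //; apply: cpathD; first exact: cpath_cst.
by apply: cpath_pair_integral; exact: (cpath_comp lipschitz_cont).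
Qed.

Lemma cpath_picard (x : E) (w : R -> E) k : cpath w -> cpath (picard x w k).
Proof.
by move=> cw; elim: k => [|k IH]; [exact: cpath_cst|exact: cpath_picard_step].
Qed.

(* In the norm sup_t exp(-2Lt) |y_t| a Picard step is a contraction of ratio 1/2,
   whatever the horizon. *)
Lemma picard_step_le (x : E) (w y z : R -> E) (m t : R) : cpath y -> cpath z -> 0 <= t -> 0 <= m ->
  (forall s, 0 <= s <= t -> `|y s - z s| <= m * expR (2 * L * s)) ->
  `|picard_step x w y t - picard_step x w z t| <= m / 2 * expR (2 * L * t).
Proof.
move=> cy cz t0 m0 yz.
rewrite /picard_step opprD addrACA subrr addr0 opprD addrACA subrr add0r.
have cBy : cpath (fun s => B (y s)) by exact: (cpath_comp lipschitz_cont).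
have cBz : cpath (fun s => B (z s)) by exact: (cpath_comp lipschitz_cont).
rewrite -(pair_integralB t cBy cBz).
have -> : m / 2 = (L * m) / (2 * L) by field; rewrite gt_eqF.
apply: pair_integral_le_exp => //; first by rewrite mulr_gt0.
- by rewrite mulr_ge0// ltW.
- exact: cpathB.
- move=> s st; rewrite (le_trans (BL _ _))// -mulrA ler_wpM2l ?yz ?(ltW L0)//.
Qed.

Lemma expR_le_horizon (s T : R) : s <= T -> expR (2 * L * s) <= expR (2 * L * T).
Proof. by move=> sT; rewrite ler_expR ler_wpM2l// mulr_ge0// ltW. Qed.

Lemma expR_ge1_time (s : R) : 0 <= s -> 1 <= expR (2 * L * s).
Proof. by move=> s0; rewrite -expR0 ler_expR !mulr_ge0// ltW. Qed.

(** In the weighted norm the distance m_k from y to the k-th iterate satisfies m_(k+1) <= e + m_k /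
    2 with m_0 <= K + rho; the fixed point of this recursion is 2e. *)
Lemma picard_error (x : E) (w y : R -> E) (T K rho e : R) k : cpath w -> cpath y ->
  0 <= K -> 0 <= rho -> 0 <= e -> `|x| <= K ->
  (forall t, 0 <= t <= T -> `|y t| <= rho) ->
  (forall t, 0 <= t <= T -> `|y t - picard_step x w y t| <= e) ->
  forall t, 0 <= t <= T ->
    `|y t - picard x w k t| <= ((K + rho) / 2 ^+ k + 2 * e) * expR (2 * L * t).
Proof.
move=> cw cy K0 rho0 e0 xK yrho ye; elim: k => [|k IH] t /andP[t0 tT].
  rewrite expr0 divr1 /= (@le_trans _ _ ((K + rho) * 1))//.
    by rewrite mulr1 (le_trans (ler_normB _ _))// addrC lerD// yrho// t0.
  apply: ler_pM => //; rewrite ?addr_ge0// ?lerDl ?mulr_ge0//.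
  exact: expR_ge1_time.
have := ye t; rewrite t0 tT => /(_ isT) H.
have {}IH s : 0 <= s <= t ->
    `|y s - picard x w k s| <= ((K + rho) / 2 ^+ k + 2 * e) * expR (2 * L * s).
  by move=> /andP[s0 st]; apply: IH; rewrite s0 (le_trans st).
have m0 : 0 <= (K + rho) / 2 ^+ k + 2 * e.
  by rewrite addr_ge0 ?mulr_ge0 ?addr_ge0// invr_ge0 exprn_ge0.
have := picard_step_le x w cy (@cpath_picard x w k cw) t0 m0 IH => {}IH.
rewrite -[y t](subrK (picard_step x w y t)) /= -addrA.
rewrite (le_trans (ler_normD _ _))//.
have -> : (K + rho) / 2 ^+ k.+1 + 2 * e =
    e + ((K + rho) / 2 ^+ k + 2 * e) / 2.
  by rewrite exprSr; field; rewrite expf_neq0.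
rewrite mulrDl lerD// (le_trans H)// ler_peMr//.
exact: expR_ge1_time.
Qed.

(** With A = 2K + 1 + |B 0| T, the tolerance 1 plus the size of the Picard step at the zero path is
    at most A, so the weighted norm N of y satisfies N <= A + N/2, whence 2A. The last 1 absorbs a
    remainder that is halved at each round. *)
Definition apriori_bound (K T : R) : R :=
  (2 * (2 * K + 1 + `|B 0| * T) + 1) * expR (2 * L * T).

Lemma apriori_bound_ge0 K T : 0 <= K -> 0 <= T -> 0 <= apriori_bound K T.
Proof.
by move=> K0 T0; rewrite mulr_ge0 ?expR_ge0// !addr_ge0// !mulr_ge0// !addr_ge0// !mulr_ge0.
Qed.

(** Only the tolerance 1 is asked, on any [[0, tau]], and the bound depends on T rather than on tau:
    this is the form that [no_exit] consumes. The bound [m] given by [cpath_bounded] depends on the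
    path; comparing y with its Picard step k times reduces its share to [m / 2 ^+ k], eventually
    below 1. *)
Lemma apriori (x : E) (w y : R -> E) (K T tau : R) : cpath w -> cpath y -> 0 <= K -> 0 <= T ->
  `|x| <= K -> (forall t, 0 <= t <= T -> `|w t| <= K) -> tau <= T ->
  (forall t, 0 <= t <= tau -> `|y t - picard_step x w y t| <= 1) ->
  forall t, 0 <= t <= tau -> `|y t| <= apriori_bound K T.
Proof.
move=> cw cy K0 T0 xK wK tauT ye.
have [m m0 ym] := cpath_bounded tau cy.
pose A := 2 * K + 1 + `|B 0| * T.
have A0 : 0 <= A by rewrite !addr_ge0// mulr_ge0.
have step k t : 0 <= t <= tau ->
    `|y t| <= (m / 2 ^+ k + 2 * A) * expR (2 * L * t).
  elim: k t => [|k IH] t /andP[t0 ttau].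
    rewrite expr0 divr1 (@le_trans _ _ (m * 1))//.
      by rewrite mulr1 ym// t0.
    by apply: ler_pM; rewrite ?lerDl ?mulr_ge0 ?expR_ge1_time.
  have {}IH s : 0 <= s <= t ->
      `|y s - 0| <= (m / 2 ^+ k + 2 * A) * expR (2 * L * s).
    by move=> /andP[s0 st]; rewrite subr0; apply: IH; rewrite s0 (le_trans st).
  have m0' : 0 <= m / 2 ^+ k + 2 * A.
    by rewrite addr_ge0 ?mulr_ge0// invr_ge0 exprn_ge0.
  have c0 : cpath (fun _ : R => 0 : E) by exact: cpath_cst.
  have := picard_step_le x w cy c0 t0 m0' IH => {}IH.
  have H0 : `|picard_step x w (cst 0) t| <= K + `|B 0| * T + K.
    rewrite (le_trans (ler_normD _ _))// lerD//; last by rewrite wK// t0 (le_trans ttau).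
    rewrite (le_trans (ler_normD _ _))// lerD//.
    apply: (@le_trans _ _ (`|B 0| * t)); last by rewrite ler_wpM2l// (le_trans ttau).
    by apply: pair_integral_le_cst => //; exact: (cpath_comp lipschitz_cont c0).
  have := ye t; rewrite t0 ttau => /(_ isT) H.
  rewrite -[y t](subrK (picard_step x w y t)).
  rewrite -[X in _ + X](subrK (picard_step x w (cst 0) t)).
  rewrite (le_trans (ler_normD _ _))//.
  apply: (@le_trans _ _ (1 + ((m / 2 ^+ k + 2 * A) / 2 * expR (2 * L * t)
      + (K + `|B 0| * T + K)))).
    by rewrite lerD// (le_trans (ler_normD _ _))// lerD.
  have -> : (m / 2 ^+ k.+1 + 2 * A) * expR (2 * L * t) =
     (m / 2 ^+ k + 2 * A) / 2 * expR (2 * L * t) + A * expR (2 * L * t).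
    by rewrite exprSr; field; rewrite expf_neq0.
  rewrite addrCA lerD2l (@le_trans _ _ (A * 1))//.
    by rewrite mulr1 /A; lra.
  by rewrite ler_wpM2l// expR_ge1_time.
have [k mk] : exists k : nat, m / 2 ^+ k <= 1.
  exists (Num.truncn m).+1; rewrite ler_pdivrMr ?exprn_gt0// mul1r.
  rewrite (le_trans (ltW (truncnS_gt m)))//.
  by rewrite -natrX ler_nat ltnW// ltn_expl.
move=> t tT; rewrite (le_trans (step k t tT))//.
case/andP: tT => t0 ttau.
apply: ler_pM; rewrite ?expR_ge0 ?expR_le_horizon//.
- by rewrite addr_ge0 ?mulr_ge0// invr_ge0 exprn_ge0.
- by rewrite [leRHS]addrC lerD2r.
- by rewrite (le_trans ttau).
Qed.

End picard.

(** Continuity argument. Let tau be the supremum of the times up to which the bound r holds. Just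
    after tau the path is within 1 of [y tau], hence below r + 1, and the hypothesis improves this
    to r; so tau cannot be less than T. *)
Lemma no_exit (R : realType) (V : normedModType R) (y : R -> V) (r T : R) :
  0 <= T -> cpath y -> `|y 0| <= r ->
  (forall tau, 0 <= tau <= T ->
    (forall t, 0 <= t <= tau -> `|y t| <= r + 1) ->
     forall t, 0 <= t <= tau -> `|y t| <= r) ->
  forall t, 0 <= t <= T -> `|y t| <= r.
Proof.
move=> T0 cy y0 H.
pose S := [set tau | 0 <= tau <= T /\ forall t, 0 <= t <= tau -> `|y t| <= r].
have S0 : S 0.
  by split=> [|t /andP[t0 t0']]; [rewrite lexx|have -> : t = 0 by apply/le_anti/andP].
have supS : has_sup S by split; [exists 0|exists T => s [/andP[]]].
pose tau := sup S.
have tau0 : 0 <= tau by apply: ub_le_sup => //; case: supS.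
have tauT : tau <= T by apply: ge_sup; [exists 0|move=> s [/andP[]]].
have lttau t : 0 <= t < tau -> `|y t| <= r.
  move=> /andP[t0 ttau]; have e0 : 0 < tau - t by rewrite subr_gt0.
  have [s [_ Ss]] := sup_adherent e0 supS.
  by rewrite subKr => ts; apply: Ss; rewrite t0 ltW.
have near_tau e : 0 < e -> exists2 a, 0 < a &
    forall s, 0 <= s -> `|tau - s| < a -> `|y tau - y s| < e.
  move=> e0; have /cvgrPdist_lt/(_ e e0) := cy tau.
  move=> /nbhs_ballP[a /= a0 Ha]; exists a => // s s0 sa.
  by have := Ha s sa; rewrite /= !positive_partE.
(* The bound passes to the supremum itself by continuity from the left. *)
have ytau : `|y tau| <= r.
  have [tau_gt0|tau_le0] := ltP 0 tau; last first.
    by have -> : tau = 0 by apply/le_anti/andP.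
  apply/ler_addgt0Pr => e e0; have [a a0 Ha] := near_tau e e0.
  pose s := Num.max 0 (tau - a / 2).
  have s0 : 0 <= s by rewrite le_max lexx.
  have stau : s < tau by rewrite gt_max tau_gt0 ltrBlDr ltrDl divr_gt0.
  rewrite -[y tau](subrK (y s)) (le_trans (ler_normD _ _))// addrC lerD//.
    by rewrite lttau// s0.
  rewrite ltW// Ha// gtr0_norm ?subr_gt0// ltrBlDr -ltrBlDl lt_max.
  by apply/orP; right; rewrite ltrD2l ltrN2 ltr_pdivrMr// mulr_natr mulr2n ltrDl.
have [a a0 Ha] := near_tau 1 ltr01.
pose tau' := Num.min T (tau + a / 2).
have a20 : 0 < a / 2 by rewrite divr_gt0.
have tau'0 : 0 <= tau' by rewrite le_min T0/= addr_ge0// ltW.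
have tau'T : tau' <= T by rewrite ge_min lexx.
have Stau' : S tau'.
  split; first by rewrite tau'0.
  apply: H; first by rewrite tau'0.
  move=> t /andP[t0 ttau']; have [ttau|taut] := ltP t tau.
    by rewrite (le_trans (lttau t _)) ?t0// lerDl.
  have : `|tau - t| < a.
    rewrite distrC ger0_norm ?subr_ge0// ltrBlDl (@le_lt_trans _ _ (tau + a / 2))//.
      by move: ttau'; rewrite le_min => /andP[].
    by rewrite ltrD2l ltr_pdivrMr// mulr_natr mulr2n ltrDl.
  move=> /(Ha t t0) ya.
  rewrite -[y t](subKr (y tau)) (le_trans (ler_normB _ _))// lerD// ltW//.
have TT : tau' = T.
  have := ub_le_sup (proj2 supS) Stau'; rewrite -/tau {1}/tau' ge_min.
  move=> /orP[Ttau|]; last by rewrite gerDl leNgt a20.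
  by apply/min_idPl; rewrite (le_trans Ttau)// lerDl ltW.
by case: Stau'; rewrite TT.
Qed.

(** * Bounds on balls for the coefficients *)

Section local_bounds.
Context {R : realType} {d : nat}.
Implicit Types (f : 'cV[R]_d -> R) (q : 'cV[R]_d).

(** Compactness of the closed ball is taken from row vectors, hence the transpositions. *)
Lemma continuous_bounded_ball {V : normedModType R} (f : 'cV[R]_d -> V) (r : R) :
  continuous f -> exists2 K, 0 <= K & forall q, `|q| <= r -> `|f q| <= K.
Proof.
move=> cf.
pose S : set 'rV[R]_d := [set v | `|v| <= r].
have cS : compact S.
  apply: bounded_closed_compact.
    exists r; split; first exact: num_real.
    by move=> x rx v /= vr; rewrite (le_trans vr)// ltW.
  rewrite (_ : S = (fun v : 'rV[R]_d => `|v|) @^-1` [set x | x <= r])//.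
  apply: preimage_closed; last exact: closed_le.
  by move=> v _; exact: norm_continuous.
have cfT : continuous (fun v : 'rV[R]_d => f v^T).
  move=> v; apply: (continuous_comp (f := fun v : 'rV[R]_d => v^T)); last exact: cf.
  by apply: (trmx_continuous (f := id)); exact: cvg_id.
have /compact_bounded[K [_ HK]] : compact ((fun v : 'rV[R]_d => f v^T) @` S).
  by apply: continuous_compact => //; exact: continuous_subspaceT.
exists (Num.max 0 K + 1); first by rewrite addr_ge0// le_max lexx.
move=> q qr; apply: HK.
  by rewrite (@le_lt_trans _ _ (Num.max 0 K)) ?ltrDl// le_max lexx orbT.
by exists q^T; [rewrite /S/= mx_norm_trmx|rewrite trmxK].
Qed.

Lemma smooth_differentiable f q : smooth f -> differentiable f q.
Proof. by move=> sf; exact: (sf [::]). Qed.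

Lemma smooth_partial f i : smooth f -> smooth (partial i f).
Proof. by move=> sf s q; rewrite -foldr_rcons -cats1; exact: sf. Qed.

Lemma smooth_continuous f : smooth f -> continuous f.
Proof. by move=> sf q; exact/differentiable_continuous/smooth_differentiable. Qed.

Lemma derive_partial f q v : differentiable f q ->
  'D_v f q = \sum_i v i 0 * partial i f q.
Proof.
move=> df; rewrite deriveE//.
have {1}-> : v = \sum_i v i 0 *: delta_mx i 0.
  rewrite {1}[v]matrix_sum_delta; apply: eq_bigr => i _.
  by rewrite big_ord1.
rewrite linear_sum; apply: eq_bigr => i _.
by rewrite linearZ /partial deriveE.
Qed.

Lemma derive_norm_le f q v K : differentiable f q ->
  (forall i, `|partial i f q| <= K) -> `|'D_v f q| <= d%:R * K * `|v|.
Proof.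
move=> df fK; rewrite derive_partial// (le_trans (ler_norm_sum _ _ _))//.
rewrite -mulrA mulr_natl -[X in _ *+ X]card_ord -sumr_const ler_sum// => i _.
by rewrite normrM mulrC ler_pM// mx_norm_coord.
Qed.

Lemma segment_norm_le (x y : 'cV[R]_d) (r t : R) : `|x| <= r -> `|y| <= r ->
  0 <= t <= 1 -> `|y + t *: (x - y)| <= r.
Proof.
move=> xr yr /andP[t0 t1].
have -> : y + t *: (x - y) = t *: x + (1 - t) *: y.
  by apply/matrixP => i j; rewrite !mxE; ring.
rewrite (le_trans (ler_normD _ _))// !mx_normZ !ger0_norm ?subr_ge0//.
have -> : r = t * r + (1 - t) * r by ring.
by rewrite lerD// ler_wpM2l// subr_ge0.
Qed.

(** Mean value theorem along the segment from y to x, which stays in the ball by convexity. *)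
Lemma lipschitz_ball f (r K : R) : (forall q, differentiable f q) ->
  (forall q, `|q| <= r -> forall i, `|partial i f q| <= K) ->
  forall x y, `|x| <= r -> `|y| <= r -> `|f x - f y| <= d%:R * K * `|x - y|.
Proof.
move=> df fK x y xr yr.
pose g (t : R) := f (y + t *: (x - y)).
pose dg (t : R) := 'D_(x - y) f (y + t *: (x - y)).
have dl (t : R) : is_diff t (fun t : R => y + t *: (x - y)) ( *:%R^~ (x - y)).
  apply: is_diff_eq.
  by apply/funext => s; rewrite /= add0r.
have gd (t : R) : is_derive t 1 g (dg t).
  have dft : differentiable f (y + t *: (x - y)) by [].
  have dgt : differentiable g t.
    by apply: (differentiable_comp (f := fun t : R => y + t *: (x - y))).
  split; first exact: diff_derivable.
  rewrite deriveE// (diff_comp (f := fun t : R => y + t *: (x - y)))//=.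
  have [_ ->] := dl t.
  by rewrite /= scale1r /dg deriveE.
have [c c01] : exists2 c, c \in `[0, 1] & g 1 - g 0 = dg c * (1 - 0).
  apply: MVT_segment => //.
  by apply: derivable_within_continuous => t _; have [] := gd t.
rewrite /g scale1r scale0r addr0 subrKC subr0 mulr1 => ->.
have c01' : 0 <= c <= 1 by move: c01; rewrite in_itv.
by apply: derive_norm_le => // i; apply: fK; exact: segment_norm_le.
Qed.

Lemma smooth_local_bound f (r : R) : smooth f ->
  exists2 K, 0 <= K & forall q, `|q| <= r ->
    `|f q| <= K /\ forall i, `|partial i f q| <= K.
Proof.
move=> sf.
have [K0 K00 HK0] := continuous_bounded_ball r (smooth_continuous sf).
pose g q : 'cV[R]_d := grad f q.
have cg : continuous g.
  move=> q; apply: mx_continuous => i j.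
  rewrite (_ : (fun _ => _) = partial i f); last by apply/funext => ?; rewrite mxE.
  exact: (smooth_continuous (smooth_partial i sf)).
have [K1 K10 HK1] := continuous_bounded_ball r cg.
exists (Num.max K0 K1); first by rewrite le_max K00.
move=> q qr; split; first by rewrite le_max HK0.
move=> i; rewrite le_max; apply/orP; right; apply: le_trans (HK1 q qr).
by apply: le_trans (mx_norm_coord _ i 0); rewrite mxE.
Qed.

Lemma smooth_lipschitz_ball f (r : R) : smooth f -> exists2 K, 0 <= K &
  forall x y, `|x| <= r -> `|y| <= r -> `|f x - f y| <= K * `|x - y|.
Proof.
move=> sf; have [K K0 HK] := smooth_local_bound r sf.
exists (d%:R * K); first by rewrite mulr_ge0.
apply: lipschitz_ball => [q|q qr i]; first exact: smooth_differentiable.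
by have [_] := HK q qr; exact.
Qed.

End local_bounds.

(** * Families depending on nu^2, and the logarithm of a determinant *)

Section perturbation.
Context {R : realType} {d : nat}.
Implicit Types (r : R) (w : R -> R) (h g : R -> 'cV[R]_d -> R).

(* On the ball of radius r the family h_s is C^1 in q, within O(s) of h_0, with a
   gradient O(w s); it is used with s = nu^2.  The weights w = 1 and w = id are
   those of smooth functions and of the nu-dependent part of det M_nu. *)
Definition perturbation r w h : Prop :=
  [/\ forall s q, differentiable (h s) q,
  forall s i, continuous (partial i (h s)) &
  exists2 K, 0 <= K & forall s q, 0 <= s <= 1 -> `|q| <= r ->
    [/\ `|h s q| <= K, `|h s q - h 0 q| <= K * s &
        forall i, `|partial i (h s) q| <= K * w s]].

Lemma perturbation_smooth r f : smooth f ->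
  perturbation r (cst 1) (fun=> f).
Proof.
move=> sf; split=> [s q|s i|]; first exact: smooth_differentiable.
  exact/smooth_continuous/smooth_partial.
have [K K0 HK] := smooth_local_bound r sf; exists K => // s q /andP[s0 _] qr.
have [fK dfK] := HK q qr; split=> // [|i]; last by rewrite mulr1.
by rewrite subrr normr0 mulr_ge0.
Qed.

Lemma perturbation_cst r w (c : R) : (forall s, 0 <= s <= 1 -> 0 <= w s) ->
  perturbation r w (fun _ _ => c).
Proof.
move=> w0; split=> [s q|s i|]; first exact: differentiable_cst.
  rewrite (_ : partial _ _ = cst 0); first exact: cst_continuous.
  by apply/funext => q; rewrite /partial derive_cst.
exists `|c| => // s q s01 _; split=> // [|i].
  by rewrite subrr normr0 mulr_ge0//; case/andP: s01.
by rewrite /partial derive_cst normr0 mulr_ge0// w0.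
Qed.

Lemma perturbationD r w h g : (forall s, 0 <= s <= 1 -> 0 <= w s) ->
  perturbation r w h -> perturbation r w g ->
  perturbation r w (fun s q => h s q + g s q).
Proof.
move=> w0 [dh ch [K K0 HK]] [dg cg [K' K'0 HK']]; split=> [s q|s i|].
- exact: differentiableD.
- rewrite (_ : partial _ _ = (fun q => partial i (h s) q + partial i (g s) q)).
    by move=> q; exact: (cvgD (ch s i q) (cg s i q)).
  by apply/funext => q; rewrite /partial deriveD//; exact: diff_derivable.
exists (K + K'); first exact: addr_ge0.
move=> s q s01 qr; have [h1 h2 h3] := HK s q s01 qr.
have [g1 g2 g3] := HK' s q s01 qr; split=> [||i].
- by rewrite (le_trans (ler_normD _ _))// lerD.
- by rewrite opprD addrACA mulrDl (le_trans (ler_normD _ _))// lerD.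
- rewrite /partial deriveD; try exact: diff_derivable.
  by rewrite mulrDl (le_trans (ler_normD _ _))//; exact: lerD (h3 i) (g3 i).
Qed.

Lemma perturbationM r w h g : (forall s, 0 <= s <= 1 -> 0 <= w s) ->
  perturbation r w h -> perturbation r w g ->
  perturbation r w (fun s q => h s q * g s q).
Proof.
move=> w0 [dh ch [K K0 HK]] [dg cg [K' K'0 HK']]; split=> [s q|s i|].
- exact: differentiableM.
- rewrite (_ : partial _ _ =
    (fun q => h s q * partial i (g s) q + g s q * partial i (h s) q)).
    move=> q; have ch0 := differentiable_continuous (dh s q).
    have cg0 := differentiable_continuous (dg s q).
    exact: (cvgD (cvgM ch0 (cg s i q)) (cvgM cg0 (ch s i q))).
  by apply/funext => q; rewrite /partial deriveM//; exact: diff_derivable.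
exists (2 * K * K'); first by rewrite !mulr_ge0.
move=> s q s01 qr; have [h1 h2 h3] := HK s q s01 qr.
have [g1 g2 g3] := HK' s q s01 qr.
have /HK /(_ qr)[h01 _ _] : 0 <= (0 : R) <= 1 by rewrite lexx ler01.
split=> [||i].
- rewrite normrM; apply: (@le_trans _ _ (K * K')); first exact: ler_pM.
  by rewrite ler_wpM2r// ler_peMl// ler1n.
- have -> : h s q * g s q - h 0 q * g 0 q =
     (h s q - h 0 q) * g s q + h 0 q * (g s q - g 0 q) by ring.
  rewrite (le_trans (ler_normD _ _))// !normrM.
  have -> : 2 * K * K' * s = (K * s) * K' + K * (K' * s) by ring.
  by rewrite lerD// ler_pM.
- rewrite /partial deriveM; try exact: diff_derivable.
  rewrite (le_trans (ler_normD _ _))// /GRing.scale/= !normrM.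
  have -> : 2 * K * K' * w s = K * (K' * w s) + K' * (K * w s) by ring.
  by apply: lerD; apply: ler_pM => //; [exact: g3|exact: h3].
Qed.

Lemma perturbation_sum r w (I : Type) (s : seq I) (P : pred I)
    (h : I -> R -> 'cV[R]_d -> R) : (forall s, 0 <= s <= 1 -> 0 <= w s) ->
  (forall i, perturbation r w (h i)) ->
  perturbation r w (fun t q => \sum_(i <- s | P i) h i t q).
Proof.
move=> w0 ph; elim: s => [|i s IH].
  rewrite (_ : (fun _ => _) = (fun _ _ => 0)); first exact: perturbation_cst.
  by apply/funext => t; apply/funext => q; rewrite big_nil.
rewrite (_ : (fun _ => _) = (fun t q =>
    (if P i then h i t q else 0) + \sum_(i <- s | P i) h i t q)).
  by apply: perturbationD => //; case: (P i) => //; exact: perturbation_cst.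
apply/funext => t; apply/funext => q; rewrite big_cons.
by case: ifPn => // _; rewrite add0r.
Qed.

Lemma perturbation_prod r w (I : Type) (s : seq I) (P : pred I)
    (h : I -> R -> 'cV[R]_d -> R) : (forall s, 0 <= s <= 1 -> 0 <= w s) ->
  (forall i, perturbation r w (h i)) ->
  perturbation r w (fun t q => \prod_(i <- s | P i) h i t q).
Proof.
move=> w0 ph; elim: s => [|i s IH].
  rewrite (_ : (fun _ => _) = (fun _ _ => 1)); first exact: perturbation_cst.
  by apply/funext => t; apply/funext => q; rewrite big_nil.
rewrite (_ : (fun _ => _) = (fun t q =>
    (if P i then h i t q else 1) * \prod_(i <- s | P i) h i t q)).
  by apply: perturbationM => //; case: (P i) => //; exact: perturbation_cst.
apply/funext => t; apply/funext => q; rewrite big_cons.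
by case: ifPn => // _; rewrite mul1r.
Qed.

(** The factor s vanishes at s = 0, so it improves the weight from 1 to s: the gradient becomes
    O(s). *)
Lemma perturbation_scale r h : perturbation r (cst 1) h ->
  perturbation r id (fun s q => s * h s q).
Proof.
move=> [dh ch [K K0 HK]]; split=> [s q|s i|]; first exact: differentiableZ.
  rewrite (_ : partial _ _ = (fun q => s * partial i (h s) q)).
    by move=> q; exact: (cvgM (cvg_cst s) (ch s i q)).
  by apply/funext => q; rewrite /partial deriveZ//; exact: diff_derivable.
exists K => // s q s01 qr; have [h1 h2 h3] := HK s q s01 qr.
case/andP: (s01) => s0 s1; split=> [||i].
- by rewrite normrM ger0_norm// (le_trans _ h1)// ler_piMl.
- by rewrite mul0r subr0 normrM ger0_norm// mulrC ler_wpM2r.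
- rewrite /partial deriveZ; last exact: diff_derivable.
  by rewrite normrM ger0_norm// mulrC ler_wpM2r// (le_trans (h3 i))// mulr1.
Qed.

(** The Leibniz expansion makes the determinant a polynomial in the entries, so stability under sums
    and products is enough. *)
Lemma perturbation_det r w k (H : R -> 'cV[R]_d -> 'M[R]_k) :
  (forall s, 0 <= s <= 1 -> 0 <= w s) ->
  (forall i j, perturbation r w (fun s q => H s q i j)) ->
  perturbation r w (fun s q => \det (H s q)).
Proof.
move=> w0 pH; apply: perturbation_sum => // sig.
apply: perturbationM => //; first exact: perturbation_cst.
by apply: perturbation_prod.
Qed.

Lemma partial_ln_pos (f : 'cV[R]_d -> R) q i : differentiable f q -> 0 < f q ->
  derivable (fun q => ln (f q)) q (delta_mx i 0) /\
  partial i (fun q => ln (f q)) q = (f q)^-1 * partial i f q.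
Proof.
move=> df f0.
have dln : differentiable (@ln R) (f q).
  by apply/derivable1_diffP; have [] := is_derive1_ln f0.
have dlnf : differentiable (fun q => ln (f q)) q.
  exact: (differentiable_comp (f := f)).
split; first exact: diff_derivable.
rewrite /partial deriveE// (diff_comp (f := f))//= diff1E// derive1E.
have [_ ->] := is_derive1_ln f0.
by rewrite -deriveE// /GRing.scale/= mulrC.
Qed.

(* [ln] is 0 on negative numbers, so that only [f q != 0] matters for the
   regularity of [ln \o f], and the sign of the determinant is never needed. *)
Lemma partial_ln_neg (f : 'cV[R]_d -> R) q i : {for q, continuous f} -> f q < 0 ->
  derivable (fun q => ln (f q)) q (delta_mx i 0) /\
  partial i (fun q => ln (f q)) q = 0.
Proof.
move=> cf f0.
have lnf0 : \forall u \near q, cst 0 u = ln (f u).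
  have := cvgr_lt _ cf _ f0.
  move=> /(_ (nbhs_filter q)); apply: (@filterS _ (nbhs q)) => u /= fu0.
  by rewrite ln0// ltW.
split; first exact: near_eq_derivable lnf0 (derivable_cst _ _ _).
by rewrite /partial -(near_eq_derive (delta_mx i 0) lnf0) derive_cst.
Qed.

Lemma derivable_partial_ln (f : 'cV[R]_d -> R) q i : differentiable f q -> f q != 0 ->
  derivable (fun q => ln (f q)) q (delta_mx i 0).
Proof.
move=> df; rewrite neq_lt => /orP[f0|f0].
  by have [] := partial_ln_neg i (differentiable_continuous df) f0.
by have [] := partial_ln_pos i df f0.
Qed.

(** The derivative is that of f divided by f, or 0 where f is negative; being within half of [|c|]
    of c keeps [|f q|] above [|c| / 2], hence the factor 2. *)
Lemma partial_ln_le (f : 'cV[R]_d -> R) q i (c K : R) :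
  c != 0 -> 0 <= K -> differentiable f q ->
  `|f q - c| <= `|c| / 2 -> `|partial i f q| <= K ->
  `|partial i (fun q => ln (f q)) q| <= 2 * K / `|c|.
Proof.
move=> c0 K0 df fc fK.
have c0' : 0 < `|c| by rewrite normr_gt0.
have fc2 : `|c| / 2 <= `|f q|.
  have : `|c| <= `|c - f q| + `|f q|.
    by rewrite -{1}[c](subrK (f q)) ler_normD.
  by rewrite distrC => H; lra.
have f0 : 0 < `|f q| by rewrite (lt_le_trans _ fc2)// divr_gt0.
have : f q != 0 by rewrite -normr_gt0.
rewrite neq_lt => /orP[fq0|fq0].
  have [_ ->] := partial_ln_neg i (differentiable_continuous df) fq0.
  by rewrite normr0 divr_ge0 ?mulr_ge0// ltW.
have [_ ->] := partial_ln_pos i df fq0.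
rewrite normrM normfV mulrC.
apply: (@le_trans _ _ (K * (2 / `|c|))); last by rewrite mulrCA mulrA.
apply: ler_pM => //.
by rewrite -[leRHS]invf_div lef_pV2 ?posrE// divr_gt0.
Qed.

(** Near each point f keeps its sign, so the partial derivative coincides locally with 0 or with the
    usual quotient. *)
Lemma partial_ln_continuous (f : 'cV[R]_d -> R) i :
  (forall q, differentiable f q) -> continuous (partial i f) ->
  (forall q, f q != 0) -> continuous (partial i (fun q => ln (f q))).
Proof.
move=> df cdf f_neq0 q.
have cf u : {for u, continuous f} by exact: differentiable_continuous.
have := f_neq0 q; rewrite neq_lt => /orP[f0|f0].
  have near0 : \forall u \near q, cst 0 u = partial i (fun q => ln (f q)) u.
    have := cvgr_lt _ (cf q) _ f0; move=> /(_ (nbhs_filter q)).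
    by apply: (@filterS _ (nbhs q)) => u /(partial_ln_neg i (cf u))[_ ->].
  rewrite /continuous_at; have [_ ->] := partial_ln_neg i (cf q) f0.
  apply: cvg_trans; first exact: near_eq_cvg near0.
  exact: cvg_cst.
have near_pos : \forall u \near q,
    (f u)^-1 * partial i f u = partial i (fun q => ln (f q)) u.
  have := cvgr_gt _ (cf q) _ f0; move=> /(_ (nbhs_filter q)).
  by apply: (@filterS _ (nbhs q)) => u /(partial_ln_pos i (df u))[_ ->].
rewrite /continuous_at; have [_ ->] := partial_ln_pos i (df q) f0.
apply: cvg_trans; first exact: near_eq_cvg near_pos.
exact: (cvgM (cvgV (f_neq0 q) (cf q)) (cdf q)).
Qed.

End perturbation.

Section constraint_bounds.
Context {R : realType} {d n : nat}.
Variables (M : 'M[R]_d) (Mz : 'M[R]_n) (beta : R) (xi : 'cV[R]_d -> 'cV[R]_n).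
Hypotheses (hM : sym_pos_def M) (hbeta : 0 < beta).
Hypothesis hxi : forall i, smooth (fun q => xi q i 0).

Lemma sym_pos_def_det k (A : 'M[R]_k) : sym_pos_def A -> \det A != 0.
Proof.
move=> hA.
apply/negP => /det0P[v v0 vM]; have [_ /(_ v^T)] := hA.
rewrite trmxK vM mul0mx mxE ltxx => /(_ _)/negP; apply => //.
by apply: contra v0 => /eqP/(congr1 trmx); rewrite trmxK trmx0 => ->.
Qed.

Lemma smooth_gradmx i j : smooth (fun q => gradmx xi q i j).
Proof.
rewrite (_ : (fun _ => _) = partial i (fun q => xi q j 0)).
  exact: smooth_partial.
by apply/funext => q; rewrite mxE.
Qed.

Definition gram (q : 'cV[R]_d) : 'M[R]_d :=
  gradmx xi q *m Mz *m (gradmx xi q)^T.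

Lemma perturbation_gram r i j :
  perturbation r (cst 1) (fun _ q => gram q i j).
Proof.
have ps k l := perturbation_smooth r (smooth_gradmx k l).
have c1 (s : R) : 0 <= s <= 1 -> 0 <= cst (1 : R) s by rewrite /= ler01.
rewrite (_ : (fun _ => _) = (fun _ q =>
    \sum_k (\sum_l gradmx xi q i l * Mz l k) * gradmx xi q j k)); last first.
  apply/funext => s; apply/funext => q; rewrite mxE; apply: eq_bigr => k _.
  by rewrite !mxE.
apply: perturbation_sum => // k; apply: perturbationM => //.
apply: perturbation_sum => // l; apply: perturbationM => //.
exact: perturbation_cst.
Qed.

(** With s = nu^2, the determinant of [M + s *: gram q] has a gradient O(s), being constant in q at
    s = 0, and stays near [\det M], which is nonzero; dividing gives O(nu^2). *)
Lemma grad_V_fix_bound (r : R) : exists2 C, 0 <= C &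
  exists2 nu0, 0 < nu0 & forall nu q, 0 < nu -> nu < nu0 -> `|q| <= r ->
    `|grad (V_fix M Mz beta xi nu) q| <= C * nu ^+ 2.
Proof.
have c1 (s : R) : 0 <= s <= 1 -> 0 <= id s by case/andP.
pose H (s : R) q := \det (M + s *: gram q).
have [dH _ [K K0 HK]] : perturbation r id H.
  apply: perturbation_det => // i j.
  rewrite (_ : (fun _ => _) = (fun s q => M i j + s * gram q i j)).
    apply: perturbationD => //; first exact: perturbation_cst.
    by apply: perturbation_scale; exact: perturbation_gram.
  by apply/funext => s; apply/funext => q; rewrite !mxE.
have detM := sym_pos_def_det hM.
have detM0 : 0 < `|\det M| by rewrite normr_gt0.
exists ((2 * beta)^-1 * (2 * K / `|\det M|)).
  by rewrite mulr_ge0// ?invr_ge0 ?divr_ge0 ?mulr_ge0// ltW.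
(* This makes [K * nu ^+ 2 <= (K + 1) * nu <= |det M| / 2], as [partial_ln_le] asks; [K + 1] is
   positive even for K = 0. *)
exists (Num.min 1 (`|\det M| / 2 / (K + 1))).
  by rewrite lt_min ltr01 !divr_gt0// ltr_wpDl.
move=> nu q nu0; rewrite lt_min => /andP[nu1 nuM] qr.
have s01 : 0 <= nu ^+ 2 <= 1.
  by rewrite exprn_ge0 ?exprn_ile1// ltW.
have [_ HM dHs] := HK (nu ^+ 2) q s01 qr.
rewrite {2}/H scale0r addr0 in HM.
have nu2 : nu ^+ 2 <= nu by rewrite expr2 ler_piMl// ltW.
have HM2 : `|H (nu ^+ 2) q - \det M| <= `|\det M| / 2.
  rewrite (le_trans HM)// (@le_trans _ _ ((K + 1) * nu))//.
    by rewrite ler_pM ?(exprn_ge0 _ (ltW nu0)) ?lerDl.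
  by rewrite mulrC -ler_pdivlMr ?ltW// ltr_wpDl.
have C0 : 0 <= (2 * beta)^-1 * (2 * K / `|\det M|) * nu ^+ 2.
  by rewrite !mulr_ge0// ?invr_ge0 ?mulr_ge0// ltW.
apply: mx_norm_le => // i j; rewrite mxE /partial.
rewrite (_ : V_fix _ _ _ _ _ =
  (2 * beta)^-1 *: (fun q => ln (H (nu ^+ 2) q) : R)); last by [].
have b0 : 0 <= (2 * beta)^-1 by rewrite invr_ge0 mulr_ge0// ltW.
have K0' : 0 <= K * nu ^+ 2 by rewrite mulr_ge0// exprn_ge0// ltW.
have dln : derivable (fun q => ln (H (nu ^+ 2) q)) q (delta_mx i 0).
  apply: derivable_partial_ln; first exact: dH.
  rewrite -normr_gt0; have : `|\det M| <= `|\det M - H (nu ^+ 2) q| + `|H (nu ^+ 2) q|.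
    by rewrite -{1}[\det M](subrK (H (nu ^+ 2) q)) ler_normD.
  by rewrite distrC => ?; lra.
have ln_le := partial_ln_le detM K0' (dH (nu ^+ 2) q) HM2 (dHs i).
rewrite deriveZ// /GRing.scale/= normrM (ger0_norm b0) -[leRHS]mulrA ler_wpM2l//.
have -> : 2 * K / `|\det M| * nu ^+ 2 = 2 * (K * nu ^+ 2) / `|\det M| by ring.
exact: ln_le.
Qed.

Lemma M_nuE nu q : M_nu M Mz xi nu q = M + nu ^+ 2 *: gram q.
Proof. by []. Qed.

Hypothesis hMz : sym_pos_def Mz.

Lemma sym_pos_def_M_nu nu q : sym_pos_def (M_nu M Mz xi nu q).
Proof.
have [MT M0] := hM; have [MzT Mz0] := hMz; rewrite M_nuE /gram; split.
  by rewrite linearD linearZ /= !trmx_mul trmxK MT MzT mulmxA.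
move=> x x0; rewrite mulmxDr mulmxDl mxE ltr_pwDl ?M0//.
rewrite -scalemxAr -scalemxAl mxE mulr_ge0 ?sqr_ge0//.
have -> : x^T *m (gradmx xi q *m Mz *m (gradmx xi q)^T) *m x =
    ((gradmx xi q)^T *m x)^T *m Mz *m ((gradmx xi q)^T *m x).
  by rewrite trmx_mul trmxK !mulmxA.
have [->|y0] := eqVneq ((gradmx xi q)^T *m x) 0; last exact/ltW/Mz0.
by rewrite mulmx0 mxE.
Qed.

(** Makes the [V_fix] force a continuous function of time along a path, so that its integral can be
    split off from that of the Langevin drift. Here nu is fixed, and positivity of [M_nu] keeps the
    determinant nonzero at every q. *)
Lemma grad_V_fix_continuous nu : continuous (grad (V_fix M Mz beta xi nu)).
Proof.
have c1 (s : R) : 0 <= s <= 1 -> 0 <= id s by case/andP.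
pose H (s : R) q := \det (M + s *: gram q).
(* The two regularity clauses of [perturbation] hold at every q, whatever the radius; 0 is an
   arbitrary choice. *)
have [dH cH _] : perturbation 0 id H.
  apply: perturbation_det => // i j.
  rewrite (_ : (fun _ => _) = (fun s q => M i j + s * gram q i j)).
    apply: perturbationD => //; first exact: perturbation_cst.
    by apply: perturbation_scale; exact: perturbation_gram.
  by apply/funext => s; apply/funext => q; rewrite !mxE.
have H0 q : H (nu ^+ 2) q != 0.
  exact: (sym_pos_def_det (sym_pos_def_M_nu nu q)).
move=> q; apply: mx_continuous => i j.
rewrite (_ : (fun _ => _) =
    (fun q => (2 * beta)^-1 * partial i (fun q => ln (H (nu ^+ 2) q)) q)).
  exact: (cvgM (cvg_cst _) (partial_ln_continuous (dH _) (cH _ i) H0 (x := q))).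
apply/funext => u; rewrite mxE /partial.
rewrite (_ : V_fix _ _ _ _ _ =
  (2 * beta)^-1 *: (fun q => ln (H (nu ^+ 2) q) : R)); last by [].
by rewrite deriveZ//; apply: derivable_partial_ln; [exact: dH|exact: H0].
Qed.

Lemma gradmx_continuous : continuous (gradmx xi).
Proof.
by move=> q; apply: mx_continuous => i j; exact/smooth_continuous/smooth_gradmx.
Qed.

Lemma gram_continuous : continuous gram.
Proof.
move=> q; apply: (mulmx_continuous (f := fun q => gradmx xi q *m Mz)
  (g := fun q => (gradmx xi q)^T)); last exact/trmx_continuous/gradmx_continuous.
apply: (mulmx_continuous (g := fun=> Mz)); first exact: gradmx_continuous.
exact: cst_continuous.
Qed.

Lemma gradmx_lipschitz_ball (r : R) : exists2 K, 0 <= K &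
  forall x y, `|x| <= r -> `|y| <= r ->
    `|gradmx xi x - gradmx xi y| <= K * `|x - y|.
Proof.
(* The constants are chosen entry by entry in a sigma type, so that their sum serves all entries. *)
have H (ij : 'I_d * 'I_n) : {K : R | 0 <= K & forall x y, `|x| <= r -> `|y| <= r ->
    `|gradmx xi x ij.1 ij.2 - gradmx xi y ij.1 ij.2| <= K * `|x - y|}.
  by apply: cid2; exact: (smooth_lipschitz_ball r (smooth_gradmx ij.1 ij.2)).
have H0 ij : 0 <= s2val (H ij) by case: (H ij).
exists (\sum_ij s2val (H ij)); first exact: sumr_ge0.
move=> x y xr yr; apply: mx_norm_le => [|i j].
  by rewrite mulr_ge0// sumr_ge0.
have Hij : `|gradmx xi x i j - gradmx xi y i j| <= s2val (H (i, j)) * `|x - y|.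
  by case: (H (i, j)) => K /= _; exact.
move: Hij; rewrite !mxE => /le_trans; apply.
by rewrite ler_wpM2r// (bigD1 (i, j))//= lerDl sumr_ge0.
Qed.

End constraint_bounds.

Section drift.
Context {R : realType} {d : nat}.
Variables (M : 'M[R]_d) (V : 'cV[R]_d -> R) (gamma : 'M[R]_d).
Local Notation E := ('cV[R]_d * 'cV[R]_d)%type.

Definition langevin_drift (x : E) : E :=
  (- grad V x.2 - gamma *m (invmx M *m x.1), invmx M *m x.1).

(** The position gradient of the Hamiltonian is [grad V], so the Lipschitz bound on
    [hamiltonian_field], taken between points of zero momentum, is one on [grad V]. The rest of the
    drift is linear. *)
Lemma langevin_drift_lipschitz : smooth V -> lipschitz (hamiltonian_field M V) ->
  exists2 L, 0 < L &
    forall x y, `|langevin_drift x - langevin_drift y| <= L * `|x - y|.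
Proof.
move=> sV hH.
have [K K0 HK] : exists2 K, 0 <= K & forall x y : E,
    `|hamiltonian_field M V x - hamiltonian_field M V y| <= K * `|x - y|.
  have := hH; rewrite /lipschitz_on => /pinfty_ex_gt0[K K0 HK]; exists K; first exact: ltW.
  by move=> x y; exact: (HK (x, y)).
have gradH p q : grad (hamiltonian M V p) q = grad V q.
  apply/matrixP => i j; rewrite !mxE /partial.
  rewrite (_ : hamiltonian M V p =
    cst (2^-1 * (p^T *m invmx M *m p) 0 0) + V); last by [].
  rewrite deriveD; [|exact: derivable_cst|exact/diff_derivable/smooth_differentiable].
  by rewrite derive_cst add0r.
pose c1 := d%:R * `|invmx M|; pose c2 := d%:R * `|gamma| * c1.
have c10 : 0 <= c1 by rewrite mulr_ge0.
have c20 : 0 <= c2 by rewrite !mulr_ge0.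
(* [K + c2] serves the momentum component, [c1] the position component, and 1 gives strict
   positivity. *)
exists (K + c2 + c1 + 1); first by rewrite ltr_wpDl// !addr_ge0.
have inv_le (u v : 'cV[R]_d) : `|invmx M *m u - invmx M *m v| <= c1 * `|u - v|.
  by rewrite -mulmxBr mulmx_norm.
move=> x y.
have /andP[xy1 xy2] : (`|x.1 - y.1| <= `|x - y|) && (`|x.2 - y.2| <= `|x - y|).
  by rewrite -[_ && _](pair_norm_le (x - y)).
have V_le : `|grad V x.2 - grad V y.2| <= K * `|x - y|.
  have := HK (0, x.2) (0, y.2).
  rewrite pair_norm_le /= !gradH => /andP[+ _].
  rewrite -opprD normrN => /le_trans; apply; rewrite ler_wpM2l//.
  by rewrite pair_norm_le /= subrr normr0 normr_ge0.
have inv1 : `|invmx M *m x.1 - invmx M *m y.1| <= c1 * `|x - y|.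
  by rewrite (le_trans (inv_le _ _))// ler_wpM2l.
rewrite pair_norm_le; apply/andP; split=> /=; last first.
  by rewrite (le_trans inv1)// ler_wpM2r//; lra.
rewrite opprD !opprK addrACA (le_trans (ler_normD _ _))//.
apply: (@le_trans _ _ ((K + c2) * `|x - y|)); last by rewrite ler_wpM2r//; lra.
rewrite mulrDl; apply: lerD; first by rewrite addrC distrC.
rewrite addrC -mulmxBr (le_trans (mulmx_norm _ _))// /c2 -[leRHS]mulrA ler_wpM2l//.
by rewrite distrC.
Qed.

End drift.

(** * The constraint force along a path *)

Section stieltjes.
Context {R : realType} {d n : nat}.
Implicit Types (A : R -> 'M[R]_(d, n)) (g : R -> 'cV[R]_n).

Lemma fine_partition (t delta : R) : 0 <= t -> 0 < delta -> exists s : seq R,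
  itv_partition 0 t s /\
  forall k, (k < size s)%N -> nth t (0 :: s) k.+1 - nth t (0 :: s) k < delta.
Proof.
rewrite le_eqVlt => /predU1P[<-|t0] delta0.
  by exists [::]; split=> //; rewrite /itv_partition/=.
pose N := (Num.truncn (t / delta)).+1.
have N0 : (0 : R) < N%:R by rewrite ltr0n.
pose s := [seq t * k.+1%:R / N%:R | k <- iota 0 N].
have sz : size s = N by rewrite size_map size_iota.
have nths k : (k <= N)%N -> nth t (0 :: s) k = t * k%:R / N%:R.
  case: k => [|k] kN /=; first by rewrite mulr0 mul0r.
  by rewrite (nth_map 0%N) ?size_iota// nth_iota.
have incr k : (k < N)%N -> nth t (0 :: s) k.+1 - nth t (0 :: s) k = t / N%:R.
  move=> kN; rewrite !nths// ?(ltnW kN)// -mulrBl -mulrBr.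
  by rewrite -natrB// subSnn mulr1.
exists s; split.
  split; last by rewrite (last_nth t) sz nths// mulfK// gt_eqF.
  by apply/(pathP t) => k; rewrite sz => kN; rewrite -subr_gt0 incr// divr_gt0.
move=> k; rewrite sz => kN; rewrite incr//.
by rewrite ltr_pdivrMr// mulrC -ltr_pdivrMr// truncnS_gt.
Qed.

(* Abel summation moves the increments from g to A; only the sup norm of g - g 0
   enters, not its variation. *)
Lemma stieltjes_bound A g (t a l c : R) (I : 'cV[R]_d) :
  0 <= t -> 0 <= a -> 0 <= l -> 0 <= c ->
  (forall s, 0 <= s <= t -> `|A s| <= a) ->
  (forall s s', 0 <= s <= t -> 0 <= s' <= t -> `|A s - A s'| <= l * `|s - s'|) ->
  (forall s, 0 <= s <= t -> `|g s - g 0| <= c) ->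
  is_stieltjes_integral A g 0 t I ->
  `|I| <= n%:R * (a + l * t) * c.
Proof.
move=> t0 a0 l0 c0 Aa Al gc hI; apply/ler_addgt0Pr => e e0.
have [delta delta0 Hd] := hI e e0.
have [s [part mesh]] := fine_partition t0 delta0.
pose x := nth t (0 :: s).
have xt k : (k <= size s)%N -> 0 <= x k <= t.
  by move=> ks; rewrite /x (itv_partition_nth_ge ks part) (itv_partition_nth_le ks part).
have xinc k : (k < size s)%N -> x k <= x k.+1.
  by move=> ks; case: part => /(pathP t)/(_ k ks)/ltW.
have x0 : x 0%N = 0 by [].
(* Each tag is taken at the left end point of its interval. *)
have /Hd : forall k, (k < size s)%N -> x k <= x k <= x k.+1 /\ x k.+1 - x k < delta.
  by move=> k ks; rewrite lexx xinc//; split=> //; exact: mesh.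
move=> /(_ part).
set S := fun N => \sum_(0 <= k < N) A (x k) *m (g (x k.+1) - g (x k)).
rewrite -/(S (size s)) => SI.
(* Once the boundary term is subtracted, each step contributes one increment of A times [g - g 0],
   and the increments of A are at most l times those of x, which telescope. *)
have step N : (N <= size s)%N ->
    `|S N - A (x N) *m (g (x N) - g 0)| <= n%:R * l * c * x N.
  elim: N => [|N IH] Ns.
    by rewrite /S big_geq// x0 subrr mulmx0 subr0 normr0 mulr0.
  have -> : S N.+1 - A (x N.+1) *m (g (x N.+1) - g 0) =
      (S N - A (x N) *m (g (x N) - g 0)) +
      (A (x N) - A (x N.+1)) *m (g (x N.+1) - g 0).
    rewrite /S big_nat_recr//= !mulmxBr !mulmxBl.
    by apply/matrixP => i j; rewrite !mxE; ring.
  rewrite (le_trans (ler_normD _ _))//.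
  have -> : n%:R * l * c * x N.+1 =
     n%:R * l * c * x N + n%:R * (l * (x N.+1 - x N)) * c by ring.
  rewrite lerD ?IH// ?(ltnW Ns)// (le_trans (mulmx_norm _ _))//.
  rewrite ler_pM// ?mulr_ge0//; last by rewrite gc// xt.
  rewrite ler_wpM2l// (le_trans (Al _ _ _ _)) ?xt// ?(ltnW Ns)//.
  by rewrite distrC ger0_norm// subr_ge0 xinc.
rewrite -[I](subKr (S (size s))) (le_trans (ler_normB _ _))//.
apply: lerD; last exact: ltW.
rewrite -[S _](subrK (A (x (size s)) *m (g (x (size s)) - g 0))).
rewrite (le_trans (ler_normD _ _))//.
have /andP[xs0 xst] := xt _ (leqnn (size s)).
have -> : n%:R * (a + l * t) * c = n%:R * l * c * t + n%:R * a * c by ring.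
apply: lerD; first by rewrite (le_trans (step _ _))// ler_wpM2l// !mulr_ge0.
rewrite (le_trans (mulmx_norm _ _))// ler_pM// ?mulr_ge0//.
  by rewrite ler_wpM2l// Aa// xs0.
by rewrite gc// xs0.
Qed.

End stieltjes.

Section time_lipschitz.
Context {R : realType} {d : nat}.
Local Notation mu := (@lebesgue_measure R).

Lemma time_integral_lipschitz (b : R -> 'cV[R]_d) (K t s s' : R) : cpath b ->
  (forall r, 0 <= r <= t -> `|b r| <= K) ->
  0 <= s <= t -> 0 <= s' <= t ->
  `|time_integral b s - time_integral b s'| <= K * `|s - s'|.
Proof.
move=> cb bK; wlog : s s' / s' <= s.
  move=> H st s't; have [ss'|/ltW ss'] := leP s' s; first exact: H.
  by rewrite distrC [`|s - s'|]distrC; exact: H.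
move=> s's /andP[s0 st] /andP[s'0 s't].
have K0 : 0 <= K by rewrite (le_trans _ (bK 0 _))// lexx (le_trans s0).
apply: mx_norm_le => [|i j]; first by rewrite mulr_ge0.
rewrite !mxE (@Rintegral_itvB _ _ (BLeft 0) (BRight s) s')//; last first.
  exact/cpath_integrable/cpath_coord.
have int1 : mu.-integrable `]s', s] (EFin \o (fun r => b r i 0)).
  apply: (integrableS _ _ _ (cpath_integrable s (cpath_coord (i := i) (j := 0) cb))) => //.
  by apply: subset_itv; rewrite bnd_simp.
have int2 : mu.-integrable `]s', s] (EFin \o (fun=> K)).
  have cK : cpath (fun _ : R => K) by exact: cpath_cst.
  apply: (integrableS _ _ _ (cpath_integrable s cK)) => //.
  by apply: subset_itv; rewrite bnd_simp.
apply: (le_trans (le_normr_Rintegral _ int1)) => //.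
apply: (@le_trans _ _ (Rintegral mu `]s', s] (fun=> K))).
  apply: le_Rintegral => //.
    exact: integrable_norm int1.
  move=> r /=; rewrite in_itv/= => /andP[s'r rs]; rewrite (le_trans (mx_norm_coord _ _ _))//.
  by rewrite bK// (le_trans s'0 (ltW s'r)) (le_trans rs).
rewrite Rintegral_cst//= lebesgue_measure_itv/= lte_fin ger0_norm ?subr_ge0//.
case: ltP => [_|ss']; first by rewrite /= .
have -> : s = s' by apply/le_anti/andP.
by rewrite subrr.
Qed.

End time_lipschitz.

Section path_derivative.
Context {R : realType}.

(** Identities obtained by differentiating in time hold for t > 0 only; this extends them to t =
    0. *)
Lemma cpath_ext0 (E : normedModType R) (f g : R -> E) :
  cpath f -> cpath g -> (forall t, 0 < t -> f t = g t) -> f 0 = g 0.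
Proof.
move=> cf cg fg; apply/eqP; rewrite -subr_eq0 -normr_eq0; apply/eqP/le_anti.
rewrite normr_ge0 andbT; apply/ler_addgt0Pr => e e0; rewrite add0r.
have cfg := cpathB cf cg.
have /cvgrPdist_lt/(_ e e0)/nbhs_ballP[a /= a0 Ha] := cfg 0.
have a20 : 0 < a / 2 by rewrite divr_gt0.
have aa : `|0 - a / 2| < a.
  rewrite sub0r normrN gtr0_norm//.
  by rewrite ltr_pdivrMr// mulr_natr mulr2n ltrDl.
have := Ha _ aa; rewrite /= !positive_partE ?(ltW a20)// (fg _ a20) subrr subr0.
exact: ltW.
Qed.

Lemma derive_path {d : nat} (y b : R -> 'cV[R]_d) (t : R) : cpath b -> 0 < t ->
  (forall s, 0 <= s -> y s = y 0 + time_integral b s) -> is_derive t 1 y (b t).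
Proof.
move=> cb t0 yE.
have dy i j : is_derive t 1 (fun s => y s i j) (b t i j).
  rewrite ord1; apply: (near_eq_is_derive
      (f := fun s => y 0 i 0 + time_integral b s i 0)).
    have := lt_nbhsr t0; apply: (@filterS _ (nbhs t)) => s /ltW s0.
    by rewrite (yE s s0) [in RHS]mxE.
  have dI := derive_time_integral i cb t0.
  by have := is_deriveD (is_derive_cst (y 0 i 0) t 1) dI; rewrite add0r.
have dyt : derivable y t 1.
  by apply/derivable_mxP => i j; have [] := dy i j.
split=> //; rewrite derive_mx//; apply/matrixP => i j; rewrite mxE.
by have [_ ->] := dy i j.
Qed.

Lemma derive_along_path {d : nat} (f : 'cV[R]_d -> R) (q : R -> 'cV[R]_d) (t : R) (v : 'cV[R]_d) :
  is_derive t 1 q v -> differentiable f (q t) ->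
  is_derive t 1 (fun s => f (q s)) ('D_v f (q t)).
Proof.
move=> [dq qv] df.
have dq' : differentiable q t by exact/derivable1_diffP.
have dfq : differentiable (fun s => f (q s)) t by exact: differentiable_comp.
split; first exact: diff_derivable.
rewrite !deriveE// (diff_comp dq' df)/=.
by rewrite -qv deriveE.
Qed.

End path_derivative.

(** * Trajectories of the constrained dynamics *)

Section constrained_path.
Context {R : realType} {d n : nat}.
Variables (M : 'M[R]_d) (Mz : 'M[R]_n) (beta : R) (V : 'cV[R]_d -> R).
Variables (xi : 'cV[R]_d -> 'cV[R]_n).
Variables (gamma sigma : 'M[R]_d) (gammaz sigmaz : 'M[R]_n).

(** What remains of [constrained_process] for a single trajectory outside a null set; the estimates
    through [constrained_path_error] concern such a trajectory. *)
Record constrained_path (nu : R) (W q p : R -> 'cV[R]_d)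
    (Wz z pz lambda : R -> 'cV[R]_n) : Prop := ConstrainedPath {
  cpath_W : cpath W ;
  cpath_q : cpath q ;
  cpath_z : cpath z ;
  cpath_p : cpath p ;
  cpath_pz : cpath pz ;
  path_q : forall t, 0 <= t ->
    q t = q 0 + time_integral (fun s => invmx M *m p s) t ;
  path_z : forall t, 0 <= t ->
    z t = z 0 + time_integral (fun s => invmx Mz *m pz s) t ;
  path_p : forall t, 0 <= t ->
    is_stieltjes_integral (fun s => gradmx xi (q s)) lambda 0 t
      (p 0 + time_integral (fun s => - grad V (q s)
                                     - grad (V_fix M Mz beta xi nu) (q s)
                                     - gamma *m (invmx M *m p s)) t
        + sigma *m W t - p t) ;
  path_pz : forall t, 0 <= t ->
    pz t = pz 0 + time_integral (fun s => - (gammaz *m (invmx Mz *m pz s))) t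
      + sigmaz *m Wz t + nu^-1 *: (lambda t - lambda 0) ;
  path_constraint : forall t, 0 <= t -> xi (q t) = nu^-1 *: z t }.

Hypotheses (hM : sym_pos_def M) (hMz : sym_pos_def Mz) (hbeta : 0 < beta).
Hypotheses (hV : smooth V) (hxi : forall i, smooth (fun q => xi q i 0)).

Lemma path_momentum nu W q p Wz z pz lambda : 0 < nu ->
  constrained_path nu W q p Wz z pz lambda -> forall t, 0 <= t ->
  pz t = nu *: (Mz *m ((gradmx xi (q t))^T *m (invmx M *m p t))).
Proof.
move=> nu0 H; have cq := cpath_q H; have cp := cpath_p H; have cpz := cpath_pz H.
have cip : cpath (fun s => invmx M *m p s).
  by apply: cpath_mulmx => //; exact: cpath_cst.
have cipz : cpath (fun s => invmx Mz *m pz s).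
  by apply: cpath_mulmx => //; exact: cpath_cst.
have cAq : cpath (fun s => gradmx xi (q s)).
  exact: (cpath_comp (gradmx_continuous hxi)).
have pos t : 0 < t ->
    pz t = nu *: (Mz *m ((gradmx xi (q t))^T *m (invmx M *m p t))).
  move=> t0.
  have Mzu : Mz \in unitmx by rewrite unitmxE unitfE sym_pos_def_det.
  (* Both sides are the time derivative of [xi (q t) = nu^-1 *: z t], computed along q and along
     z. *)
  suff : (gradmx xi (q t))^T *m (invmx M *m p t) = nu^-1 *: (invmx Mz *m pz t).
    move=> ->; rewrite scalemxAr scalerA mulrV ?scale1r ?unitfE ?gt_eqF//.
    by rewrite mulKVmx.
  have tnear : \forall s \near t, 0 <= s.
    by have := lt_nbhsr t0; apply: (@filterS _ (nbhs t)) => s /ltW.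
  have dq := derive_path cip t0 (path_q H).
  have dz := derive_path cipz t0 (path_z H).
  apply/matrixP => i j; rewrite ord1.
  have [_ dxi] := derive_along_path dq (smooth_differentiable (q t) (hxi i)).
  have [_ dzi] : is_derive t 1 (fun s => xi (q s) i 0)
      ((nu^-1 *: (invmx Mz *m pz t)) i 0).
    apply: (near_eq_is_derive (f := fun s => nu^-1 * z s i 0)).
      move: tnear; apply: (@filterS _ (nbhs t)) => s s0.
      by rewrite (path_constraint H)// mxE.
    have [dz' zE] := dz.
    have dzi : is_derive t 1 (fun s => z s i 0) ((invmx Mz *m pz t) i 0).
      split; first by move/derivable_mxP : dz' => /(_ i 0).
      by rewrite -zE derive_mx// mxE.
    by have := is_deriveZ nu^-1 dzi; rewrite [X in _ -> is_derive _ _ _ X]mxE.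
  rewrite -dzi dxi derive_partial; last exact: smooth_differentiable.
  by rewrite mxE; apply: eq_bigr => k _; rewrite !mxE mulrC.
(* At t = 0 there is no two-sided derivative; the identity comes from continuity from the right. *)
move=> t; rewrite le_eqVlt => /predU1P[<-|]; last exact: pos.
apply: (cpath_ext0 (f := pz)
  (g := fun t => nu *: (Mz *m ((gradmx xi (q t))^T *m (invmx M *m p t))))) => //.
apply: (cpath_comp (f := fun u => nu *: u)); first exact: scaler_continuous.
apply: cpath_mulmx; first exact: cpath_cst.
apply: cpath_mulmx => // s; exact: trmx_continuous (cAq s).
Qed.

Variable L : R.
Local Notation B := (langevin_drift M V gamma).
Hypotheses (L0 : 0 < L) (BL : forall x y, `|B x - B y| <= L * `|x - y|).

(* By [path_momentum], pz is O(nu), and then [path_pz] makes lambda t - lambda 0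
   equal to nu times a bounded quantity. *)
Lemma constrained_path_error (K T : R) : 0 <= K -> 0 <= T ->
  exists r C nu0 : R, [/\ 0 <= r, 0 <= C, 0 < nu0 &
  forall nu W q p Wz z pz lambda, 0 < nu -> nu < nu0 ->
    constrained_path nu W q p Wz z pz lambda ->
    `|(p 0, q 0)| <= K ->
    (forall t, 0 <= t <= T -> `|W t| <= K) ->
    (forall t, 0 <= t <= T -> `|Wz t| <= K) ->
  forall t, 0 <= t <= T -> `|(p t, q t)| <= r /\
    `|(p t, q t) - picard_step B (p 0, q 0) (fun s => (sigma *m W s, 0))
                     (fun s => (p s, q s)) t| <= C * nu].
Proof.
move=> K0 T0.
(* [K1] bounds both the initial datum and the forcing [sigma *m W t], as [apriori] asks. *)
pose K1 := K + d%:R * `|sigma| * K.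
have K10 : 0 <= K1 by rewrite addr_ge0 ?mulr_ge0.
pose r0 := apriori_bound B L K1 T.
have r00 : 0 <= r0 by exact: apriori_bound_ge0.
have K1r0 : K1 <= r0.
  rewrite /r0 /apriori_bound -[leLHS]mulr1.
  apply: ler_pM => //; last exact: expR_ge1_time.
  have : 0 <= `|B 0| * T by rewrite mulr_ge0.
  by move=> ?; lra.
(* The margin 1 is that of [no_exit]: coefficients are bounded on the ball of radius r, and the path
   is shown to stay in that of radius r0. *)
pose r := r0 + 1.
have r_ge0 : 0 <= r by rewrite addr_ge0.
have [a a0 Ha] := continuous_bounded_ball r (gradmx_continuous hxi).
have [l l0 Hl] := gradmx_lipschitz_ball hxi r.
have [C1 C10 [nu1 nu10 HV]] := grad_V_fix_bound Mz hM hbeta hxi r.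
(* [v] bounds the velocity, [nu * b] bounds [pz], [b'] the friction on [pz], and [nu * c] the
   variation of [lambda]. The two terms of [C] come from the constraint force and from the gradient
   of [V_fix]. *)
pose v := d%:R * `|invmx M| * r.
have v0 : 0 <= v by rewrite !mulr_ge0.
pose b := n%:R * `|Mz| * (d%:R * a * v).
have b0 : 0 <= b by rewrite !mulr_ge0.
pose b' := n%:R * `|gammaz| * (n%:R * `|invmx Mz| * b).
have b'0 : 0 <= b' by rewrite !mulr_ge0.
pose c := b + b + b' * T + n%:R * `|sigmaz| * K.
have c0 : 0 <= c by rewrite !addr_ge0 ?mulr_ge0.
pose C := n%:R * (a + l * v * T) * c + C1 * T.
have C0 : 0 <= C by rewrite addr_ge0 ?mulr_ge0 ?addr_ge0 ?mulr_ge0.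
(* [nu < 1] absorbs the extra powers of nu, [nu1] is the range of [grad_V_fix_bound], and the last
   term gives [C * nu <= 1], the tolerance of [apriori]. *)
exists r, C, (Num.min 1 (Num.min nu1 (C + 1)^-1)).
split=> //; first by rewrite !lt_min ltr01 nu10 invr_gt0 ltr_wpDl.
move=> nu W q p Wz z pz lambda nu0; rewrite !lt_min => /and3P[nu_lt1 nu_nu1 nuC] H.
move=> y0K WK WzK.
pose y s := (p s, q s); pose w s : 'cV[R]_d * 'cV[R]_d := (sigma *m W s, 0).
have cq := cpath_q H; have cp := cpath_p H; have cpz := cpath_pz H.
have cy : cpath y by exact: cpath_pair.
have cw : cpath w.
  apply: cpath_pair; last exact: cpath_cst.
  by apply: cpath_mulmx; [exact: cpath_cst|exact: cpath_W H].
have cip : cpath (fun s => invmx M *m p s).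
  by apply: cpath_mulmx => //; exact: cpath_cst.
have cVfix : cpath (fun s => grad (V_fix M Mz beta xi nu) (q s)).
  apply: (cpath_comp (f := grad (V_fix M Mz beta xi nu))) => //.
  exact: grad_V_fix_continuous.
have cB : cpath (fun s => (B (y s)).1).
  exact/cpath_fst/(cpath_comp (lipschitz_cont L0 BL)).
(* The estimate is first proved as long as the path stays in the ball of radius r; [no_exit] then
   discharges that condition. *)
have core tau : 0 <= tau <= T -> (forall t, 0 <= t <= tau -> `|y t| <= r) ->
    forall t, 0 <= t <= tau -> `|y t - picard_step B (y 0) w y t| <= C * nu.
  move=> /andP[tau0 tauT] yr t /andP[t0 ttau].
  have tT : t <= T by rewrite (le_trans ttau).
  have pr s : 0 <= s <= t -> `|p s| <= r.
    move=> /andP[s0 st]; have := yr s; rewrite s0 (le_trans st)// => /(_ isT).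
    by rewrite pair_norm_le => /andP[].
  have qr s : 0 <= s <= t -> `|q s| <= r.
    move=> /andP[s0 st]; have := yr s; rewrite s0 (le_trans st)// => /(_ isT).
    by rewrite pair_norm_le => /andP[].
  have vr s : 0 <= s <= t -> `|invmx M *m p s| <= v.
    by move=> st; rewrite (le_trans (mulmx_norm _ _))// ler_wpM2l ?mulr_ge0 ?pr.
  have pzb s : 0 <= s <= t -> `|pz s| <= nu * b.
    move=> st; have s0 : 0 <= s by case/andP: st.
    rewrite (path_momentum nu0 H s0) mx_normZ gtr0_norm// ler_wpM2l ?(ltW nu0)//.
    rewrite (le_trans (mulmx_norm _ _))// ler_wpM2l ?mulr_ge0//.
    rewrite (le_trans (mulmx_norm _ _))// mx_norm_trmx ler_pM ?mulr_ge0//.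
      by rewrite ler_wpM2l// Ha// qr.
    exact: vr.
  have lambda_le s : 0 <= s <= t -> `|lambda s - lambda 0| <= nu * c.
    move=> st; have /andP[s0 s_t] := st.
    have -> : lambda s - lambda 0 = nu *: (pz s - pz 0 -
        time_integral (fun s => - (gammaz *m (invmx Mz *m pz s))) s - sigmaz *m Wz s).
      rewrite (path_pz H s0); set TI := time_integral _ _.
      move: TI (sigmaz *m Wz s) => TI sW.
      by apply/matrixP => i j; rewrite !mxE; field; rewrite gt_eqF.
    rewrite mx_normZ gtr0_norm// ler_wpM2l ?(ltW nu0)//.
    rewrite (le_trans (ler_normB _ _))// lerD//; last first.
      rewrite (le_trans (mulmx_norm _ _))// ler_wpM2l ?mulr_ge0// WzK//.
      by rewrite s0 (le_trans s_t).
    rewrite (le_trans (ler_normB _ _))// lerD//; last first.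
      apply: (@le_trans _ _ (b' * s)); last by rewrite ler_wpM2l// (le_trans s_t).
      apply: time_integral_le_cst => //.
        apply: cpathN; apply: cpath_mulmx; first exact: cpath_cst.
        by apply: cpath_mulmx; first exact: cpath_cst.
      move=> s' /andP[s'0 s's].
      rewrite normrN (le_trans (mulmx_norm _ _))// ler_wpM2l ?mulr_ge0//.
      rewrite (le_trans (mulmx_norm _ _))// ler_wpM2l ?mulr_ge0//.
      rewrite (le_trans (pzb _ _)) ?s'0 ?(le_trans s's)//.
      by rewrite ler_piMl// ltW.
    have nub : nu * b <= b by rewrite ler_piMl// ltW.
    rewrite (le_trans (ler_normB _ _))// lerD// (le_trans (pzb _ _))//.
    by rewrite lexx.
  have A_lip s s' : 0 <= s <= t -> 0 <= s' <= t ->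
      `|gradmx xi (q s) - gradmx xi (q s')| <= l * v * `|s - s'|.
    move=> st s't; rewrite (le_trans (Hl _ _ (qr _ st) (qr _ s't)))//.
    rewrite -mulrA ler_wpM2l//.
    have /andP[s0 _] := st; have /andP[s'0 _] := s't.
    rewrite (path_q H s0) (path_q H s'0) opprD addrACA subrr add0r.
    exact: (time_integral_lipschitz cip vr).
  have I_le := stieltjes_bound t0 a0 (mulr_ge0 l0 v0) (mulr_ge0 (ltW nu0) c0)
    (fun s st => Ha _ (qr s st)) A_lip lambda_le (path_p H t0).
  have Vfix_le : `|time_integral (fun s => grad (V_fix M Mz beta xi nu) (q s)) t|
      <= C1 * nu * T.
    apply: (@le_trans _ _ (C1 * nu * t)); last by rewrite ler_wpM2l// mulr_ge0// ltW.
    apply: time_integral_le_cst => // s st.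
    rewrite (le_trans (HV _ _ _ _ (qr _ st)))// ler_wpM2l//.
    by rewrite expr2 ler_piMl// ltW.
  have Cnu0 : 0 <= C * nu by rewrite mulr_ge0// ltW.
  (* The position component carries no error: its equation is exactly that of the Picard step. *)
  rewrite pair_norm_le; apply/andP; split; last first.
    by rewrite /= addr0 -(path_q H t0) subrr normr0.
  move: I_le; rewrite /= ; set I := (X in `|X|) => I_le.
  have -> : p t - (p 0 + time_integral (fun s => (B (y s)).1) t + sigma *m W t) =
      - I - time_integral (fun s => grad (V_fix M Mz beta xi nu) (q s)) t.
    rewrite /I; set J := time_integral (fun s => _ - _ - _) t.
    have -> : J = time_integral (fun s => (B (y s)).1) t -
        time_integral (fun s => grad (V_fix M Mz beta xi nu) (q s)) t.
      rewrite -(time_integralB t cB cVfix); congr (time_integral _ t).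
      by apply/funext => s /=; rewrite addrAC.
    move: (time_integral _ t) (time_integral _ t) (sigma *m W t) => TB TV sW.
    by apply/matrixP => i j; rewrite !mxE; ring.
  rewrite (le_trans (ler_normB _ _))// normrN.
  have -> : C * nu = n%:R * (a + l * v * T) * (nu * c) + C1 * nu * T.
    by rewrite /C; ring.
  apply: lerD => //; rewrite (le_trans I_le)// ler_wpM2r//.
    by rewrite mulr_ge0// ltW.
  by rewrite ler_wpM2l// lerD2l ler_wpM2l// mulr_ge0.
have xK1 : `|y 0| <= K1 by rewrite (le_trans y0K)// lerDl !mulr_ge0.
have wK1 t : 0 <= t <= T -> `|w t| <= K1.
  move=> tT; rewrite pair_norm_le /= normr0 K10 andbT.
  apply: (@le_trans _ _ (d%:R * `|sigma| * K)); last by rewrite lerDr.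
  by rewrite (le_trans (mulmx_norm _ _))// ler_wpM2l ?mulr_ge0// WK.
have Cnu : C * nu <= 1.
  rewrite (@le_trans _ _ ((C + 1) * nu))//; first by rewrite ler_wpM2r ?lerDl// ltW.
  by rewrite mulrC -ler_pdivlMr ?div1r ?ltr_wpDl// ltW.
have yr0 : forall t, 0 <= t <= T -> `|y t| <= r0.
  apply: no_exit => //; first by rewrite (le_trans xK1).
  move=> tau tauT yr; have /andP[_ tauT'] := tauT.
  apply: (apriori L0 BL cw cy K10 T0 xK1 wK1 tauT') => t ttau.
  by rewrite (le_trans (core tau tauT yr t ttau)).
have yr t : 0 <= t <= T -> `|y t| <= r.
  by move=> tT; rewrite (le_trans (yr0 t tT))// lerDl.
move=> t tT; split; first exact: yr.
by apply: (core T) => //; rewrite T0 lexx.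
Qed.

End constrained_path.

(** * Averages of path functionals *)

Section mean.
Context {R : realType} {dT : measure_display} {T : measurableType dT}.
Variable P : probability T R.
Implicit Types (f g : T -> R) (K : R).

Definition mean f : R := Rintegral P setT f.

Lemma bounded_integrable f K : measurable_fun setT f ->
  {ae P, forall w, `|f w| <= K} -> P.-integrable setT (EFin \o f).
Proof.
move=> mf fK; apply/integrableP; split; first exact/measurable_EFinP.
apply: (@le_lt_trans _ _ (\int[P]_w `|K%:E|)%E).
  apply: ae_ge0_le_integral => //.
  - exact/measurableT_comp/measurable_EFinP.
  - apply: filterS fK => w fK _; rewrite lee_fin (le_trans fK)//.
    exact: ler_norm.
by rewrite integral_cst//= probability_setT mule1 ltry.
Qed.

Lemma expectation_mean f K : measurable_fun setT f ->
  (forall w, `|f w| <= K) -> 'E_P[f]%E = (mean f)%:E.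
Proof.
move=> mf fK; rewrite unlock /mean /Rintegral fineK//.
by apply: integrable_fin_num => //; apply: (bounded_integrable mf); exact: aeW.
Qed.

Lemma mean_cst K : mean (cst K) = K.
Proof. by rewrite /mean Rintegral_cst//= probability_setT mulr1. Qed.

Lemma mean_le_ae f g K : measurable_fun setT f -> measurable_fun setT g ->
  (forall w, `|f w| <= K) -> (forall w, `|g w| <= K) ->
  {ae P, forall w, f w <= g w} -> mean f <= mean g.
Proof.
move=> mf mg fK gK fg.
have intf : P.-integrable setT (EFin \o f) by apply: (bounded_integrable mf); exact: aeW fK.
have intg : P.-integrable setT (EFin \o g) by apply: (bounded_integrable mg); exact: aeW gK.
(* [f'] equals f almost everywhere and is below g everywhere, which reduces the claim to a pointwise
   comparison. *)
pose f' w := Num.min (f w) (g w).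
have mf' : measurable_fun setT f' by exact: measurable_minr.
have intf' : P.-integrable setT (EFin \o f').
  apply: (@bounded_integrable f' K mf'); apply: aeW => w; rewrite /f'.
  by rewrite minElt; case: ifP => _.
have -> : mean f = mean f'.
  congr fine; apply: ae_eq_integral => //; first exact/measurable_EFinP.
    exact/measurable_EFinP.
  by apply: filterS fg => w fg _ /=; rewrite /f' min_l.
by apply: le_Rintegral => // w _; rewrite /f' ge_min lexx orbT.
Qed.

Lemma meanD f g K : measurable_fun setT f -> measurable_fun setT g ->
  (forall w, `|f w| <= K) -> (forall w, `|g w| <= K) ->
  mean (fun w => f w + g w) = mean f + mean g.
Proof.
by move=> mf mg fK gK; rewrite /mean RintegralD//;
  [apply: (bounded_integrable mf)|apply: (bounded_integrable mg)]; exact: aeW.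
Qed.

Lemma meanN f K : measurable_fun setT f -> (forall w, `|f w| <= K) ->
  mean (fun w => - f w) = - mean f.
Proof.
move=> mf fK; rewrite -mulN1r /mean -RintegralZl//.
  by apply: eq_Rintegral => w _; rewrite mulN1r.
by apply: (bounded_integrable mf); exact: aeW.
Qed.

Lemma meanZ f (r K : R) : measurable_fun setT f -> (forall w, `|f w| <= K) ->
  mean (fun w => r * f w) = r * mean f.
Proof.
move=> mf fK; rewrite /mean RintegralZl//.
by apply: (bounded_integrable mf); exact: aeW.
Qed.

Lemma mean_cvg (f_ : nat -> T -> R) f K :
  (forall N, measurable_fun setT (f_ N)) -> measurable_fun setT f ->
  (forall N w, `|f_ N w| <= K) ->
  {ae P, forall w, f_ N w @[N --> \oo] --> f w} ->
  mean (f_ N) @[N --> \oo] --> mean f.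
Proof.
move=> mf_ mf f_K f_f.
have [] := @dominated_convergence _ T R P setT _ (fun N w => (f_ N w)%:E)
  (EFin \o f) (cst K%:E) _ _ _ _ _ => //.
- by move=> N; exact/measurable_EFinP.
- exact/measurable_EFinP.
- by apply: filterS f_f => w f_f _; apply: cvg_EFin; [exact: nearW|].
- by apply: (@bounded_integrable (cst K) `|K|); [exact: measurable_cst|exact: aeW].
- by apply: aeW => w N _; rewrite lee_fin.
move=> intf _ H; have finf : (\int[P]_w (f w)%:E)%E \is a fin_num by exact: integrable_fin_num.
by apply: fine_cvg; rewrite fineK.
Qed.

Lemma mean_norm_le f K : measurable_fun setT f -> (forall w, `|f w| <= K) ->
  `|mean f| <= K.
Proof.
move=> mf fK.
have K0 : 0 <= K by rewrite (le_trans (normr_ge0 _) (fK point)).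
have mK : forall c : R, `|c| <= K -> forall w : T, `|cst c w| <= K by [].
have Kn : `|- K| <= K by rewrite normrN ger0_norm.
have Kp : `|K| <= K by rewrite ger0_norm.
rewrite ler_norml -{1}(mean_cst (- K)) -{2}(mean_cst K).
have fK' w : - K <= f w <= K by rewrite -ler_norml.
apply/andP; split; apply: (mean_le_ae (K := K)) => //; apply: aeW => w /=.
  by case/andP: (fK' w).
by case/andP: (fK' w).
Qed.

Lemma mean_sum (I : Type) (s : seq I) (F : I -> T -> R) K :
  (forall i, measurable_fun setT (F i)) -> (forall i w, `|F i w| <= K) ->
  mean (fun w => \sum_(i <- s) F i w) = \sum_(i <- s) mean (F i).
Proof.
move=> mF FK; have K0 (i : I) : 0 <= K by rewrite (le_trans (normr_ge0 _) (FK i point)).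
elim: s => [|i s IH].
  rewrite big_nil (_ : (fun _ => _) = cst 0) ?mean_cst//.
  by apply/funext => w; rewrite big_nil.
rewrite big_cons -IH (_ : (fun _ => _) =
    (fun w => F i w + \sum_(j <- s) F j w)); last first.
  by apply/funext => w; rewrite big_cons.
have sK w : `|\sum_(j <- s) F j w| <= (size s)%:R * K.
  elim: (s) => [|j r IHr]; first by rewrite big_nil normr0 mul0r.
  by rewrite big_cons (le_trans (ler_normD _ _))//= mulrSr mulrDl mul1r addrC lerD.
apply: (@meanD _ _ ((size s)%:R * K + K)) => // [|w|w].
- exact: measurable_sum.
- by rewrite (le_trans (FK i w))// lerDr mulr_ge0// (K0 i).
- by rewrite (le_trans (sK w))// lerDl (K0 i).
Qed.

Lemma mean_indic (A : set T) : measurable A -> mean \1_A = fine (P A).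
Proof. by move=> mA; rewrite /mean /Rintegral integral_indic// setIT. Qed.

(** With X the code of a path, this makes means on different probability spaces comparable term by
    term. *)
Lemma mean_finite (I : finType) (X : T -> I) (phi : I -> R) :
  (forall i, measurable (X @^-1` [set i])) ->
  measurable_fun setT (phi \o X) /\
  mean (phi \o X) = \sum_i phi i * fine (P (X @^-1` [set i])).
Proof.
move=> mX.
have E : phi \o X = (fun w => \sum_i phi i * \1_(X @^-1` [set i]) w).
  apply/funext => w /=; rewrite (bigD1 (X w))//= indicE mem_set// mulr1.
  rewrite big1 ?addr0// => i iX; rewrite indicE memNset ?mulr0//=.
  by move=> XI; rewrite XI eqxx in iX.
have mi i : measurable_fun setT (fun w : T => phi i * \1_(X @^-1` [set i]) w).
  by apply: measurable_funM => //; exact: measurable_indic.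
split; first by rewrite E; exact: measurable_sum.
pose K := \sum_i `|phi i|.
have indic1 i w : `|\1_(X @^-1` [set i]) w : R| <= 1.
  by rewrite indicE; case: (_ \in _); rewrite ?normr1 ?normr0.
rewrite E (@mean_sum _ _ _ K) => // [|i w].
  apply: eq_bigr => i _.
  have mX1 : measurable_fun setT (\1_(X @^-1` [set i]) : T -> R).
    exact: measurable_indic.
  by rewrite (@meanZ _ (phi i) 1 mX1 (indic1 i)) mean_indic.
rewrite normrM (@le_trans _ _ `|phi i|)//; first by rewrite ler_piMr.
by rewrite /K (bigD1 i)//= lerDl sumr_ge0.
Qed.

End mean.

(** * Finite codes for paths *)

Section discretization.
Context {R : realType}.
Implicit Types (N : nat) (u : R).

(* A path is encoded by its increments over the (N+1)^2 steps of length 1/(N+1),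
   rounded on a grid of step (N+1)^-3 of [-N, N]: there are finitely many codes,
   and the rounding errors add up to at most 1/(N+1). *)
Definition precision N : R := N.+1%:R ^+ 3.

(** Values outside [-N, N] receive some default code, through [Num.truncn] or [inord]; a given
    bounded quantity meets this for finitely many N only. The end point u = N accounts for the final
    successor in the number of codes. *)
Definition code N u : 'I_(2 * N * N.+1 ^ 3).+1 :=
  inord (Num.truncn ((u + N%:R) * precision N)).

Definition decode N (j : 'I_(2 * N * N.+1 ^ 3).+1) : R :=
  j%:R / precision N - N%:R.

Lemma precision_gt0 N : 0 < precision N.
Proof. by rewrite exprn_gt0// ltr0n. Qed.

Lemma decode_code_le N u : `|u| <= N%:R ->
  `|decode (code N u) - u| <= (precision N)^-1.
Proof.
rewrite ler_norml => /andP[Nu uN]; have D0 := precision_gt0 N.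
rewrite /decode /code; set v := (u + N%:R) * precision N.
have v0 : 0 <= v by rewrite mulr_ge0 ?(ltW D0)// -lerBlDr sub0r.
have /andP[kv vk] := truncn_itv v0.
have kM : (Num.truncn v < (2 * N * N.+1 ^ 3).+1)%N.
  rewrite ltnS -(ler_nat R) (le_trans kv)//.
  rewrite natrM natrX ler_wpM2r ?(ltW D0)//.
  by rewrite natrM mulr_natl mulr2n lerD2r.
rewrite inordK//.
have uE : u = v / precision N - N%:R by rewrite /v mulfK ?addrK// gt_eqF.
rewrite [X in _ - X]uE.
have -> : (Num.truncn v)%:R / precision N - N%:R - (v / precision N - N%:R) =
    - ((v - (Num.truncn v)%:R) / precision N) by ring.
rewrite normrN normrM ger0_norm ?subr_ge0// gtr0_norm ?invr_gt0//.
rewrite ler_piMl ?invr_ge0 ?(ltW D0)//.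
by rewrite lerBlDr addrC natr1 ltW.
Qed.

Lemma measurable_code N (j : 'I_(2 * N * N.+1 ^ 3).+1) :
  measurable (code N @^-1` [set j]).
Proof.
have mt : measurable_fun setT (fun u : R => (u + N%:R) * precision N).
  by apply: measurable_funM => //; apply: measurable_funD.
(* A level set of [Num.truncn] is a difference of half-lines; at k = 0 nothing is removed, since
   negative numbers are sent to 0. *)
have mk k : measurable [set v : R | Num.truncn v = k].
  have -> : [set v : R | Num.truncn v = k] = `]-oo, k.+1%:R[ `\`
      (if k is k'.+1 then `]-oo, k'.+1%:R[ else set0).
    apply/seteqP; split=> v /=; rewrite in_itv/= -truncn_le_nat.
      by move=> vk; rewrite vk; split=> //; case: k vk => [|k] vk /=; [case|rewrite in_itv/= -truncn_le_nat vk ltnn].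
    case: k => [[]|k [vk]]; first by rewrite leqn0 => /eqP.
    rewrite /= in_itv/= -truncn_le_nat => /negP; rewrite -ltnNge => kv.
    by apply/eqP; rewrite eqn_leq vk kv.
  by apply: measurableD => //; case: k.
have -> : code N @^-1` [set j] = (fun u : R => (u + N%:R) * precision N) @^-1`
    (\bigcup_(k in [set k | inord k = j]) [set v : R | Num.truncn v = k]).
  apply/seteqP; split=> [u /= uj|u [k /= kj uk]].
    by exists (Num.truncn ((u + N%:R) * precision N)).
  by rewrite /code uk.
rewrite -[X in measurable X]setTI; apply: mt => //.
by apply: bigcup_measurable => k _.
Qed.

(** Heine's theorem, from the near-covering form of the compactness of [[0, T]]. *)
Lemma cpath_unif_continuous (V : normedModType R) (y : R -> V) (T e : R) :
  cpath y -> 0 < e -> exists2 delta, 0 < delta &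
    forall s t, 0 <= s <= T -> 0 <= t <= T -> `|s - t| < delta -> `|y s - y t| < e.
Proof.
move=> cy e0.
pose P (delta x : R) := forall s, `|s - x| < delta ->
  `|positive_part y s - positive_part y x| < e.
have : \forall delta \near 0^'+, `[0, T] `<=` P delta.
  have /compact_near_coveringP := @segment_compact R 0 T; apply => x _.
  have e20 : 0 < e / 2 by rewrite divr_gt0.
  have /cvgrPdist_lt/(_ _ e20)/nbhs_ballP[a /= a0 Ha] := cy x.
  have a20 : 0 < a / 2 by rewrite divr_gt0.
  exists (ball x (a / 2), [set delta | delta < a / 2]).
    by split=> /=; [exact: nbhsx_ballx|exact: nbhs_right_lt].
  move=> [x' delta] /= [xx' da] s sx'.
  have xs : ball x a s.
    rewrite [a]splitr; apply: (ball_triangle xx').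
    by rewrite /ball/= distrC (lt_trans sx').
  have xx'a : ball x a x' by apply: le_ball xx'; rewrite ger_pMr// invf_le1// ler1n.
  rewrite [e]splitr -(subrKA (positive_part y x)) (le_lt_trans (ler_normD _ _))//.
  by rewrite ltrD ?Ha// distrC Ha.
move=> H; have : \forall delta \near 0^'+, 0 < delta /\ `[0, T] `<=` P delta.
  by near=> delta; split; near: delta => //; exact: nbhs_right_gt.
move=> /filter_ex[delta [delta0 Hd]]; exists delta => // s t s0T t0T st.
have tT : [set` `[0, T]] t by rewrite /= in_itv.
have := Hd t tT s st; case/andP: s0T => s0 _; case/andP: t0T => t0 _.
by rewrite !positive_partE.
Unshelve. all: by end_near. Qed.

(** Rises linearly from 0 to 1 over the j-th step of the grid of mesh 1/(N+1), and is constant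
    outside it. *)
Definition ramp N (j : nat) (t : R) : R :=
  Num.min 1 (Num.max 0 (t * N.+1%:R - j%:R)).

(** The piecewise linear path that starts from 0 and moves by [c j] during the j-th step; the
    (N+1)^2 steps reach time N+1. *)
Definition polyline {V : normedModType R} N (c : nat -> V) (t : R) : V :=
  \sum_(0 <= j < N.+1 ^ 2) ramp N j t *: c j.

Definition increment {V : normedModType R} N (y : R -> V) (j : nat) : V :=
  y (j.+1%:R / N.+1%:R) - y (j%:R / N.+1%:R).

Lemma ramp_ge0_le1 N j t : 0 <= ramp N j t <= 1.
Proof.
by rewrite /ramp le_min ler01 le_max lexx/= ge_min lexx.
Qed.

Lemma ramp_continuous N j : continuous (ramp N j).
Proof.
move=> t; have c1 : {for t, continuous (fun s : R => s * N.+1%:R - j%:R)}.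
  by apply: cvgB; [apply: cvgM; [exact: cvg_id|exact: cvg_cst]|exact: cvg_cst].
have cc (a : R) : {for t, continuous (fun _ : R => a)} by exact: cst_continuous.
exact: (continuous_min (cc 1) (continuous_max (cc 0) c1)).
Qed.

Lemma cpath_polyline (V : normedModType R) N (c : nat -> V) :
  cpath (polyline N c).
Proof.
apply: cpath_continuous => t.
apply: (cvg_big (op := +%R) (x0 := 0)) => [|j _]; first exact: add_continuous.
by apply: cvgZr_tmp; exact: ramp_continuous.
Qed.

Lemma ramp1 N j t : j.+1%:R <= t * N.+1%:R -> ramp N j t = 1.
Proof.
rewrite -natr1 -lerBrDl => jt; by rewrite /ramp min_l// le_max jt orbT.
Qed.

Lemma ramp0 N j t : t * N.+1%:R <= j%:R -> ramp N j t = 0.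
Proof. by rewrite -subr_le0 => jt; rewrite /ramp (max_l jt) min_r. Qed.

(** Ramps before the current step k equal 1, and their increments telescope; those after it
    vanish. *)
Lemma polyline_increment (V : normedModType R) N (y : R -> V) (t : R) :
  let k := Num.truncn (t * N.+1%:R) in
  0 <= t -> t < N.+1%:R ->
  polyline N (increment N y) t = y (k%:R / N.+1%:R) - y 0 +
    ramp N k t *: (y (k.+1%:R / N.+1%:R) - y (k%:R / N.+1%:R)).
Proof.
move=> k t0 tN; have N0 : (0 : R) < N.+1%:R by rewrite ltr0n.
have /andP[kt tk] : k%:R <= t * N.+1%:R < k.+1%:R by rewrite truncn_itv// mulr_ge0.
have kJ : (k < N.+1 ^ 2)%N.
  rewrite -(ltr_nat R) (le_lt_trans kt)// natrX expr2 ltr_pM2r//.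
rewrite /polyline (@big_cat_nat _ _ _ k)//=; last exact: ltnW.
rewrite [X in _ + X]big_ltn// [X in _ + (_ + X)]big1_seq; last first.
  move=> j /=; rewrite mem_index_iota => /andP[kj _].
  by rewrite ramp0 ?scale0r// (le_trans (ltW tk))// ler_nat.
rewrite addr0; congr (_ + _).
rewrite (eq_big_nat _ _ (F2 := fun j => y (j.+1%:R / N.+1%:R) - y (j%:R / N.+1%:R))).
  rewrite (telescope_sumr (fun j => y (j%:R / N.+1%:R)))//.
  by rewrite mul0r.
by move=> j /andP[_ jk]; rewrite ramp1 ?scale1r// (le_trans _ kt)// ler_nat.
Qed.

End discretization.

Section path_codes.
Context {R : realType}.
Implicit Types (N : nat).

Definition vec_code {e : nat} N (x : 'cV[R]_e) :
    {ffun 'I_e -> 'I_(2 * N * N.+1 ^ 3).+1} :=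
  [ffun i => code N (x i 0)].

Definition decode_vec {e : nat} N
    (a : {ffun 'I_e -> 'I_(2 * N * N.+1 ^ 3).+1}) : 'cV[R]_e :=
  \col_i decode (a i).

(** The index set has the successor shape that [inord] requires in [decode_path]. *)
Definition path_code {m : nat} N (y : R -> 'cV[R]_m) :
    {ffun 'I_(N.+1 ^ 2).+1 * 'I_m -> 'I_(2 * N * N.+1 ^ 3).+1} :=
  [ffun ji : 'I_(N.+1 ^ 2).+1 * 'I_m => code N (increment N y ji.1 ji.2 0)].

Definition decode_path {m : nat} N
    (b : {ffun 'I_(N.+1 ^ 2).+1 * 'I_m -> 'I_(2 * N * N.+1 ^ 3).+1}) :
    R -> 'cV[R]_m :=
  polyline N (fun j => \col_i decode (b (inord j, i))).

Lemma decode_vec_le {e : nat} N (x : 'cV[R]_e) : `|x| <= N%:R ->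
  `|decode_vec (vec_code N x) - x| <= (@precision R N)^-1.
Proof.
move=> xN; apply: mx_norm_le => [|i j]; first by rewrite invr_ge0 ltW// precision_gt0.
by rewrite !mxE ffunE ord1 decode_code_le// (le_trans (mx_norm_coord _ _ _)).
Qed.

Lemma near_inv_lt (e : R) : 0 < e -> \forall N \near \oo, N.+1%:R^-1 < e.
Proof.
move=> e0; near=> N.
rewrite invf_plt ?posrE ?ltr0n// (@le_lt_trans _ _ N%:R) ?ltr_nat//.
by near: N; exact: nbhs_infty_ger.
Unshelve. all: by end_near. Qed.

Lemma inv_precision_le N : (@precision R N)^-1 <= N.+1%:R^-1.
Proof.
rewrite lef_pV2 ?posrE ?precision_gt0// /precision exprS ler_peMr//.
by rewrite exprn_ege1// ler1n.
Qed.

Lemma decode_vec_cvg {e : nat} (x : 'cV[R]_e) :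
  decode_vec (vec_code N x) @[N --> \oo] --> x.
Proof.
apply/cvgrPdist_lt => eps eps0; near=> N.
rewrite distrC (le_lt_trans (decode_vec_le _))//.
  by near: N; exact: nbhs_infty_ger.
rewrite (le_lt_trans (inv_precision_le _))//.
by near: N; exact: near_inv_lt.
Unshelve. all: by end_near. Qed.

Lemma cpath_decode_path {m : nat} N
    (b : {ffun 'I_(N.+1 ^ 2).+1 * 'I_m -> 'I_(2 * N * N.+1 ^ 3).+1}) :
  cpath (decode_path b).
Proof. exact: cpath_polyline. Qed.

(** The codes see increments only, hence the limit [y t - y 0]. Interpolation costs two moduli of
    continuity; rounding costs (N+1)^2 errors of size (N+1)^-3. *)
Lemma decode_path_cvg {m : nat} (y : R -> 'cV[R]_m) (T e : R) :
  cpath y -> 0 < e -> \forall N \near \oo, forall t, 0 <= t <= T ->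
    `|decode_path (path_code N y) t - (y t - y 0)| <= e.
Proof.
move=> cy e0; have e30 : 0 < e / 3 by rewrite divr_gt0.
(* The grid points around a time t <= T may exceed T, but not T + 1. *)
have [K K0 yK] := cpath_bounded (T + 1) cy.
have [delta delta0 Hd] := cpath_unif_continuous (T + 1) cy e30.
near=> N => t /andP[t0 tT].
have N0 : (0 : R) < N.+1%:R by rewrite ltr0n.
have N1d : (N.+1%:R)^-1 < delta by near: N; exact: near_inv_lt.
have N1e : (N.+1%:R)^-1 < e / 3 by near: N; exact: near_inv_lt.
have KN : K + K <= N%:R by near: N; exact: nbhs_infty_ger.
have TN : T <= N%:R by near: N; exact: nbhs_infty_ger.
have tN : t < N.+1%:R by rewrite (le_lt_trans tT)// (le_lt_trans TN)// ltr_nat.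
have N1 : (N.+1%:R)^-1 <= (1 : R) by rewrite invf_le1// ler1n.
pose k := Num.truncn (t * N.+1%:R).
have /andP[kt tk] : k%:R <= t * N.+1%:R < k.+1%:R by rewrite truncn_itv// mulr_ge0// ltW.
have grid (j : nat) : (j%:R : R) <= t * N.+1%:R + 1 ->
    0 <= (j%:R : R) / N.+1%:R <= T + 1.
  move=> jt; rewrite divr_ge0//= ler_pdivrMr// mulrDl mul1r (le_trans jt)//.
  by rewrite lerD ?ler_wpM2r ?ler1n.
have kgrid : 0 <= (k%:R : R) / N.+1%:R <= T + 1 by apply: grid; rewrite (le_trans kt)// lerDl.
have k1grid : 0 <= (k.+1%:R : R) / N.+1%:R <= T + 1 by apply: grid; rewrite -natr1 lerD2r.
have tgrid : 0 <= (t : R) <= T + 1 by rewrite t0 (le_trans tT)// lerDl.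
have ktd : `|k%:R / N.+1%:R - t| < delta.
  rewrite distrC ger0_norm; last by rewrite subr_ge0 ler_pdivrMr.
  apply: le_lt_trans N1d; rewrite lerBlDr.
  have -> : N.+1%:R^-1 + k%:R / N.+1%:R = k.+1%:R / N.+1%:R :> R.
    by rewrite -(natr1 k) mulrDl div1r addrC.
  by rewrite ler_pdivlMr// ltW.
have step1 : `|polyline N (increment N y) t - (y t - y 0)| <= e / 3 + e / 3.
  have cancel (a b c f : 'cV[R]_m) : a - b + c - (f - b) = a - f + c.
    by rewrite opprB [a - b + c]addrAC addrA subrK addrAC.
  rewrite polyline_increment// -/k cancel.
  rewrite (le_trans (ler_normD _ _))// lerD//; first by rewrite ltW// Hd.
  rewrite normrZ; have /andP[r0 r1] := ramp_ge0_le1 N k t.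
  rewrite ger0_norm// (@le_trans _ _ (1 * (e / 3)))//; last by rewrite mul1r.
  apply: ler_pM => //; rewrite ltW// Hd//.
  by rewrite -mulrBl -natr1 addrAC subrr add0r div1r ger0_norm ?invr_ge0.
have step2 : `|decode_path (path_code N y) t - polyline N (increment N y) t| <= e / 3.
  rewrite /decode_path /polyline -sumrB.
  have D0 := @precision_gt0 R N.
  apply: (@le_trans _ _ (\sum_(0 <= j < N.+1 ^ 2) (@precision R N)^-1)); last first.
    rewrite sumr_const_nat subn0 -[leLHS]mulr_natl natrX /precision.
    apply: le_trans (ltW N1e); move: (N.+1%:R : R) N0 => x x0.
    by have -> : x ^+ 2 / x ^+ 3 = x^-1 by field; rewrite gt_eqF.
  rewrite (le_trans (ler_norm_sum _ _ _))// !big_mkord ler_sum// => j _.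
  (* Steps starting after t have a zero ramp; their increments may lie beyond T + 1, where y is not
     controlled and the code may overflow. *)
  have [jk|kj] := ltP (t * N.+1%:R) j%:R.
    by rewrite (ramp0 (ltW jk)) !scale0r subrr normr0 invr_ge0 ltW.
  rewrite -scalerBr normrZ; have /andP[r0 r1] := ramp_ge0_le1 N j t.
  rewrite ger0_norm// (@le_trans _ _ (1 * (@precision R N)^-1))//; last by rewrite mul1r.
  apply: ler_pM => //; apply: mx_norm_le => [|i i']; first by rewrite invr_ge0 ltW.
  rewrite ord1 !mxE ffunE /= inordK; last by rewrite ltnS ltnW.
  have -> : y (j.+1%:R / N.+1%:R) i 0 - y (j%:R / N.+1%:R) i 0 =
    (increment N y j) i 0 by rewrite !mxE.
  rewrite decode_code_le// (le_trans (mx_norm_coord _ _ _))//.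
  rewrite (le_trans _ KN)// (le_trans (ler_normB _ _))// lerD// yK// grid//.
    by rewrite -natr1 lerD2r.
  by rewrite (le_trans kj)// lerDl.
have -> : e = e / 3 + (e / 3 + e / 3) by lra.
by rewrite -(subrKA (polyline N (increment N y) t)) (le_trans (ler_normD _ _))// lerD.
Unshelve. all: by end_near. Qed.

End path_codes.

Section path_functionals.
Context {R : realType} {e m : nat}.
Implicit Types (psi : 'cV[R]_e -> (R -> 'cV[R]_m) -> R).

Definition cvg_path {V : normedModType R} (y_ : nat -> R -> V) (y : R -> V) : Prop :=
  forall T eps : R, 0 < eps ->
    \forall N \near \oo, forall t, 0 <= t <= T -> `|y_ N t - y t| <= eps.

(** Sequential continuity is the form that dominated convergence uses, with y restricted to
    continuous paths. *)
Definition path_continuous psi : Prop :=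
  forall x y (x_ : nat -> 'cV[R]_e) (y_ : nat -> R -> 'cV[R]_m),
    cpath y -> (forall N, cpath (y_ N)) ->
    x_ N @[N --> \oo] --> x -> cvg_path y_ y ->
    psi (x_ N) (y_ N) @[N --> \oo] --> psi x y.

Lemma psi_decode_cvg psi x y : path_continuous psi -> cpath y ->
  psi (decode_vec (vec_code N x)) (decode_path (path_code N y)) @[N --> \oo]
    --> psi x (fun t => y t - y 0).
Proof.
move=> cpsi cy; apply: cpsi.
- by apply: cpathB => //; exact: cpath_cst.
- by move=> N; exact: cpath_decode_path.
- exact: decode_vec_cvg.
- by move=> T eps eps0; exact: decode_path_cvg.
Qed.

End path_functionals.

(** * Measurability of path functionals *)

Section measurability.
Context {R : realType} {dT : measure_display} {T : measurableType dT}.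

Definition random_vector {e : nat} (x : T -> 'cV[R]_e) : Prop :=
  forall i, measurable_fun setT (fun w => x w i 0).

Definition random_path {m : nat} (Y : R -> T -> 'cV[R]_m) : Prop :=
  (forall w, cpath (Y ^~ w)) /\ forall t, 0 <= t -> random_vector (Y t).

Lemma measurable_preimage_code N (f : T -> R) j : measurable_fun setT f ->
  measurable [set w | code N (f w) = j].
Proof.
move=> mf; rewrite (_ : [set _ | _] = f @^-1` (code N @^-1` [set j]))//.
by rewrite -[X in measurable X]setTI; apply: mf => //; exact: measurable_code.
Qed.

Lemma measurable_ffun_eq (I J : finType) (X : T -> {ffun I -> J}) :
  (forall i j, measurable [set w | X w i = j]) ->
  forall b, measurable (X @^-1` [set b]).
Proof.
move=> mX b; rewrite (_ : _ @^-1` _ =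
    \bigcap_(i in setT) [set w | X w i = b i]).
  by apply: fin_bigcap_measurable => //; exact: finite_finset.
apply/seteqP; split=> [w /= Xb i _ /=|w H]; first by rewrite Xb.
by apply/ffunP => i; exact: H.
Qed.

Lemma measurable_vec_code {e : nat} N (x : T -> 'cV[R]_e) : random_vector x ->
  forall a, measurable ((fun w => vec_code N (x w)) @^-1` [set a]).
Proof.
move=> mx; apply: measurable_ffun_eq => i j.
rewrite (_ : mkset _ = [set w | code N (x w i 0) = j]).
  exact/measurable_preimage_code/mx.
by apply/seteqP; split=> w /=; rewrite ffunE.
Qed.

Lemma measurable_path_code {m : nat} N (Y : R -> T -> 'cV[R]_m) : random_path Y ->
  forall b, measurable ((fun w => path_code N (Y ^~ w)) @^-1` [set b]).
Proof.
move=> [_ mY]; apply: measurable_ffun_eq => -[k i] j.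
rewrite (_ : mkset _ = [set w | code N (increment N (Y ^~ w) k i 0) = j]).
  apply: measurable_preimage_code.
  rewrite (_ : (fun _ => _) = (fun w =>
     Y (k.+1%:R / N.+1%:R) w i 0 - Y (k%:R / N.+1%:R) w i 0)).
    by apply: measurable_funB; apply: mY; rewrite divr_ge0.
  by apply/funext => w; rewrite !mxE.
by apply/seteqP; split=> w /=; rewrite ffunE.
Qed.

(** The functional is the pointwise limit of its values at decoded data, which are functions of
    finitely many measurable events. *)
Lemma measurable_path_functional {e m : nat} (psi : 'cV[R]_e -> (R -> 'cV[R]_m) -> R)
    (x : T -> 'cV[R]_e) (Y : R -> T -> 'cV[R]_m) :
  path_continuous psi -> random_vector x -> random_path Y ->
  measurable_fun setT (fun w => psi (x w) (fun t => Y t w - Y 0 w)).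
Proof.
move=> cpsi mx mY.
pose f_ N w := psi (decode_vec (vec_code N (x w))) (decode_path (path_code N (Y ^~ w))).
apply: (@measurable_fun_cvg _ _ _ _ f_); last first.
  by move=> w _; apply: psi_decode_cvg => //; case: mY.
move=> N.
pose X w := (vec_code N (x w), path_code N (Y ^~ w)).
pose phi ab := psi (decode_vec ab.1) (decode_path ab.2).
have mX ab : measurable (X @^-1` [set ab]).
  rewrite (_ : _ @^-1` _ = ((fun w => vec_code N (x w)) @^-1` [set ab.1]) `&`
      ((fun w => path_code N (Y ^~ w)) @^-1` [set ab.2])).
    by apply: measurableI; [exact: measurable_vec_code|exact: measurable_path_code].
  by apply/seteqP; split=> [w /= <- //|w []]; rewrite /X/= => -> ->; case: (ab).
(* [mean_finite] is stated for a probability; a Dirac mass gives access to its measurability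
   half. *)
have [+ _] := @mean_finite R dT T (@dirac _ T point R) _ X (phi N N) mX.
exact.
Qed.

End measurability.

Section sub_sigma_algebra.
Context {R : realType} {T : pointedType} (G : set (set T)).
Hypothesis sG : sigma_algebra setT G.

(** Here and below, [g_sigma_algebraType G] turns the bare family G into a measurable type whose
    measurable sets are exactly those of G. *)
Lemma sigma_algebra_preimageB (f g : T -> R) :
  (forall C : set R, measurable C -> G (f @^-1` C)) ->
  (forall C : set R, measurable C -> G (g @^-1` C)) ->
  forall C : set R, measurable C -> G ((fun w => f w - g w) @^-1` C).
Proof.
move=> Gf Gg C mC.
have mf (h : T -> R) : (forall C : set R, measurable C -> G (h @^-1` C)) ->
    measurable_fun (setT : set (g_sigma_algebraType G)) h.
  by move=> Gh _ D mD; rewrite setTI; apply: sub_sigma_algebra; exact: Gh.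
have /(_ measurableT C mC) := measurable_funB (mf f Gf) (mf g Gg).
by rewrite setTI /measurable/= sigma_algebra_id.
Qed.

Lemma sigma_algebra_fin_bigcap (I : finType) (A : I -> set T) :
  (forall i, G (A i)) -> G (\bigcap_(i in setT) A i).
Proof.
move=> GA; have : measurable (\bigcap_(i in setT) A i : set (g_sigma_algebraType G)).
  apply: fin_bigcap_measurable => [|i _]; first exact: finite_finset.
  by apply: sub_sigma_algebra; exact: GA.
by rewrite /measurable/= sigma_algebra_id.
Qed.

Lemma sigma_algebra_setI (A B : set T) : G A -> G B -> G (A `&` B).
Proof.
move=> GA GB; have : measurable (A `&` B : set (g_sigma_algebraType G)).
  by apply: measurableI; apply: sub_sigma_algebra.
by rewrite /measurable/= sigma_algebra_id.
Qed.

End sub_sigma_algebra.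

Section adapted_processes.
Context {R : realType} {dT : measure_display} {T : measurableType dT}.
Variables (F : R -> set (set T)).
Hypothesis hF : is_filtration F.

Lemma continuous_adapted_random_path {m : nat} (X : R -> T -> 'cV[R]_m) :
  continuous_adapted F X -> random_path X.
Proof.
move=> [aX cX]; split=> [w|t t0 i]; first exact/cpathP.
by move=> _ C mC; rewrite setTI; case: hF => _ Fm _; apply: (Fm t t0); exact: aX.
Qed.

Variables (P : probability T R) (m : nat) (B : R -> T -> 'cV[R]_m).
Hypothesis hB : brownian_motion P F B.

(** The product formula handles one increment given the past. The event about the first k increments
    belongs to F at the k-th grid time, so it serves as the past of the next one; membership and
    probability are therefore proved together. *)
Lemma brownian_increments N (A : set T) (C : nat -> 'I_m -> set R) k :
  F 0 A -> (forall j i, measurable (C j i)) ->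
  let G := A `&` [set w | forall j, (j < k)%N -> forall i,
    C j i (increment N (B ^~ w) j i 0)] in
  F (k%:R / N.+1%:R) G /\
  P G = (P A * \prod_(j < k) \prod_(i < m) normal_prob 0
     (Num.sqrt (j.+1%:R / N.+1%:R - j%:R / N.+1%:R)) (C j i))%E.
Proof.
move=> FA mC /=; have [sF _ Fmono] := hF; have [[aB cB] _ lawB] := hB.
have grid0 j : 0 <= j%:R / N.+1%:R :> R by rewrite divr_ge0.
have grid_lt j : j%:R / N.+1%:R < j.+1%:R / N.+1%:R :> R.
  by rewrite ltr_pM2r ?invr_gt0 ?ltr0n// ltr_nat.
elim: k => [|k [FG PG]].
  rewrite mul0r big_ord0 mule1 (_ : _ `&` _ = A)//.
  by apply/seteqP; split=> w //= -[].
set G := (X in P X) in PG.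
set I := [set w | forall i, C k i ((B (k.+1%:R / N.+1%:R) w - B (k%:R / N.+1%:R) w) i 0)].
have -> : A `&` [set w | forall j, (j < k.+1)%N -> forall i,
    C j i (increment N (B ^~ w) j i 0)] = G `&` I.
  apply/seteqP; split=> w /=.
    by move=> [Aw Cw]; split; [split=> // j jk; apply: Cw; exact: ltnW|exact: Cw].
  move=> [[Aw Cw] Iw]; split=> // j; rewrite ltnS leq_eqVlt => /predU1P[->|]; last exact: Cw.
  exact: Iw.
split.
  have sFk := sF _ (grid0 k.+1); apply: sigma_algebra_setI => //.
    by apply: Fmono FG => //; exact: ltW.
  rewrite (_ : I = \bigcap_(i in setT) ((fun w =>
      B (k.+1%:R / N.+1%:R) w i 0 - B (k%:R / N.+1%:R) w i 0) @^-1` C k i)).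
    apply: sigma_algebra_fin_bigcap => // i.
    apply: sigma_algebra_preimageB => // D mD; first exact: aB.
    by apply: (Fmono (k%:R / N.+1%:R)) => //; [exact: ltW|exact: aB].
  apply/seteqP; split=> w /= H i; first by move=> _; have := H i; rewrite !mxE.
  by have := H i Logic.I; rewrite !mxE.
by rewrite (lawB _ _ (grid0 k) (grid_lt k) _ (C k) FG (mC k)) PG big_ord_recr/= muleA.
Qed.

End adapted_processes.

(** * Independence of the noise and the initial data *)

Section brownian_transfer.
Context {R : realType} {d1 d2 : measure_display}.
Context {T1 : measurableType d1} {T2 : measurableType d2}.
Variables (P1 : probability T1 R) (P2 : probability T2 R).
Variables (F1 : R -> set (set T1)) (F2 : R -> set (set T2)).
Hypotheses (hF1 : is_filtration F1) (hF2 : is_filtration F2).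
Variables (m : nat) (B1 : R -> T1 -> 'cV[R]_m) (B2 : R -> T2 -> 'cV[R]_m).
Hypotheses (hB1 : brownian_motion P1 F1 B1) (hB2 : brownian_motion P2 F2 B2).

(* With finitely many codes, independence and equality in law of Brownian paths
   turn into finite sums; no product measure on a path space is needed. *)
Lemma path_code_independent N (A : set T1) b : F1 0 A ->
  P1 (A `&` ((fun w => path_code N (B1 ^~ w)) @^-1` [set b])) =
  (P1 A * P2 ((fun w => path_code N (B2 ^~ w)) @^-1` [set b]))%E.
Proof.
move=> FA.
pose C (j : nat) (i : 'I_m) : set R := code N @^-1` [set b (inord j, i)].
have mC j i : measurable (C j i) by exact: measurable_code.
have E (T : Type) (B : R -> T -> 'cV[R]_m) :
    (fun w => path_code N (B ^~ w)) @^-1` [set b] =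
    [set w | forall j, (j < (N.+1 ^ 2).+1)%N -> forall i,
      C j i (increment N (B ^~ w) j i 0)].
  apply/seteqP; split=> w /=.
    by move=> pb j jN i; rewrite /C /= -pb ffunE /= inordK.
  move=> H; apply/ffunP => -[j i]; rewrite ffunE /=.
  by have := H j (ltn_ord j) i; rewrite /C/= inord_val.
have FT : F2 0 setT.
  have [/(_ 0 (lexx _))[F0 FC _] _ _] := hF2.
  by rewrite -[setT](setD0 setT); exact: FC.
have [_ H1] := brownian_increments hF1 hB1 N (N.+1 ^ 2).+1 FA mC.
have [_ H2] := brownian_increments hF2 hB2 N (N.+1 ^ 2).+1 FT mC.
rewrite !E H1; congr (_ * _)%E.
by rewrite -[X in P2 X](setTI) H2 probability_setT mul1e.
Qed.

Variables (e : nat) (x : T1 -> 'cV[R]_e).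
Hypothesis hx : forall i (C : set R), measurable C -> F1 0 ((fun w => x w i 0) @^-1` C).
Variables (psi : 'cV[R]_e -> (R -> 'cV[R]_m) -> R) (K : R).
Hypotheses (cpsi : path_continuous psi).
Hypothesis (psiK : forall a y, cpath y -> `|psi a y| <= K).

(** The conditional mean given the initial datum a. Computed on the second space, it is one function
    of a that can serve all first spaces. *)
Definition brownian_average (a : 'cV[R]_e) : R :=
  mean P2 (fun w => psi a (fun t => B2 t w - B2 0 w)).

Let rB1 : random_path B1.
Proof. by apply: (continuous_adapted_random_path hF1); case: hB1. Qed.

Let rB2 : random_path B2.
Proof. by apply: (continuous_adapted_random_path hF2); case: hB2. Qed.

Let rx : random_vector x.
Proof.
move=> i _ C mC; rewrite setTI; case: hF1 => _ /(_ 0 (lexx _)) Fm _.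
by apply: Fm; exact: hx.
Qed.

Let cB (T : Type) (B : R -> T -> 'cV[R]_m) w : cpath (B ^~ w) ->
  cpath (fun t => B t w - B 0 w).
Proof. by move=> cB; apply: cpathB => //; exact: cpath_cst. Qed.

Let mpsi2 a : measurable_fun setT (fun w => psi a (fun t => B2 t w - B2 0 w)).
Proof.
exact: (@measurable_path_functional R d2 T2 e m psi (cst a)).
Qed.

Lemma brownian_average_cvg (a_ : nat -> 'cV[R]_e) a :
  a_ N @[N --> \oo] --> a -> brownian_average (a_ N) @[N --> \oo] --> brownian_average a.
Proof.
move=> aN; apply: (mean_cvg (K := K)) => // [N w|].
  by apply: psiK; apply: cB; exact: rB2.1.
apply: aeW => w; apply: cpsi => // [|N|].
- by apply: cB; exact: rB2.1.
- by apply: cB; exact: rB2.1.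
- by move=> S eps eps0; apply: nearW => N t _; rewrite subrr normr0 ltW.
Qed.

Lemma brownian_average_le a : `|brownian_average a| <= K.
Proof.
apply: mean_norm_le => // w.
by apply: psiK; apply: cB; exact: rB2.1.
Qed.

Lemma measurable_brownian_average :
  measurable_fun setT (fun w => brownian_average (x w)).
Proof.
apply: (@measurable_path_functional R d1 T1 e m (fun a _ => brownian_average a) x B1) => //.
by move=> a y a_ y_ _ _ + _; exact: brownian_average_cvg.
Qed.

(** A Fubini theorem for the initial datum and the noise, with a change of the noise's space: it is
    a rearrangement of finite sums for codes, and dominated convergence on both sides gives the
    general case. *)
Lemma brownian_transfer :
  mean P1 (fun w => psi (x w) (fun t => B1 t w - B1 0 w)) =
  mean P1 (fun w => brownian_average (x w)).
Proof.
pose L N w := psi (decode_vec (vec_code N (x w))) (decode_path (path_code N (B1 ^~ w))).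
pose H N a := mean P2 (fun w => psi a (decode_path (path_code N (B2 ^~ w)))).
pose p2 N b := fine (P2 ((fun w => path_code N (B2 ^~ w)) @^-1` [set b])).
pose p1 N a := fine (P1 ((fun w => vec_code N (x w)) @^-1` [set a])).
have HE N a : H N a = \sum_b psi a (decode_path b) * p2 N b.
  have [_ <-] := @mean_finite _ _ _ P2 _ (fun w => path_code N (B2 ^~ w))
    (fun b => psi a (decode_path b)) (measurable_path_code rB2).
  by [].
have mH N a : measurable_fun setT (fun w => psi a (decode_path (path_code N (B2 ^~ w)))).
  by have [] := @mean_finite _ _ _ P2 _ (fun w => path_code N (B2 ^~ w))
    (fun b => psi a (decode_path b)) (measurable_path_code rB2).
have mHx N := @mean_finite _ _ _ P1 _ (fun w => vec_code N (x w))
    (fun a => H N (decode_vec a)) (measurable_vec_code rx).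
(* The joint law of the two codes is a product because the event on the initial datum lies in
   [F1 0]. *)
have mL N : measurable_fun setT (L N) /\ mean P1 (L N) =
    \sum_a \sum_b psi (decode_vec a) (decode_path b) * (p1 N a * p2 N b).
  pose X w := (vec_code N (x w), path_code N (B1 ^~ w)).
  have XE ab : X @^-1` [set ab] = ((fun w => vec_code N (x w)) @^-1` [set ab.1]) `&`
      ((fun w => path_code N (B1 ^~ w)) @^-1` [set ab.2]).
    by apply/seteqP; split=> [w /= <- //|w []]; rewrite /X/= => -> ->; case: (ab).
  have mX ab : measurable (X @^-1` [set ab]).
    by rewrite XE; apply: measurableI; [exact: measurable_vec_code|exact: measurable_path_code].
  have [mpX meanX] := @mean_finite _ _ _ P1 _ X
    (fun ab => psi (decode_vec ab.1) (decode_path ab.2)) mX.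
  split=> //; rewrite meanX pair_big/=; apply: eq_bigr => -[a b] _ /=.
  congr (_ * _); rewrite XE/= path_code_independent.
    by rewrite fineM// fin_num_measure//; [exact: measurable_vec_code|exact: measurable_path_code].
  have [/(_ 0 (lexx _)) sF _ _] := hF1.
  rewrite (_ : _ @^-1` _ = \bigcap_(i in setT) [set w | vec_code N (x w) i = a i]).
    apply: sigma_algebra_fin_bigcap => // i.
    rewrite (_ : mkset _ = (fun w => x w i 0) @^-1` (code N @^-1` [set a i])).
      by apply: hx; exact: measurable_code.
    by apply/seteqP; split=> w /=; rewrite ffunE.
  apply/seteqP; split=> [w /= Xb i _ /=|w Ha]; first by rewrite Xb.
  by apply/ffunP => i; exact: Ha.
have LH N : mean P1 (L N) = mean P1 (fun w => H N (decode_vec (vec_code N (x w)))).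
  rewrite (mL N).2 (mHx N).2; apply: eq_bigr => a _.
  rewrite HE big_distrl/=; apply: eq_bigr => b _.
  by rewrite -/(p1 N a); ring.
have c1 : mean P1 (L N) @[N --> \oo] --> mean P1 (fun w => psi (x w) (fun t => B1 t w - B1 0 w)).
  apply: (mean_cvg (K := K)) => [N||N w|].
  - exact: (mL N).1.
  - exact: measurable_path_functional.
  - by apply: psiK; exact: cpath_decode_path.
  - by apply: aeW => w; apply: psi_decode_cvg => //; exact: rB1.1.
have c2 : mean P1 (L N) @[N --> \oo] --> mean P1 (fun w => brownian_average (x w)).
  under eq_cvg do rewrite LH.
  apply: (mean_cvg (K := K)) => [N||N w|].
  - exact: (mHx N).1.
  - exact: measurable_brownian_average.
  - by apply: mean_norm_le => // w2; apply: psiK; exact: cpath_decode_path.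
  (* Inner limit, on the second space with w frozen; the outer one is on the first. *)
  - apply: aeW => w; apply: (mean_cvg (K := K)) => // [N w2|].
      by apply: psiK; exact: cpath_decode_path.
    by apply: aeW => w2; apply: psi_decode_cvg => //; exact: rB2.1.
exact: (cvg_unique _ c1 c2).
Qed.

End brownian_transfer.

(** * Reduction to uniformly continuous functionals *)

Section path_functions.
Context {R : realType} {V : normedModType R}.
Implicit Types (x y : R -> V) (f g : (R -> V) -> R).

Definition path_seq_continuous f : Prop :=
  forall y (y_ : nat -> R -> V), cpath y -> (forall N, cpath (y_ N)) ->
    cvg_path y_ y -> f (y_ N) @[N --> \oo] --> f y.

(** A compact subset of [[0, +oo[] lies in some [[0, T]]. *)
Lemma cvg_path_space y (y_ : nat -> R -> V) : cvg_path y_ y ->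
  (fun N => y_ N : @path_space R V) @ \oo --> (y : @path_space R V).
Proof.
move=> yy; apply/fam_cvgP => A [A0 cA].
move=> U /uniform_nbhs[ent [entE sub]].
move: entE; rewrite -entourage_ballE => -[eps /= eps0 Eeps].
have [T AT] : exists T : R, A `<=` `[0, T].
  have /compact_bounded[K [_ HK]] := cA.
  exists (`|K| + 1) => t At; rewrite /= in_itv/=.
  have := A0 t At; rewrite /= in_itv/= andbT => t0; rewrite t0/=.
  rewrite (le_trans (ler_norm t))//; apply: HK => //.
  by rewrite (le_lt_trans (ler_norm K))// ltrDl.
have eps20 : 0 < eps / 2 by rewrite divr_gt0.
have := yy T (eps / 2) eps20; rewrite /nbhs/=.
apply: filterS => N HN; apply: sub => t At; apply: Eeps => /=.
have := AT t At; rewrite /= in_itv/= => /HN.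
rewrite -ball_normE/= distrC => /le_lt_trans; apply.
by rewrite ltr_pdivrMr// mulr_natr mulr2n ltrDl.
Qed.

Lemma within_path_seq_continuous (f : @path_space R V -> R) :
  {within @continuous_paths R V, continuous f} -> path_seq_continuous f.
Proof.
move=> cf y y_ cy cy_ yy.
move/subspace_continuousP : cf => /(_ y).
have /cpathP Cy := cy; move=> /(_ Cy) H.
apply: (cvg_comp (fun N => y_ N : @path_space R V) f _ H) => A.
rewrite /within/= => HA.
have := cvg_path_space yy HA.
by apply: (@filterS _ \oo) => N; apply; exact: ((cpathP (y_ N)).1 (cy_ N)).
Qed.

Definition path_sup (T : R) y : R := sup [set `|y t| | t in `[0, T]].

Lemma path_sup_has_sup T y : 0 <= T -> cpath y ->
  has_sup [set `|y t| | t in `[0, T]].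
Proof.
move=> T0 cy; split; first by exists `|y 0|, 0 => //=; rewrite in_itv/= lexx.
have [K _ yK] := cpath_bounded T cy.
by exists K => _ [t + <-]; rewrite /= in_itv/=; exact: yK.
Qed.

Lemma path_sup_ge T y t : cpath y -> 0 <= t <= T -> `|y t| <= path_sup T y.
Proof.
move=> cy tT; have T0 : 0 <= T by case/andP: tT; exact: le_trans.
apply: ub_le_sup; first by have [] := path_sup_has_sup T0 cy.
by exists t => //=; rewrite in_itv.
Qed.

Lemma path_sup_le T y c : 0 <= T -> (forall t, 0 <= t <= T -> `|y t| <= c) ->
  path_sup T y <= c.
Proof.
move=> T0 yc; apply: ge_sup.
  by exists `|y 0|, 0 => //=; rewrite in_itv/= lexx.
by move=> _ [t + <-]; rewrite /= in_itv/=; exact: yc.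
Qed.

Lemma path_sup_ge0 T y : 0 <= T -> cpath y -> 0 <= path_sup T y.
Proof.
by move=> T0 cy; apply: le_trans (path_sup_ge cy (t := 0) _); rewrite ?lexx.
Qed.

Lemma path_sup_dist T x y e : 0 <= T -> cpath x -> cpath y ->
  (forall t, 0 <= t <= T -> `|x t - y t| <= e) ->
  path_sup T x <= path_sup T y + e.
Proof.
move=> T0 cx cy xy; apply: path_sup_le => // t tT.
rewrite -[x t](subrK (y t)) (le_trans (ler_normD _ _))// addrC lerD ?xy//.
exact: path_sup_ge.
Qed.

Variables (f : (R -> V) -> R) (G : R).
Hypotheses (cf : path_seq_continuous f) (fG : forall y, cpath y -> `|f y| <= G).

(* Lipschitz for the seminorm path_sup k, below f and converging to f: it gives
   the lower half of the convergence, and -f gives the other half. *)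
Definition inf_convolution (k : nat) x : R :=
  inf [set f y + k%:R * path_sup k%:R (fun t => y t - x t) | y in @cpath R V].

Let lower k x : cpath x -> has_inf
  [set f y + k%:R * path_sup k%:R (fun t => y t - x t) | y in @cpath R V].
Proof.
move=> cx; split; first by exists (f x + k%:R * path_sup k%:R (fun t => x t - x t)), x.
exists (- G) => _ [y cy <-]; rewrite -[- G]addr0 lerD//.
  by have := fG cy; rewrite ler_norml => /andP[].
by rewrite mulr_ge0// path_sup_ge0//; exact: cpathB.
Qed.

Lemma inf_convolution_le k x : cpath x -> inf_convolution k x <= f x.
Proof.
move=> cx; have [_ lb] := lower k cx.
have : inf_convolution k x <= f x + k%:R * path_sup k%:R (fun t => x t - x t).
  by apply: ge_inf => //; exists x.
suff -> : path_sup k%:R (fun t => x t - x t) = 0 by rewrite mulr0 addr0.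
apply/le_anti/andP; split.
  by apply: path_sup_le => // t _; rewrite subrr normr0.
by apply: path_sup_ge0 => //; exact: cpathB.
Qed.

Lemma inf_convolution_norm k x : cpath x -> `|inf_convolution k x| <= G.
Proof.
move=> cx; rewrite ler_norml; apply/andP; split; last first.
  by rewrite (le_trans (inf_convolution_le k cx))// (le_trans (ler_norm _))// fG.
apply: lb_le_inf; first by have [] := lower k cx.
move=> _ [y cy <-]; rewrite -[- G]addr0 lerD//.
  by have := fG cy; rewrite ler_norml => /andP[].
by rewrite mulr_ge0// path_sup_ge0//; exact: cpathB.
Qed.

Lemma inf_convolution_lipschitz k x x' e : cpath x -> cpath x' ->
  (forall t, 0 <= t <= k%:R -> `|x t - x' t| <= e) ->
  `|inf_convolution k x - inf_convolution k x'| <= k%:R * e.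
Proof.
move=> cx cx' xe.
suff H u u' : cpath u -> cpath u' ->
    (forall t, 0 <= t <= k%:R -> `|u t - u' t| <= e) ->
    inf_convolution k u <= inf_convolution k u' + k%:R * e.
  rewrite ler_norml lerBlDr [_ + inf_convolution _ _]addrC H// andbT.
  rewrite lerBrDl lerBlDr H// => t tk.
  by rewrite distrC xe.
move=> cu cu' ue; rewrite -lerBlDr; apply: lb_le_inf; first by have [] := lower k cu'.
move=> _ [y cy <-]; rewrite lerBlDr -addrA -mulrDr.
apply: (@le_trans _ _ (f y + k%:R * path_sup k%:R (fun t => y t - u t))).
  by apply: ge_inf; [have [] := lower k cu|exists y].
rewrite lerD2l ler_wpM2l// path_sup_dist//; try exact: cpathB.
move=> t tk; rewrite opprB addrC addrA subrK -[leLHS]normrN opprB.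
exact: ue.
Qed.

(** Near-minimizers [y_ k] pay a penalty of at most 2G + 1, so they tend to x uniformly on each
    [[0, T]]; then [f (y_ k)] tends to [f x] and squeezes the infimum from below. *)
Lemma inf_convolution_cvg x : cpath x ->
  inf_convolution k x @[k --> \oo] --> f x.
Proof.
move=> cx.
have H k : {y | cpath y & f y + k%:R * path_sup k%:R (fun t => y t - x t) <
    inf_convolution k x + k.+1%:R^-1}.
  apply: cid2; have k0 : (0 : R) < k.+1%:R^-1 by rewrite invr_gt0.
  by have [_ [y cy <-] ylt] := inf_adherent k0 (lower k cx); exists y.
pose y_ k := s2val (H k).
have cy_ k : cpath (y_ k) by rewrite /y_; case: (H k).
have Hy k : f (y_ k) + k%:R * path_sup k%:R (fun t => y_ k t - x t) <
    inf_convolution k x + k.+1%:R^-1 by rewrite /y_; case: (H k).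
have yx : cvg_path y_ x.
  move=> T eps eps0; near=> k => t /andP[t0 tT].
  have k1 : (1 : R) <= k%:R by near: k; exact: nbhs_infty_ger.
  have kT : T <= k%:R by near: k; exact: nbhs_infty_ger.
  have kG : (G + G + 1) / eps <= k%:R by near: k; exact: nbhs_infty_ger.
  have k0 : (0 : R) < k%:R by rewrite (lt_le_trans _ k1).
  have cyx : cpath (fun t => y_ k t - x t) by exact: cpathB.
  have := path_sup_ge cyx (t := t) (T := k%:R); rewrite t0 (le_trans tT)// => /(_ isT).
  move=> /le_trans; apply.
  rewrite -(ler_pM2l k0) (@le_trans _ _ (G + G + 1))//; last first.
    by rewrite -ler_pdivrMr.
  have := Hy k; have := inf_convolution_le k cx; have := fG cx; have := fG (cy_ k).
  have : k.+1%:R^-1 <= (1 : R) by rewrite invf_le1// ler1n.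
  move: (path_sup k%:R (fun t => y_ k t - x t)) => S.
  move: (inf_convolution k x) => I; move: (k.+1%:R^-1) => i.
  by rewrite !ler_norml => ? /andP[? ?] /andP[? ?] ? ?; lra.
have fy := cf cx cy_ yx.
have inv0 : (k.+1%:R^-1 : R) @[k --> \oo] --> (0 : R).
  exact: cvg_harmonic.
apply: (squeeze_cvgr (f := fun k => f (y_ k) - k.+1%:R^-1) (h := cst (f x))).
- apply: nearW => k; rewrite inf_convolution_le// andbT.
  rewrite lerBlDr ltW//; apply: le_lt_trans (Hy k).
  by rewrite lerDl mulr_ge0// path_sup_ge0//; exact: cpathB.
- by rewrite -[X in _ --> X]subr0; exact: cvgB.
- exact: cvg_cst.
Unshelve. all: by end_near. Qed.

End path_functions.

Section picard_convergence.
Context {R : realType} {d : nat}.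
Local Notation E := ('cV[R]_d * 'cV[R]_d)%type.
Variables (B : E -> E) (L : R).
Hypotheses (L0 : 0 < L) (BL : forall x y, `|B x - B y| <= L * `|x - y|).

(** The noise enters a Picard step by addition only, so the iterate depends continuously on the
    noise for uniform convergence on bounded intervals. *)
Lemma cvg_path_picard (x : E) (x_ : nat -> E) (w : R -> E) (w_ : nat -> R -> E) :
  cpath w -> (forall N, cpath (w_ N)) ->
  x_ N @[N --> \oo] --> x -> cvg_path w_ w ->
  forall k, cvg_path (fun N => picard B (x_ N) (w_ N) k) (picard B x w k).
Proof.
move=> cw cw_ xx ww; elim=> [|k IH] T e e0.
  have /cvgrPdist_le/(_ e e0) := xx.
  by apply: (@filterS _ \oo) => N xN t _ /=; rewrite distrC.
have [T0|T0] := ltP T 0.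
  by apply: nearW => N t /andP[t0 /(le_trans t0)]; rewrite leNgt T0.
have e30 : 0 < e / 3 by rewrite divr_gt0.
have T10 : 0 < T + 1 by rewrite ltr_wpDl.
(* Multiplied by L and integrated over [[0, t]] with t <= T, this tolerance stays below e/3. *)
have e40 : 0 < e / 3 / (L * (T + 1)) by rewrite divr_gt0// mulr_gt0.
have /cvgrPdist_le/(_ _ e30) H1 := xx.
have H2 := ww T _ e30.
have H3 := IH T _ e40.
near=> N.
have H1N : `|x - x_ N| <= e / 3 by near: N; exact: H1.
have H2N : forall t, 0 <= t <= T -> `|w_ N t - w t| <= e / 3 by near: N; exact: H2.
have H3N : forall t, 0 <= t <= T ->
    `|picard B (x_ N) (w_ N) k t - picard B x w k t| <= e / 3 / (L * (T + 1)).
  by near: N; exact: H3.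
move=> t /andP[t0 tT] /=.
rewrite /picard_step opprD addrACA opprD [X in X + _]addrACA.
have cBN : cpath (fun s => B (picard B (x_ N) (w_ N) k s)).
  exact: (cpath_comp (lipschitz_cont L0 BL) (cpath_picard L0 BL (cw_ N))).
have cB : cpath (fun s => B (picard B x w k s)).
  exact: (cpath_comp (lipschitz_cont L0 BL) (cpath_picard L0 BL cw)).
rewrite -(pair_integralB t cBN cB).
have -> : e = e / 3 + e / 3 + e / 3 by lra.
rewrite (le_trans (ler_normD _ _))// lerD//; last first.
  by rewrite H2N// t0.
rewrite (le_trans (ler_normD _ _))// lerD//.
  by rewrite distrC.
apply: (@le_trans _ _ (e / 3 / (T + 1) * t)).
  apply: pair_integral_le_cst => //; first exact: cpathB.
  move=> s /andP[s0 st]; rewrite (le_trans (BL _ _))// mulrC -ler_pdivlMr//.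
  have -> : e / 3 / (T + 1) / L = e / 3 / (L * (T + 1)).
    by rewrite invfM mulrA mulrAC.
  by apply: H3N; rewrite s0 (le_trans st).
rewrite mulrAC ler_pdivrMr// ler_wpM2l ?(ltW e30)// (le_trans tT)// lerDl//.
Unshelve. all: by end_near. Qed.

End picard_convergence.

(** * Cutoffs and tails *)

Section tails.
Context {R : realType}.

(** [clamp (u - K)] is a continuous surrogate for the indicator of large u, so that tails are means
    of bounded continuous functionals, open to convergence in law and to [brownian_transfer]. *)
Definition clamp (u : R) : R := Num.min 1 (Num.max 0 u).

Lemma clamp_continuous : continuous clamp.
Proof.
move=> t; have cc (a : R) : {for t, continuous (fun _ : R => a)} by exact: cst_continuous.
have ci : {for t, continuous (fun s : R => s)} by exact: cvg_id.
exact: (continuous_min (cc 1) (continuous_max (cc 0) ci)).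
Qed.

Lemma clamp_ge0_le1 u : 0 <= clamp u <= 1.
Proof. by rewrite /clamp le_min ler01 le_max lexx/= ge_min lexx. Qed.

Lemma clamp_norm u : `|clamp u| <= 1.
Proof. by have /andP[u0 u1] := clamp_ge0_le1 u; rewrite ger0_norm. Qed.

Lemma clamp1 u : 1 <= u -> clamp u = 1.
Proof. by move=> u1; rewrite /clamp min_l// le_max u1 orbT. Qed.

Lemma clamp0 u : u <= 0 -> clamp u = 0.
Proof. by move=> u0; rewrite /clamp (max_l u0) min_r. Qed.

Lemma cvg_path_sup (V : normedModType R) (T : R) (y : R -> V) (y_ : nat -> R -> V) :
  0 <= T -> cpath y -> (forall N, cpath (y_ N)) -> cvg_path y_ y ->
  path_sup T (y_ N) @[N --> \oo] --> path_sup T y.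
Proof.
move=> T0 cy cy_ yy; apply/cvgrPdist_le => e e0.
have := yy T e e0; apply: (@filterS _ \oo) => N yN.
rewrite ler_norml; apply/andP; split.
  by rewrite lerBrDl lerBlDr; exact: path_sup_dist.
rewrite lerBlDl; apply: path_sup_dist => // t tT.
by rewrite distrC yN.
Qed.

End tails.

(** Dominated convergence gives sequential continuity of [brownian_average], whereas convergence in
    law tests continuous functions. *)
Lemma seq_continuous_continuous (R : realType) (V : normedModType R) (f : V -> R) :
  (forall x (x_ : nat -> V), x_ N @[N --> \oo] --> x ->
     f (x_ N) @[N --> \oo] --> f x) -> continuous f.
Proof.
move=> H x; apply: contrapT => /cvgrPdist_lt nf.
have {nf}[e e0 nf] : exists2 e, 0 < e & ~ \forall y \near x, `|f x - f y| < e.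
  by apply: contrapT => h; apply: nf => e e0; apply: contrapT => ne; apply: h; exists e.
have {}nf N : exists y, `|x - y| < N.+1%:R^-1 /\ e <= `|f x - f y|.
  apply: contrapT => h; apply: nf; apply/nbhs_ballP; exists N.+1%:R^-1 => /=.
    by rewrite invr_gt0.
  move=> y; rewrite -ball_normE/= => xy; rewrite ltNge; apply/negP => exy.
  by apply: h; exists y.
have [x_ Hx] := choice nf.
have xx : x_ N @[N --> \oo] --> x.
  apply/cvgrPdist_lt => eps eps0.
  have := @cvg_harmonic R; move/cvgrPdist_lt/(_ eps eps0).
  apply: (@filterS _ \oo) => N /=; rewrite sub0r normrN ger0_norm ?invr_ge0//.
  by apply: lt_trans; have [] := Hx N.
have /cvgrPdist_lt/(_ e e0) := H x x_ xx.
move=> /(@filter_ex _ \oo)[N]; have [_] := Hx N.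
by rewrite leNgt => /negP.
Qed.

Section brownian_projection.
Context {R : realType} {dT : measure_display} {T : measurableType dT}.
Variables (P : probability T R) (F : R -> set (set T)) (d n : nat).
Variables (W : R -> T -> 'cV[R]_d) (Wz : R -> T -> 'cV[R]_n).

(** Test the coordinates of [Wz] against the full line: each contributes a factor 1 to the product
    formula. *)
Lemma brownian_motion_col_mx :
  brownian_motion P F (fun t w => col_mx (W t w) (Wz t w)) ->
  brownian_motion P F W.
Proof.
move=> [[aB cB] B0 lawB].
have WE t w i : W t w i 0 = col_mx (W t w) (Wz t w) (lshift n i) 0.
  by rewrite col_mxEu.
split.
- split=> [t t0 i C mC|w].
    rewrite (_ : (fun w => W t w i 0) = (fun w => col_mx (W t w) (Wz t w) (lshift n i) 0)).
      exact: aB.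
    by apply/funext => w; exact: WE.
  apply/cpathP; apply: cpath_mx => i j; rewrite ord1.
  have /cpathP cBw := cB w.
  apply: (cpath_eq (x := fun t => col_mx (W t w) (Wz t w) (lshift n i) 0)).
    by move=> t _; rewrite WE.
  exact: (cpath_coord (i := lshift n i) (j := 0) cBw).
- apply: filterS B0 => w B0; rewrite -[W 0 w](@col_mxKu _ d n 1 _ (Wz 0 w)) B0.
  by rewrite linear0.
move=> s t s0 st A C FA mC.
pose C' (i : 'I_(d + n)) : set R := match fintype.split i with inl j => C j | inr _ => setT end.
have C'l j : C' (lshift n j) = C j.
  by rewrite /C'; case: splitP => k /= jk; [congr C; exact: val_inj|
     have := ltn_ord j; rewrite jk ltnNge leq_addr].
have C'r j : C' (rshift d j) = setT.
  rewrite /C'; case: splitP => // k /= jk.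
  by have := ltn_ord k; rewrite -jk ltnNge leq_addr.
have mC' i : measurable (C' i) by rewrite /C'; case: fintype.split => // j; exact: mC.
have := lawB s t s0 st A C' FA mC'.
rewrite big_split_ord/= (eq_bigr (fun j => normal_prob 0 (Num.sqrt (t - s)) (C j))); last first.
  by move=> j _; rewrite C'l.
rewrite [X in (_ * (_ * X))%E]big1 ?mule1; last first.
  by move=> j _; rewrite C'r; exact: (@probability_setT _ _ _ (normal_prob 0 (Num.sqrt (t - s)))).
move=> <-; congr (P (A `&` _)); apply/seteqP; split=> w /= Cw i.
  rewrite opp_col_mx add_col_mx -(splitK i); case: (fintype.split i) => j /=.
    by rewrite C'l col_mxEu.
  by rewrite C'r.
by have := Cw (lshift n i); rewrite C'l opp_col_mx add_col_mx col_mxEu.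
Qed.

End brownian_projection.

(** * Convergence in law *)

Section comparison.
Context {R : realType} {dT : measure_display} {T : measurableType dT}.
Variable P : probability T R.

(** Almost surely, either both cutoffs are below 1 and the difference is at most e, or one of them
    equals 1 and pays for the trivial bound 2G. *)
Lemma mean_compare (u v t1 t2 : T -> R) (G e : R) :
  measurable_fun setT u -> measurable_fun setT v ->
  measurable_fun setT t1 -> measurable_fun setT t2 ->
  (forall w, `|u w| <= G) -> (forall w, `|v w| <= G) ->
  (forall w, 0 <= t1 w <= 1) -> (forall w, 0 <= t2 w <= 1) -> 0 <= e ->
  {ae P, forall w, t1 w < 1 -> t2 w < 1 -> `|u w - v w| <= e} ->
  `|mean P u - mean P v| <= e + 2 * G * (mean P t1 + mean P t2).
Proof.
move=> mu mv mt1 mt2 uG vG t101 t201 e0 uv.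
have G0 : 0 <= G by rewrite (le_trans _ (uG point)).
have t1n w : `|t1 w| <= 1 by have /andP[? ?] := t101 w; rewrite ger0_norm.
have t2n w : `|t2 w| <= 1 by have /andP[? ?] := t201 w; rewrite ger0_norm.
pose r w := e + 2 * G * (t1 w + t2 w).
have mt12 : measurable_fun setT (fun w => t1 w + t2 w) by exact: measurable_funD.
have mr0 : measurable_fun setT (fun w => 2 * G * (t1 w + t2 w)).
  by apply: measurable_funM => //; exact: measurable_cst.
have mr : measurable_fun setT r.
  by apply: measurable_funD => //; exact: measurable_cst.
have t12n w : `|t1 w + t2 w| <= 2.
  by rewrite (le_trans (ler_normD _ _))// (_ : 2 = 1 + 1)// lerD.
have r0n w : `|2 * G * (t1 w + t2 w)| <= 4 * G + e + G.
  rewrite normrM ger0_norm ?mulr_ge0// (@le_trans _ _ (2 * G * 2))//.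
    by rewrite ler_wpM2l// mulr_ge0.
  by lra.
have rn w : `|r w| <= 4 * G + e + e + G.
  rewrite /r (le_trans (ler_normD _ _))// ger0_norm//.
  by have := r0n w; lra.
have meanr : mean P r = e + 2 * G * (mean P t1 + mean P t2).
  have me : measurable_fun setT (cst e : T -> R) by exact: measurable_cst.
  have en (w : T) : `|cst e w| <= 4 * G + e + G by rewrite /= ger0_norm//; lra.
  rewrite (@meanD _ _ _ P _ _ _ me mr0 en r0n) mean_cst.
  by rewrite (@meanZ _ _ _ P _ _ _ mt12 t12n) (@meanD _ _ _ P _ _ _ mt1 mt2 t1n t2n).
have key : {ae P, forall w, `|u w - v w| <= r w}.
  apply: filterS uv => w uv.
  have /andP[t10 t11] := t101 w; have /andP[t20 t21] := t201 w.
  have [t1w|t1w] := ltP (t1 w) 1; first have [t2w|t2w] := ltP (t2 w) 1.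
  - rewrite (le_trans (uv t1w t2w))// lerDl mulr_ge0 ?addr_ge0//; exact: mulr_ge0.
  - have : `|u w - v w| <= G + G by rewrite (le_trans (ler_normB _ _))// lerD.
    by rewrite /r; nra.
  - have : `|u w - v w| <= G + G by rewrite (le_trans (ler_normB _ _))// lerD.
    by rewrite /r; nra.
rewrite -meanr.
have vr (a b : T -> R) : measurable_fun setT a -> measurable_fun setT b ->
    (forall w, `|a w| <= G) -> (forall w, `|b w| <= G) ->
    {ae P, forall w, `|a w - b w| <= r w} -> mean P a <= mean P b + mean P r.
  move=> ma mb aG bG ab.
  have bG' w : `|b w| <= 4 * G + e + e + G by rewrite (le_trans (bG w))//; lra.
  rewrite -(@meanD _ _ _ P _ _ _ mb mr bG' rn).
  apply: (@mean_le_ae _ _ _ P _ _ (4 * G + e + e + G + G)) => //.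
  - exact: measurable_funD.
  - by move=> w; rewrite (le_trans (aG w))//; lra.
  - by move=> w; rewrite (le_trans (ler_normD _ _))// addrC lerD.
  - by apply: filterS ab => w; rewrite ler_norml => /andP[_]; rewrite lerBlDr addrC.
rewrite ler_norml; apply/andP; split.
  rewrite lerBrDl lerBlDr vr//.
  by apply: filterS key => w; rewrite distrC.
by rewrite lerBlDl vr.
Qed.

End comparison.

Lemma nonexpansive_continuous (R : realType) (V U : normedModType R) (f : V -> U) :
  (forall x y, `|f x - f y| <= `|x - y|) -> continuous f.
Proof.
move=> H x; apply/cvgrPdist_lt => e e0.
have : \forall y \near x, `|x - y| < e.
  by have /cvgrPdist_lt/(_ e e0) := @cvg_id _ (nbhs x).
by apply: (@filterS _ (nbhs x)) => y; exact: le_lt_trans.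
Qed.

Section pair_paths.
Context {R : realType} {d : nat}.
Local Notation E := ('cV[R]_d * 'cV[R]_d)%type.

(** Momentum and position are packed into one column, the format of [random_vector] and of the
    codes. *)
Definition unstack (a : 'cV[R]_(d + d)) : E := (usubmx a, dsubmx a).

Definition stack (x : E) : 'cV[R]_(d + d) := col_mx x.1 x.2.

Lemma stackK : cancel stack unstack.
Proof. by move=> [a b]; rewrite /unstack/stack col_mxKu col_mxKd. Qed.

Lemma unstackB a b : unstack (a - b) = unstack a - unstack b.
Proof. by rewrite /unstack !linearB. Qed.

Lemma unstack_norm a : `|unstack a| <= `|a|.
Proof.
rewrite pair_norm_le; apply/andP; split; apply: mx_norm_le => // i j;
  by rewrite mxE mx_norm_coord.
Qed.

Lemma stack_norm x : `|stack x| <= `|x|.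
Proof.
have /andP[x1 x2] : (`|x.1| <= `|x|) && (`|x.2| <= `|x|) by rewrite -pair_norm_le.
apply: mx_norm_le => // i j; rewrite mxE ord1.
by case: fintype.split => k; rewrite (le_trans (mx_norm_coord _ _ _)).
Qed.

Lemma stackB x y : stack x - stack y = stack (x - y).
Proof. by rewrite /stack opp_col_mx add_col_mx. Qed.

Lemma unstack_continuous : continuous unstack.
Proof.
by apply: nonexpansive_continuous => a b; rewrite -unstackB unstack_norm.
Qed.

Lemma stack_continuous : continuous stack.
Proof.
by apply: nonexpansive_continuous => a b; rewrite stackB stack_norm.
Qed.

Variables (dT : measure_display) (T : measurableType dT).

Lemma random_path_stack (y1 y2 : R -> T -> 'cV[R]_d) :
  random_path y1 -> random_path y2 ->
  random_path (fun t w => stack (y1 t w, y2 t w)).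
Proof.
move=> [c1 m1] [c2 m2]; split=> [w|t t0 i].
  by apply: (cpath_comp stack_continuous); apply: cpath_pair; [exact: c1|exact: c2].
rewrite -(splitK i); case: (fintype.split i) => j /=.
  rewrite (_ : (fun _ => _) = (fun w => y1 t w j 0)); first exact: m1.
  by apply/funext => w; rewrite col_mxEu.
rewrite (_ : (fun _ => _) = (fun w => y2 t w j 0)); first exact: m2.
by apply/funext => w; rewrite col_mxEd.
Qed.

(** [measurable_path_functional] sees centered paths, so the path is recovered as its initial value
    plus its centered part. *)
Lemma measurable_path_seq_continuous (f : (R -> E) -> R)
    (y1 y2 : R -> T -> 'cV[R]_d) : path_seq_continuous f ->
  random_path y1 -> random_path y2 ->
  measurable_fun setT (fun w => f (fun t => (y1 t w, y2 t w))).
Proof.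
move=> cf r1 r2.
pose psi (a : 'cV[R]_(d + d)) (w : R -> 'cV[R]_(d + d)) :=
  f (fun t => unstack (a + w t)).
have rY := random_path_stack r1 r2.
have cpsi : path_continuous psi.
  move=> a y a_ y_ cy cy_ aa yy; apply: cf.
  - apply: (cpath_comp unstack_continuous); apply: cpathD => //; exact: cpath_cst.
  - move=> N; apply: (cpath_comp unstack_continuous); apply: cpathD => //.
    exact: cpath_cst.
  - move=> S e e0; have e20 : 0 < e / 2 by rewrite divr_gt0.
    have := yy S _ e20; have /cvgrPdist_le/(_ _ e20) := aa.
    apply: (@filterS2 _ \oo) => N aN yN t tS.
    rewrite -unstackB (le_trans (unstack_norm _))// opprD addrACA.
    by rewrite [e]splitr (le_trans (ler_normD _ _))// lerD ?yN// distrC.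
have := measurable_path_functional cpsi (rY.2 0 (lexx _)) rY.
congr measurable_fun; apply/funext => w; rewrite /psi; congr f.
by apply/funext => t; rewrite addrC subrK stackK.
Qed.

End pair_paths.

Section tail_functionals.
Context {R : realType} {e m : nat}.

Lemma path_continuous_sup_tail (S K : R) : 0 <= S ->
  path_continuous (fun (_ : 'cV[R]_e) (y : R -> 'cV[R]_m) => clamp (path_sup S y - K)).
Proof.
move=> S0 a y a_ y_ cy cy_ _ yy.
apply: (cvg_comp (fun N => path_sup S (y_ N) - K) (@clamp R)); last exact: clamp_continuous.
by apply: cvgB; [exact: cvg_path_sup|exact: cvg_cst].
Qed.

Lemma path_continuous_fun (h : 'cV[R]_e -> R) : continuous h ->
  path_continuous (fun a (_ : R -> 'cV[R]_m) => h a).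
Proof. by move=> ch a y a_ y_ _ _ aa _; apply: (cvg_comp a_ h _ (ch a)). Qed.

End tail_functionals.

Section tails_of_processes.
Context {R : realType} {dT : measure_display} {T : measurableType dT}.
Variable P : probability T R.

(** h is finite at each w, so the cutoff is eventually 0 there. *)
Lemma mean_clamp_cvg0 (h : T -> R) : measurable_fun setT h ->
  mean P (fun w => clamp (h w - N%:R)) @[N --> \oo] --> (0 : R).
Proof.
move=> mh; rewrite -[X in _ --> X](@mean_cst _ _ _ P 0).
apply: (mean_cvg (K := 1)) => [N||N w|].
- apply: (measurableT_comp (f := @clamp R)).
    exact: continuous_measurable_fun clamp_continuous.
  by apply: measurable_funB.
- exact: measurable_cst.
- exact: clamp_norm.
- apply: aeW => w; apply: cvg_near_cst; near=> N.
  by rewrite clamp0// subr_le0; near: N; exact: nbhs_infty_ger.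
Unshelve. all: by end_near. Qed.

Definition centered {m : nat} (B : R -> T -> 'cV[R]_m) (w : T) : R -> 'cV[R]_m :=
  fun t => B t w - B 0 w.

Lemma cpath_centered {m : nat} (B : R -> T -> 'cV[R]_m) w :
  cpath (B ^~ w) -> cpath (centered B w).
Proof. by move=> cB; apply: cpathB => //; exact: cpath_cst. Qed.

Lemma measurable_path_sup {m : nat} (S : R) (B : R -> T -> 'cV[R]_m) :
  0 <= S -> random_path B -> measurable_fun setT (fun w => path_sup S (centered B w)).
Proof.
move=> S0 rB.
(* The initial datum is the only vector of dimension 0. *)
apply: (@measurable_path_functional _ _ _ 0 m (fun _ y => path_sup S y) (fun=> 0)) => //.
  by move=> a y a_ y_ cy cy_ _ yy; exact: cvg_path_sup.
Qed.

Lemma measurable_sup_tail {m : nat} (S K : R) (B : R -> T -> 'cV[R]_m) :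
  0 <= S -> random_path B ->
  measurable_fun setT (fun w => clamp (path_sup S (centered B w) - K)).
Proof.
move=> S0 rB; apply: (measurableT_comp (f := @clamp R)).
  exact: continuous_measurable_fun clamp_continuous.
by apply: measurable_funB => //; exact: measurable_path_sup.
Qed.

Lemma measurable_continuous_fun {e : nat} (h : 'cV[R]_e -> R) (x : T -> 'cV[R]_e) :
  continuous h -> random_vector x -> measurable_fun setT (fun w => h (x w)).
Proof.
move=> ch rx.
have r0 : random_path (fun (_ : R) (_ : T) => 0 : 'cV[R]_0).
  by split=> [w|t _ []//]; exact: cpath_cst.
exact: (measurable_path_functional (path_continuous_fun (m := 0) ch) rx r0).
Qed.

End tails_of_processes.

(** [brownian_transfer] with a trivial initial datum. It makes the tail of the noise independent of
    nu. *)
Lemma brownian_sup_tail (R : realType) (m : nat) (S K : R)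
    (d1 d2 : measure_display) (T1 : measurableType d1) (T2 : measurableType d2)
    (P1 : probability T1 R) (P2 : probability T2 R)
    (F1 : R -> set (set T1)) (F2 : R -> set (set T2))
    (B1 : R -> T1 -> 'cV[R]_m) (B2 : R -> T2 -> 'cV[R]_m) :
  is_filtration F1 -> is_filtration F2 ->
  brownian_motion P1 F1 B1 -> brownian_motion P2 F2 B2 -> 0 <= S ->
  mean P1 (fun w => clamp (path_sup S (centered B1 w) - K)) =
  mean P2 (fun w => clamp (path_sup S (centered B2 w) - K)).
Proof.
move=> hF1 hF2 hB1 hB2 S0.
have := @brownian_transfer R _ _ T1 T2 P1 P2 F1 F2 hF1 hF2 m B1 B2 hB1 hB2 0
  (fun=> 0) _ _ 1 (@path_continuous_sup_tail R 0 m S K S0).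
move=> -> //.
- by rewrite /brownian_average -[RHS](@mean_cst _ _ _ P1).
- by case.
- by move=> a y _; exact: clamp_norm.
Qed.

Section one_space.
Context {R : realType} {d : nat}.
Local Notation E := ('cV[R]_d * 'cV[R]_d)%type.
Variables (B : E -> E) (L : R) (sigma : 'M[R]_d).
Hypotheses (L0 : 0 < L) (BL : forall x y, `|B x - B y| <= L * `|x - y|).
Variables (g : (R -> E) -> R) (G : R).
Hypotheses (cg : path_seq_continuous g) (gG : forall y, cpath y -> `|g y| <= G).

Definition noise (w : R -> 'cV[R]_d) : R -> E := fun s => (sigma *m w s, 0).

Lemma cpath_noise w : cpath w -> cpath (noise w).
Proof.
move=> cw; apply: cpath_pair; last exact: cpath_cst.
by apply: cpath_mulmx => //; exact: cpath_cst.
Qed.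

Definition picard_functional (k : nat) (a : 'cV[R]_(d + d)) (w : R -> 'cV[R]_d) : R :=
  g (picard B (unstack a) (noise w) k).

Lemma path_continuous_picard k : path_continuous (picard_functional k).
Proof.
move=> a w a_ w_ cw cw_ aa ww; apply: cg.
- exact/(cpath_picard L0 BL)/cpath_noise.
- by move=> N; exact/(cpath_picard L0 BL)/cpath_noise.
apply: (cvg_path_picard L0 BL).
- exact: cpath_noise.
- by move=> N; exact: cpath_noise.
- by apply: (cvg_comp a_ (@unstack R d) aa); exact: unstack_continuous.
move=> S e e0; have c0 : 0 < d%:R * `|sigma| + 1 by rewrite ltr_wpDl// mulr_ge0.
have := ww S (e / (d%:R * `|sigma| + 1)) (divr_gt0 e0 c0).
apply: (@filterS _ \oo) => N wN t tS; rewrite pair_norm_le /= subrr normr0 (ltW e0) andbT.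
rewrite -mulmxBr (le_trans (mulmx_norm _ _))//.
rewrite (@le_trans _ _ ((d%:R * `|sigma| + 1) * `|w_ N t - w t|))//.
  by rewrite ler_wpM2r// lerDl.
by rewrite mulrC -ler_pdivlMr// wN.
Qed.

Lemma picard_functional_le k a w : cpath w -> `|picard_functional k a w| <= G.
Proof. by move=> cw; apply/gG/(cpath_picard L0 BL)/cpath_noise. Qed.

Variables (dT : measure_display) (T : measurableType dT) (P : probability T R).
Variables (b : nat) (W : R -> T -> 'cV[R]_d) (Bm : R -> T -> 'cV[R]_b).
Variables (x : T -> E) (y1 y2 : R -> T -> 'cV[R]_d).
Hypotheses (rW : random_path W) (rBm : random_path Bm).
Hypotheses (rx : random_vector (fun w => stack (x w))).
Hypotheses (r1 : random_path y1) (r2 : random_path y2).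

(** [W] drives the iterate, while [Bm] is the noise whose size is cut off: for the constrained
    dynamics the latter also contains [Wz]. Cutoffs at K are below 1 only for sizes below K + 1. *)
Lemma picard_compare (k : nat) (K S delta e : R) : 0 <= S -> 0 <= e ->
  (forall u v, cpath u -> cpath v ->
     (forall t, 0 <= t <= S -> `|u t - v t| <= delta) -> `|g u - g v| <= e) ->
  {ae P, forall w, `|x w| <= K + 1 ->
    (forall t, 0 <= t <= S -> `|centered Bm w t| <= K + 1) ->
    forall t, 0 <= t <= S ->
      `|(y1 t w, y2 t w) - picard B (x w) (noise (centered W w)) k t| <= delta} ->
  `|mean P (fun w => g (fun t => (y1 t w, y2 t w))) -
    mean P (fun w => picard_functional k (stack (x w)) (centered W w))| <=
  e + 2 * G * (mean P (fun w => clamp (`|x w| - K)) +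
               mean P (fun w => clamp (path_sup S (centered Bm w) - K))).
Proof.
move=> S0 e0 gunif Hy; apply: mean_compare => //.
- exact: measurable_path_seq_continuous.
- apply: measurable_path_functional => //; exact: path_continuous_picard.
- rewrite (_ : (fun w => _) = (fun w => clamp (`|unstack (stack (x w))| - K))).
    apply: (measurable_continuous_fun (h := fun a => clamp (`|unstack a| - K))) => // a.
    apply: (continuous_comp (f := fun a => `|unstack a| - K)); last exact: clamp_continuous.
    exact: (cvgB (cvg_norm (@unstack_continuous R d a)) (cvg_cst K)).
  by apply/funext => w; rewrite stackK.
- exact: measurable_sup_tail.
- by move=> w; apply: gG; apply: cpath_pair; [exact: r1.1|exact: r2.1].
- by move=> w; apply: picard_functional_le; apply: cpath_centered; exact: rW.1.
- by move=> w; exact: clamp_ge0_le1.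
- by move=> w; exact: clamp_ge0_le1.
apply: filterS Hy => w Hy t1 t2.
have lt1 u : clamp (u - K) < 1 -> u <= K + 1.
  by move=> u1; rewrite leNgt; apply/negP => uK; move: u1; rewrite clamp1 ?ltxx// lerBrDl ltW.
rewrite /picard_functional stackK; apply: gunif.
- by apply: cpath_pair; [exact: r1.1|exact: r2.1].
- by apply/(cpath_picard L0 BL)/cpath_noise/cpath_centered/rW.1.
apply: Hy; first exact: lt1.
move=> t tS; rewrite (le_trans _ (lt1 _ t2))// path_sup_ge//.
by apply: cpath_centered; exact: rBm.1.
Qed.

End one_space.

Lemma adapted_stack0 (R : realType) (d : nat) (dT : measure_display)
    (T : measurableType dT) (F : R -> set (set T)) (p q : R -> T -> 'cV[R]_d) :
  adapted F p -> adapted F q -> forall i (C : set R), measurable C ->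
  F 0 ((fun w => stack (p 0 w, q 0 w) i 0) @^-1` C).
Proof.
move=> ap aq i C mC; rewrite -(splitK i); case: (fintype.split i) => j /=.
  rewrite (_ : (fun _ => _) = (fun w => p 0 w j 0)); first exact: ap.
  by apply/funext => w; rewrite col_mxEu.
rewrite (_ : (fun _ => _) = (fun w => q 0 w j 0)); first exact: aq.
by apply/funext => w; rewrite col_mxEd.
Qed.

(** * Passage to the limit in nu *)

Section limit_in_law.
Context {R : realType} {d n : nat}.
Local Notation E := ('cV[R]_d * 'cV[R]_d)%type.
Variables (B : E -> E) (L : R) (sigma : 'M[R]_d).
Hypotheses (L0 : 0 < L) (BL : forall x y, `|B x - B y| <= L * `|x - y|).
Variables (dT : R -> measure_display) (T : forall nu : R, measurableType (dT nu)).
Variables (P : forall nu : R, probability (T nu) R).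
Variables (F : forall nu : R, R -> set (set (T nu))).
Variables (W q p y1 : forall nu : R, R -> T nu -> 'cV[R]_d).
Variables (Wz : forall nu : R, R -> T nu -> 'cV[R]_n).
Arguments P : clear implicits.
Arguments F : clear implicits.
Arguments W : clear implicits.
Arguments q : clear implicits.
Arguments p : clear implicits.
Arguments y1 : clear implicits.
Arguments Wz : clear implicits.
Hypotheses (hF : forall nu : R, 0 < nu -> is_filtration (F nu)).
Hypotheses (hB : forall nu : R, 0 < nu ->
  brownian_motion (P nu) (F nu) (fun t w => col_mx (W nu t w) (Wz nu t w))).
Hypotheses (hq : forall nu : R, 0 < nu -> continuous_adapted (F nu) (q nu)).
Hypotheses (hp : forall nu : R, 0 < nu -> continuous_adapted (F nu) (p nu)).
Hypotheses (hy1 : forall nu : R, 0 < nu -> random_path (y1 nu)).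
Variables (dT0 : measure_display) (T0 : measurableType dT0) (P0 : probability T0 R).
Variables (F0 : R -> set (set T0)) (W0 q0 p0 : R -> T0 -> 'cV[R]_d).
Hypotheses (hF0 : is_filtration F0) (hW0 : brownian_motion P0 F0 W0).
Hypotheses (hq0 : continuous_adapted F0 q0) (hp0 : continuous_adapted F0 p0).
Hypothesis (hinit : cvg_in_law setT P (fun nu w => (p nu 0 w, q nu 0 w))
                                    P0 (fun w => (p0 0 w, q0 0 w))).
(** [y1] stands for either momentum, [p] or [M_nu M^-1 p], so that both convergences follow from one
    argument. Initial data and iterates are always those of [p]. *)
Hypothesis hY : forall K S : R, 0 <= K -> 0 <= S ->
  exists C nu0 : R, [/\ 0 <= C, 0 < nu0 & forall nu : R, 0 < nu -> nu < nu0 ->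
    {ae P nu, forall w, `|(p nu 0 w, q nu 0 w)| <= K ->
    (forall t, 0 <= t <= S ->
      `|centered (fun t w => col_mx (W nu t w) (Wz nu t w)) w t| <= K) ->
    forall k t, 0 <= t <= S -> `|(y1 nu t w, q nu t w) -
      picard B (p nu 0 w, q nu 0 w) (noise sigma (centered (W nu) w)) k t| <=
      C * ((2 ^+ k)^-1 + nu)}].
Hypothesis hX : forall K S : R, 0 <= K -> 0 <= S -> exists2 C : R, 0 <= C &
    {ae P0, forall w, `|(p0 0 w, q0 0 w)| <= K ->
    (forall t, 0 <= t <= S -> `|centered W0 w t| <= K) ->
    forall k t, 0 <= t <= S -> `|(p0 t w, q0 t w) -
      picard B (p0 0 w, q0 0 w) (noise sigma (centered W0 w)) k t| <=
      C * (2 ^+ k)^-1}.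

Lemma mean_init_cvg (f : E -> R) (K : R) : continuous f -> (forall x, `|f x| <= K) ->
  mean (P nu) (fun w => f (p nu 0 w, q nu 0 w)) @[nu --> 0^'+] -->
  mean P0 (fun w => f (p0 0 w, q0 0 w)).
Proof.
move=> cf fK.
have mf0 : measurable_fun setT (fun w => f (p0 0 w, q0 0 w)).
  rewrite (_ : (fun _ => _) = (fun w => f (unstack (stack (p0 0 w, q0 0 w))))).
    apply: (measurable_continuous_fun (h := fun a => f (unstack a))).
      by move=> a; apply: continuous_comp; [exact: unstack_continuous|exact: cf].
    have r1 := continuous_adapted_random_path hF0 hp0.
    have r2 := continuous_adapted_random_path hF0 hq0.
    exact: (random_path_stack r1 r2).2.
  by apply/funext => w; rewrite stackK.
have H := @hinit f (continuous_subspaceT cf) (ex_intro _ K (fun x _ => fK x)).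
rewrite (expectation_mean P0 mf0 (fun w => fK _)) in H.
(* This holds for every real nu, even where nothing is known of the process: [mean] is by definition
   the finite part of the expectation. *)
rewrite (_ : (fun nu : R => _) =
  (fun nu => fine 'E_(P nu)[fun w => f (p nu 0 w, q nu 0 w)]%E)); last first.
  by apply/funext => nu; rewrite unlock.
exact: fine_cvg H.
Qed.

Lemma exp2_small (C e : R) : 0 <= C -> 0 < e -> exists k, C * (2 ^+ k)^-1 <= e.
Proof.
move=> C0 e0; exists (Num.truncn (C / e)).+1.
rewrite ler_pdivrMr ?exprn_gt0// mulrC -ler_pdivrMr//.
by rewrite (le_trans (ltW (truncnS_gt _)))// -natrX ler_nat ltnW// ltn_expl.
Qed.

Lemma mean_uniformly_continuous_cvg (g : (R -> E) -> R) (G : R) :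
  path_seq_continuous g -> (forall y, cpath y -> `|g y| <= G) ->
  (forall e : R, 0 < e -> exists S delta : R, [/\ 0 <= S, 0 < delta &
    forall u v, cpath u -> cpath v ->
      (forall t, 0 <= t <= S -> `|u t - v t| <= delta) -> `|g u - g v| <= e]) ->
  mean (P nu) (fun w => g (fun t => (y1 nu t w, q nu t w))) @[nu --> 0^'+] -->
  mean P0 (fun w => g (fun t => (p0 t w, q0 t w))).
Proof.
move=> cg gG gunif; have G0 : 0 <= G.
  by rewrite (le_trans (normr_ge0 _) (gG (fun=> 0) _))//; exact: cpath_cst.
apply/cvgrPdist_le => e e0.
have e60 : 0 < e / 6 by rewrite divr_gt0.
have [S [delta [S0 delta0 gSd]]] := gunif _ e60.
have delta20 : 0 < delta / 2 by rewrite divr_gt0.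
(* In each of the two comparisons with a Picard iterate, e/6 goes to the modulus of g and e/6 to the
   tails, [2 * G * (eta + eta)]; one more e/6 goes to the initial laws. *)
pose eta := e / (24 * (G + 1)).
have eta0 : 0 < eta by rewrite divr_gt0// mulr_gt0// ltr_wpDl.
have etaG : 2 * G * (eta + eta) <= e / 6.
  have -> : e / 6 = 2 * (G + 1) * (eta + eta).
    by rewrite /eta; field; rewrite gt_eqF// ltr_wpDl.
  by rewrite ler_wpM2r// ?addr_ge0 ?(ltW eta0)// ler_wpM2l// lerDl.
have eta20 : 0 < eta / 2 by rewrite divr_gt0.
have rW0 : random_path W0 by apply: (continuous_adapted_random_path hF0); case: hW0.
have rp0 := continuous_adapted_random_path hF0 hp0.
have rq0 := continuous_adapted_random_path hF0 hq0.
pose BB nu t w := col_mx (W nu t w) (Wz nu t w).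
have rB (nu : R) : 0 < nu -> random_path (BB nu).
  by move=> nu0; apply: (continuous_adapted_random_path (hF nu0)); case: (hB nu0).
have mx0 : measurable_fun setT (fun w => `|(p0 0 w, q0 0 w)|).
  rewrite (_ : (fun _ => _) = (fun w => `|unstack (stack (p0 0 w, q0 0 w))|)).
    apply: (measurable_continuous_fun (h := fun a => `|unstack a|)).
      by move=> a; exact: (cvg_norm (@unstack_continuous R d a)).
    exact: (random_path_stack rp0 rq0).2.
  by apply/funext => w; rewrite stackK.
have tail1 := mean_clamp_cvg0 P0 mx0.
have tail2 := mean_clamp_cvg0 P0 (measurable_path_sup S0 rW0).
(* The space at nu = 1 represents all others, by [brownian_sup_tail]. *)
have tail3 := mean_clamp_cvg0 (P 1) (measurable_path_sup S0 (rB _ ltr01)).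
have [N [t1N [t2N t3N]]] : exists N : nat,
    mean P0 (fun w => clamp (`|(p0 0 w, q0 0 w)| - N%:R)) < eta / 2 /\
    mean P0 (fun w => clamp (path_sup S (centered W0 w) - N%:R)) < eta /\
    mean (P 1) (fun w => clamp (path_sup S (centered (BB 1) w) - N%:R)) < eta.
  have : \forall N \near \oo,
      mean P0 (fun w => clamp (`|(p0 0 w, q0 0 w)| - N%:R)) < eta / 2 /\
      mean P0 (fun w => clamp (path_sup S (centered W0 w) - N%:R)) < eta /\
      mean (P 1) (fun w => clamp (path_sup S (centered (BB 1) w) - N%:R)) < eta.
    near=> N; split; [|split]; near: N.
    - exact: (cvgr_lt _ tail1).
    - exact: (cvgr_lt _ tail2).
    - exact: (cvgr_lt _ tail3).
  exact: (@filter_ex _ \oo).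
set K : R := N%:R in t1N t2N t3N.
have K10 : 0 <= K + 1 by rewrite addr_ge0.
have [C1 [nu1 [C10 nu10 hY1]]] := hY K10 S0.
have [C2 C20 hX2] := hX K10 S0.
(* k is fixed before nu, so that a single functional [psi] serves all nu. *)
have [k k_small] := exp2_small (addr_ge0 C10 C20) delta20.
have k_small1 : C1 * (2 ^+ k)^-1 <= delta / 2.
  by rewrite (le_trans _ k_small)// ler_wpM2r ?lerDl// invr_ge0 exprn_ge0.
have k_small2 : C2 * (2 ^+ k)^-1 <= delta.
  rewrite (@le_trans _ _ (delta / 2))//; last by rewrite ler_pdivrMr// mulr_natr mulr2n lerDl ltW.
  by rewrite (le_trans _ k_small)// ler_wpM2r ?lerDr// invr_ge0 exprn_ge0.
pose psi := picard_functional B sigma g k.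
have cpsi : path_continuous psi by exact: (path_continuous_picard L0 BL cg).
have psiG a y : cpath y -> `|psi a y| <= G by exact: (picard_functional_le sigma L0 BL gG).
(* Averaging over the limit noise on both sides leaves the same continuous function of the initial
   datum, to which [hinit] applies. *)
pose H a := brownian_average P0 W0 psi a.
have cH : continuous (fun x : E => H (stack x)).
  move=> x; apply: (continuous_comp (f := @stack R d)); first exact: stack_continuous.
  apply: seq_continuous_continuous => a a_ aa.
  exact: (brownian_average_cvg hF0 hW0 cpsi psiG aa).
have HG x : `|H (stack x)| <= G by exact: (brownian_average_le hF0 hW0 cpsi psiG).
have cvgH := mean_init_cvg cH HG.
have ctail : continuous (fun x : E => clamp (`|x| - K)).
  move=> x; apply: (continuous_comp (f := fun x : E => `|x| - K)); last exact: clamp_continuous.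
  exact: (cvgB (cvg_norm (@cvg_id _ (nbhs x))) (cvg_cst K)).
have cvgtail := mean_init_cvg ctail (fun x => clamp_norm _).
have t1N' : mean P0 (fun w => clamp (`|(p0 0 w, q0 0 w)| - K)) < eta.
  by rewrite (lt_trans t1N)// ltr_pdivrMr// mulr_natr mulr2n ltrDl.
have cmp0 : `|mean P0 (fun w => g (fun t => (p0 t w, q0 t w))) -
    mean P0 (fun w => H (stack (p0 0 w, q0 0 w)))| <= e / 6 + e / 6.
  have ap0 : adapted F0 p0 by case: hp0.
  have aq0 : adapted F0 q0 by case: hq0.
  rewrite -(brownian_transfer hF0 hF0 hW0 hW0 (adapted_stack0 ap0 aq0) cpsi psiG).
  have := picard_compare (sigma := sigma) (P := P0) L0 BL cg gG rW0 rW0 ((random_path_stack rp0 rq0).2 0 (lexx _))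
    rp0 rq0 (k := k) (K := K) S0 (ltW e60) gSd.
  move=> cmp; apply: le_trans (cmp _) _.
    apply: filterS hX2 => w hw xK WK t tS.
    by rewrite (le_trans (hw xK WK k t tS)).
  rewrite lerD2l (le_trans _ etaG)// ler_wpM2l ?mulr_ge0//.
  by rewrite lerD ?(ltW t1N') ?(ltW t2N).
have nu_small : 0 < Num.min nu1 (delta / 2 / (C1 + 1)).
  by rewrite lt_min nu10 divr_gt0// ltr_wpDl.
near=> nu.
have nu0 : 0 < nu by near: nu; exact: nbhs_right_gt.
have nu_lt : nu < Num.min nu1 (delta / 2 / (C1 + 1)) by near: nu; exact: nbhs_right_lt.
have H1 : `|mean P0 (fun w => H (stack (p0 0 w, q0 0 w))) -
    mean (P nu) (fun w => H (stack (p nu 0 w, q nu 0 w)))| <= e / 6.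
  by near: nu; move/cvgrPdist_le : cvgH; apply.
have H2 : mean (P nu) (fun w => clamp (`|(p nu 0 w, q nu 0 w)| - K)) < eta.
  by near: nu; exact: (cvgr_lt _ cvgtail).
have H3 : mean (P nu) (fun w => clamp (path_sup S (centered (BB nu) w) - K)) < eta.
  by rewrite (brownian_sup_tail K (hF nu0) (hF ltr01) (hB nu0) (hB ltr01) S0).
have rp := continuous_adapted_random_path (hF nu0) (hp nu0).
have rq := continuous_adapted_random_path (hF nu0) (hq nu0).
have hW := brownian_motion_col_mx (hB nu0).
have rW : random_path (W nu) by apply: (continuous_adapted_random_path (hF nu0)); case: hW.
have cmp : `|mean (P nu) (fun w => g (fun t => (y1 nu t w, q nu t w))) -
    mean (P nu) (fun w => H (stack (p nu 0 w, q nu 0 w)))| <= e / 6 + e / 6.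
  have ap : adapted (F nu) (p nu) by case: (hp nu0).
  have aq : adapted (F nu) (q nu) by case: (hq nu0).
  rewrite -(brownian_transfer (hF nu0) hF0 hW hW0 (adapted_stack0 ap aq) cpsi psiG).
  have := picard_compare (sigma := sigma) (P := P nu) L0 BL cg gG rW (rB nu nu0) ((random_path_stack rp rq).2 0 (lexx _))
    (hy1 nu0) rq (k := k) (K := K) S0 (ltW e60) gSd.
  move=> cmp; apply: le_trans (cmp _) _.
    have := hY1 nu nu0; move: nu_lt; rewrite lt_min => /andP[nunu1 nuC] /(_ nunu1).
    apply: filterS => w hw xK WK t tS.
    rewrite (le_trans (hw xK WK k t tS))// mulrDr [delta]splitr lerD//.
    rewrite (@le_trans _ _ ((C1 + 1) * nu))//; first by rewrite ler_wpM2r ?lerDl// ltW.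
    by rewrite mulrC -ler_pdivlMr ?ltW// ltr_wpDl.
  rewrite lerD2l (le_trans _ etaG)// ler_wpM2l ?mulr_ge0//.
  by rewrite lerD ?(ltW H2) ?(ltW H3).
move: cmp0 H1 cmp; rewrite !ler_norml => /andP[? ?] /andP[? ?] /andP[? ?].
by apply/andP; split; lra.
Unshelve. all: by end_near. Qed.

(** Some inf-convolution has a mean within e/2 of that of f in the limit; its means converge, and it
    lies below f on every path. *)
Lemma mean_path_lower (f : (R -> E) -> R) (G e : R) :
  path_seq_continuous f -> (forall y, cpath y -> `|f y| <= G) -> 0 < e ->
  \forall nu \near 0^'+, mean P0 (fun w => f (fun t => (p0 t w, q0 t w))) - e <=
    mean (P nu) (fun w => f (fun t => (y1 nu t w, q nu t w))).
Proof.
move=> cf fG e0; have e20 : 0 < e / 2 by rewrite divr_gt0.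
have rp0 := continuous_adapted_random_path hF0 hp0.
have rq0 := continuous_adapted_random_path hF0 hq0.
have cX w : cpath (fun t => (p0 t w, q0 t w)).
  by apply: cpath_pair; [exact: rp0.1|exact: rq0.1].
pose h k := inf_convolution f k.
have hG k y : cpath y -> `|h k y| <= G by exact: inf_convolution_norm.
have hunif k e' : 0 < e' -> exists S delta : R, [/\ 0 <= S, 0 < delta &
    forall u v, cpath u -> cpath v ->
      (forall t, 0 <= t <= S -> `|u t - v t| <= delta) -> `|h k u - h k v| <= e'].
  move=> e'0; exists k%:R, (e' / k.+1%:R); split=> // [|u v cu cv uv].
    by rewrite divr_gt0.
  rewrite (le_trans (inf_convolution_lipschitz fG cu cv uv))//.
  rewrite mulrA ler_pdivrMr// mulrC ler_wpM2l ?(ltW e'0)//.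
  by rewrite ler_nat.
have ch k : path_seq_continuous (h k).
  move=> y y_ cy cy_ yy; apply/cvgrPdist_le => e' e'0.
  have [S [delta [S0 delta0 H]]] := hunif k e' e'0.
  have := yy S delta delta0; apply: (@filterS _ \oo) => N yN.
  by rewrite distrC; apply: H.
have cvgk : mean P0 (fun w => h k (fun t => (p0 t w, q0 t w))) @[k --> \oo] -->
    mean P0 (fun w => f (fun t => (p0 t w, q0 t w))).
  apply: (mean_cvg (K := G)) => [k||k w|].
  - exact: measurable_path_seq_continuous.
  - exact: measurable_path_seq_continuous.
  - exact: hG.
  - by apply: aeW => w; apply: (inf_convolution_cvg cf fG).
have [k hk] : exists k, mean P0 (fun w => f (fun t => (p0 t w, q0 t w))) - e / 2 <
    mean P0 (fun w => h k (fun t => (p0 t w, q0 t w))).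
  by apply: (@filter_ex _ \oo); apply: (cvgr_gt _ cvgk); rewrite ltrBlDr ltrDl.
have cvgh := mean_uniformly_continuous_cvg (ch k) (hG k) (hunif k).
near=> nu.
have nu0 : 0 < nu by near: nu; exact: nbhs_right_gt.
have H1 : mean P0 (fun w => h k (fun t => (p0 t w, q0 t w))) - e / 2 <
    mean (P nu) (fun w => h k (fun t => (y1 nu t w, q nu t w))).
  by near: nu; apply: (cvgr_gt _ cvgh); rewrite ltrBlDr ltrDl.
have rq := continuous_adapted_random_path (hF nu0) (hq nu0).
have cY w : cpath (fun t => (y1 nu t w, q nu t w)).
  by apply: cpath_pair; [exact: (hy1 nu0).1|exact: rq.1].
have H2 : mean (P nu) (fun w => h k (fun t => (y1 nu t w, q nu t w))) <=
    mean (P nu) (fun w => f (fun t => (y1 nu t w, q nu t w))).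
  apply: (@mean_le_ae _ _ _ (P nu) _ _ G).
  - exact: (measurable_path_seq_continuous (ch k) (hy1 nu0) rq).
  - exact: (measurable_path_seq_continuous cf (hy1 nu0) rq).
  - by move=> w; exact: hG.
  - by move=> w; exact: fG.
  - by apply: aeW => w; exact: (inf_convolution_le fG).
by lra.
Unshelve. all: by end_near. Qed.

Lemma limit_law : cvg_in_law (@continuous_paths R E)
  P (fun nu w t => (y1 nu t w, q nu t w)) P0 (fun w t => (p0 t w, q0 t w)).
Proof.
move=> f cf0 [G fG'].
have cf := within_path_seq_continuous cf0.
have fG y : cpath y -> `|f y| <= G by move=> /cpathP; exact: fG'.
have rp0 := continuous_adapted_random_path hF0 hp0.
have rq0 := continuous_adapted_random_path hF0 hq0.
have cX w : cpath (fun t => (p0 t w, q0 t w)).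
  by apply: cpath_pair; [exact: rp0.1|exact: rq0.1].
have mf0 : measurable_fun setT (fun w => f (fun t => (p0 t w, q0 t w))).
  exact: measurable_path_seq_continuous.
have mf nu : 0 < nu -> measurable_fun setT (fun w => f (fun t => (y1 nu t w, q nu t w))).
  move=> nu0; apply: measurable_path_seq_continuous => //; first exact: hy1.
  exact: (continuous_adapted_random_path (hF nu0) (hq nu0)).
have cY nu w : 0 < nu -> cpath (fun t => (y1 nu t w, q nu t w)).
  move=> nu0; apply: cpath_pair; first exact: (hy1 nu0).1.
  exact: (continuous_adapted_random_path (hF nu0) (hq nu0)).1.
rewrite (expectation_mean P0 mf0 (fun w => fG _ (cX w))).
apply: cvg_EFin.
  near=> nu; have nu0 : 0 < nu by near: nu; exact: nbhs_right_gt.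
  by rewrite (expectation_mean (P nu) (mf nu nu0) (fun w => fG _ (cY nu w nu0))).
rewrite (_ : fine \o _ = (fun nu => mean (P nu) (fun w => f (fun t => (y1 nu t w, q nu t w))))); last first.
  by apply/funext => nu; rewrite /= unlock.
apply/cvgrPdist_le => e e0.
have cNf : path_seq_continuous (fun y => - f y).
  by move=> y y_ cy cy_ yy; apply: cvgN; exact: cf.
have NfG y : cpath y -> `|- f y| <= G by move=> cy; rewrite normrN fG.
have H1 := mean_path_lower cf fG e0.
have H2 := mean_path_lower cNf NfG e0.
near=> nu; have nu0 : 0 < nu by near: nu; exact: nbhs_right_gt.
have : mean P0 (fun w => f (fun t => (p0 t w, q0 t w))) - e <=
    mean (P nu) (fun w => f (fun t => (y1 nu t w, q nu t w))) by near: nu; exact: H1.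
have : mean P0 (fun w => - f (fun t => (p0 t w, q0 t w))) - e <=
    mean (P nu) (fun w => - f (fun t => (y1 nu t w, q nu t w))) by near: nu; exact: H2.
rewrite (@meanN _ _ _ P0 _ G mf0 (fun w => fG _ (cX w))).
rewrite (@meanN _ _ _ (P nu) _ G (mf nu nu0) (fun w => fG _ (cY nu w nu0))).
by move=> ? ?; rewrite ler_norml; apply/andP; split; lra.
Unshelve. all: by end_near. Qed.

End limit_in_law.

Lemma ae_and {R : realType} {dT : measure_display} {T : measurableType dT}
    (P : probability T R) (Q1 Q2 : T -> Prop) :
  {ae P, forall w, Q1 w} -> {ae P, forall w, Q2 w} -> {ae P, forall w, Q1 w /\ Q2 w}.
Proof. by apply: filterS2 => w. Qed.

(** * Pathwise estimates for the two processes *)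

Section assembly.
Context {R : realType} {d n : nat}.
Local Notation E := ('cV[R]_d * 'cV[R]_d)%type.
Variables (M : 'M[R]_d) (Mz : 'M[R]_n) (beta : R).
Variables (V : 'cV[R]_d -> R) (xi : 'cV[R]_d -> 'cV[R]_n).
Variables (gamma sigma : 'M[R]_d) (gammaz sigmaz : 'M[R]_n).
Hypotheses (hM : sym_pos_def M) (hMz : sym_pos_def Mz) (hbeta : 0 < beta).
Hypotheses (hV : smooth V) (hxi : forall i, smooth (fun q => xi q i 0)).
Local Notation B := (langevin_drift M V gamma).
Variable L : R.
Hypotheses (L0 : 0 < L) (BL : forall x y, `|B x - B y| <= L * `|x - y|).

Lemma centered_start0 {dT : measure_display} {T : measurableType dT} (m : nat) (W : R -> T -> 'cV[R]_m) w :
  W 0 w = 0 -> centered W w = W ^~ w.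
Proof. by move=> W0; apply/funext => t; rewrite /centered W0 subr0. Qed.

Lemma constrained_process_path {dT : measure_display} {T : measurableType dT}
    (P : probability T R) (F : R -> set (set T)) nu W Wz q z p pz lambda :
  constrained_process P F M Mz beta V xi gamma sigma gammaz sigmaz nu
    W Wz q z p pz lambda ->
  {ae P, forall w, [/\ constrained_path M Mz beta V xi gamma sigma gammaz sigmaz nu
    (W ^~ w) (q ^~ w) (p ^~ w) (Wz ^~ w) (z ^~ w) (pz ^~ w) (lambda ^~ w),
    W 0 w = 0 & Wz 0 w = 0]}.
Proof.
move=> H.
have [_ B0 _] := cp_noise H.
have rB := continuous_adapted_random_path (cp_filtration H) (let: And3 c _ _ := cp_noise H in c).
have c1 := ae_and (cp_q H) (cp_z H).
have c2 := ae_and (cp_p H) (cp_pz H).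
have c3 := ae_and (cp_constraint H) B0.
have := ae_and (ae_and c1 c2) c3; apply: filterS => w [[[Hq Hz] [Hp Hpz]] [Hc HB]].
have cpx m (X : R -> T -> 'cV[R]_m) : continuous_adapted F X -> cpath (X ^~ w).
  by move=> [_ cX]; exact/cpathP.
split; last first.
- by rewrite -[Wz 0 w](@col_mxKd _ d n 1 (W 0 w)) HB linear0.
- by rewrite -[W 0 w](@col_mxKu _ d n 1 _ (Wz 0 w)) HB linear0.
split=> //.
- have [aW cW] : continuous_adapted F W.
    by have [] := brownian_motion_col_mx (cp_noise H).
  exact/cpathP.
- exact: cpx (cp_q_adapted H).
- exact: cpx (cp_z_adapted H).
- exact: cpx (cp_p_adapted H).
- exact: cpx (cp_pz_adapted H).
Qed.

Lemma constrained_picard (K S : R) : 0 <= K -> 0 <= S ->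
  exists r C nu0 : R, [/\ 0 <= r, 0 <= C, 0 < nu0 &
  forall (nu : R) (W q p : R -> 'cV[R]_d) (Wz z pz lambda : R -> 'cV[R]_n),
    0 < nu -> nu < nu0 ->
    constrained_path M Mz beta V xi gamma sigma gammaz sigmaz nu W q p Wz z pz lambda ->
    `|(p 0, q 0)| <= K ->
    (forall t, 0 <= t <= S -> `|col_mx (W t) (Wz t)| <= K) ->
  forall t, 0 <= t <= S -> `|(p t, q t)| <= r /\
    forall k, `|(p t, q t) - picard B (p 0, q 0) (noise sigma W) k t| <=
      C * ((2 ^+ k)^-1 + nu)].
Proof.
move=> K0 S0.
have [r [C [nu0 [r0 C0 nu00 H]]]] :=
  constrained_path_error sigma gammaz sigmaz hM hMz hbeta hxi L0 BL K0 S0.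
(* From [picard_error] with error [C * nu]: [(K + r) / 2 ^+ k + 2 * (C * nu)] is at most
   [K + r + 2 * C] times [(2 ^+ k)^-1 + nu]. *)
exists r, ((K + r + 2 * C) * expR (2 * L * S)), nu0; split=> //.
  by rewrite mulr_ge0 ?expR_ge0// !addr_ge0// mulr_ge0.
move=> nu W q p Wz z pz lambda nu_gt0 nu_lt hpath y0K BK.
have WK t : 0 <= t <= S -> `|W t| <= K.
  move=> tS; rewrite (le_trans _ (BK t tS))//; apply: mx_norm_le => // i j.
  by rewrite -(col_mxEu (W t) (Wz t)) mx_norm_coord.
have WzK t : 0 <= t <= S -> `|Wz t| <= K.
  move=> tS; rewrite (le_trans _ (BK t tS))//; apply: mx_norm_le => // i j.
  by rewrite -(col_mxEd (W t) (Wz t)) mx_norm_coord.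
have {}H := H _ _ _ _ _ _ _ _ nu_gt0 nu_lt hpath y0K WK WzK.
have cy : cpath (fun s => (p s, q s)).
  by apply: cpath_pair; [exact: cpath_p hpath|exact: cpath_q hpath].
have cw : cpath (noise sigma W) by exact: cpath_noise (cpath_W hpath).
move=> t tS; split; first by case: (H t tS).
move=> k.
have Cnu0 : 0 <= C * nu by rewrite mulr_ge0// ltW.
have step s : 0 <= s <= S ->
    `|(p s, q s) - picard_step B (p 0, q 0) (noise sigma W) (fun s => (p s, q s)) s| <= C * nu.
  by move=> sS; case: (H s sS).
have yr s : 0 <= s <= S -> `|(p s, q s)| <= r by move=> sS; case: (H s sS).
have := picard_error L0 BL k cw cy K0 r0 Cnu0 y0K yr step tS.
move=> /le_trans; apply.
have /andP[t0 tS'] := tS; have k0 : 0 <= (2 ^+ k : R)^-1 by rewrite invr_ge0 exprn_ge0.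
rewrite [leRHS]mulrAC; apply: ler_pM; rewrite ?expR_ge0 ?expR_le_horizon//.
  by apply: addr_ge0; apply: mulr_ge0 => //; exact: addr_ge0.
have Kr : 0 <= K + r by exact: addr_ge0.
have := mulr_ge0 Kr (ltW nu_gt0); have := mulr_ge0 C0 k0.
by move: (2 ^+ k)^-1 k0 => u u0 ? ?; nra.
Qed.

(** A Langevin trajectory is an exact fixed point of its Picard step: the tolerance 1 feeds
    [apriori], and the error 0 leaves only the geometric term. *)
Lemma langevin_picard {dT : measure_display} {T : measurableType dT}
    (P : probability T R) (F : R -> set (set T)) (W q p : R -> T -> 'cV[R]_d) (K S : R) :
  langevin_process P F M V gamma sigma W q p -> 0 <= K -> 0 <= S ->
  exists2 C : R, 0 <= C &
    {ae P, forall w, `|(p 0 w, q 0 w)| <= K ->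
    (forall t, 0 <= t <= S -> `|centered W w t| <= K) ->
    forall k t, 0 <= t <= S -> `|(p t w, q t w) -
      picard B (p 0 w, q 0 w) (noise sigma (centered W w)) k t| <=
      C * (2 ^+ k)^-1}.
Proof.
move=> [hF hW [hq hp] qE pE] K0 S0.
pose K1 := K + d%:R * `|sigma| * K.
have K10 : 0 <= K1 by rewrite addr_ge0 ?mulr_ge0.
pose r := apriori_bound B L K1 S.
have r0 : 0 <= r by exact: apriori_bound_ge0.
exists ((K + r) * expR (2 * L * S)); first by rewrite mulr_ge0 ?expR_ge0 ?addr_ge0.
have [[_ cW] W0 _] := hW.
have := ae_and (ae_and qE pE) W0; apply: filterS => w [[qEw pEw] W0w] y0K WK k t tS.
have cy : cpath (fun s => (p s w, q s w)).
  by apply: cpath_pair; apply/cpathP; [exact: hp.2|exact: hq.2].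
rewrite (centered_start0 W0w) in WK *.
have cWw : cpath (W ^~ w) by exact/cpathP.
have cw : cpath (noise sigma (W ^~ w)) by exact: cpath_noise.
have step s : 0 <= s -> (p s w, q s w) =
    picard_step B (p 0 w, q 0 w) (noise sigma (W ^~ w)) (fun s => (p s w, q s w)) s.
  by move=> s0; rewrite {1}pEw// {1}qEw// /picard_step /noise; congr pair; rewrite /= addr0.
have step_le (e : R) tau : 0 <= e -> forall s, 0 <= s <= tau -> `|(p s w, q s w) -
    picard_step B (p 0 w, q 0 w) (noise sigma (W ^~ w)) (fun s => (p s w, q s w)) s| <= e.
  by move=> e0 s /andP[s0 _]; rewrite -step// subrr normr0.
have y0K1 : `|(p 0 w, q 0 w)| <= K1 by rewrite (le_trans y0K)// lerDl !mulr_ge0.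
have wK1 s : 0 <= s <= S -> `|noise sigma (W ^~ w) s| <= K1.
  move=> sS; rewrite pair_norm_le /= normr0 K10 andbT.
  apply: (@le_trans _ _ (d%:R * `|sigma| * K)); last by rewrite lerDr.
  by rewrite (le_trans (mulmx_norm _ _))// ler_wpM2l ?mulr_ge0// WK.
have yr := apriori L0 BL cw cy K10 S0 y0K1 wK1 (lexx S) (step_le 1 S ler01).
have := picard_error L0 BL k cw cy K0 r0 (lexx 0) y0K yr (step_le 0 S (lexx 0)) tS.
move=> /le_trans; apply.
have /andP[t0 tS'] := tS; have k0 : 0 <= (2 ^+ k : R)^-1 by rewrite invr_ge0 exprn_ge0.
rewrite mulr0 addr0 [leRHS]mulrAC ler_wpM2l ?mulr_ge0 ?addr_ge0//.
exact: expR_le_horizon.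
Qed.

End assembly.

(** * The momentum M_nu M^-1 p *)

Section momentum_map.
Context {R : realType} {d n : nat}.
Variables (M : 'M[R]_d) (Mz : 'M[R]_n) (xi : 'cV[R]_d -> 'cV[R]_n).
Hypotheses (hM : sym_pos_def M) (hxi : forall i, smooth (fun q => xi q i 0)).
Local Notation E := ('cV[R]_d * 'cV[R]_d)%type.

Definition effective_momentum (nu : R) (x : E) : 'cV[R]_d :=
  M_nu M Mz xi nu x.2 *m invmx M *m x.1.

Lemma effective_momentum_continuous nu : continuous (effective_momentum nu).
Proof.
move=> x; have c1 : {for x, continuous (fun x : E => x.1)} by exact: cvg_fst.
have c2 : {for x, continuous (fun x : E => x.2)} by exact: cvg_snd.
have cgram : {for x.2, continuous (gram Mz xi)} by exact: gram_continuous.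
have cg : {for x.2, continuous (fun q => nu ^+ 2 *: gram Mz xi q)}.
  exact: (cvgZ (cvg_cst (nu ^+ 2)) cgram).
have cM : {for x.2, continuous (M_nu M Mz xi nu)}.
  exact: (cvgD (cvg_cst M) cg).
have cMx : {for x, continuous (fun x : E => M_nu M Mz xi nu x.2)}.
  exact: (continuous_comp c2 cM).
have ci : {for x, continuous (fun _ : E => invmx M)} by exact: cst_continuous.
exact: (mulmx_continuous (mulmx_continuous cMx ci) c1).
Qed.

(** The difference is [nu ^+ 2] times the Gram matrix applied to [M^-1 p], and nu^2 <= nu. *)
Lemma effective_momentum_bound (r : R) : exists2 C, 0 <= C &
  forall nu (x : E), 0 < nu -> nu <= 1 -> `|x| <= r ->
    `|effective_momentum nu x - x.1| <= C * nu.
Proof.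
have [a a0 Ha] := continuous_bounded_ball r (gram_continuous (Mz := Mz) hxi).
(* The absolute value keeps the constant nonnegative, the sign of r being free. *)
exists (d%:R * a * (d%:R * `|invmx M| * `|r|)); first by rewrite !mulr_ge0.
move=> nu x nu0 nu1; rewrite pair_norm_le => /andP[x1 x2].
have Mu : M \in unitmx by rewrite unitmxE unitfE sym_pos_def_det.
rewrite /effective_momentum M_nuE !mulmxDl mulmxV// mul1mx [x.1 + _]addrC addrK.
rewrite -!scalemxAl normrZ ger0_norm ?sqr_ge0// mulrC -mulmxA.
apply: ler_pM => //; rewrite ?sqr_ge0//; last by rewrite expr2 ler_piMl// ltW.
rewrite (le_trans (mulmx_norm _ _))// ler_pM ?mulr_ge0//.
  by rewrite ler_wpM2l// Ha.
rewrite (le_trans (mulmx_norm _ _))// ler_wpM2l ?mulr_ge0// (le_trans x1)//.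
exact: ler_norm.
Qed.

Lemma random_path_effective_momentum {dT : measure_display} {T : measurableType dT}
    nu (p q : R -> T -> 'cV[R]_d) : random_path p -> random_path q ->
  random_path (fun t w => effective_momentum nu (p t w, q t w)).
Proof.
move=> rp rq; split=> [w|t t0 i].
  apply: (cpath_comp (@effective_momentum_continuous nu)).
  by apply: cpath_pair; [exact: rp.1|exact: rq.1].
rewrite (_ : (fun _ => _) = (fun w =>
    effective_momentum nu (unstack (stack (p t w, q t w))) i 0)).
  apply: (measurable_continuous_fun (h := fun a => effective_momentum nu (unstack a) i 0)).
    move=> a.
    have ce : {for unstack a, continuous (effective_momentum nu)}.
      exact: effective_momentum_continuous.
    have cu : {for a, continuous (fun a => effective_momentum nu (unstack a))}.
      exact: (continuous_comp (@unstack_continuous R d a) ce).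
    exact: (continuous_comp cu (@coord_continuous R d 1 i 0 _)).
  exact: (random_path_stack rp rq).2.
by apply/funext => w; rewrite stackK.
Qed.

End momentum_map.

Theorem proposition3p6 (R : realType) (d n : nat)
    (M : 'M[R]_d) (Mz : 'M[R]_n) (beta : R)
    (V : 'cV[R]_d -> R) (xi : 'cV[R]_d -> 'cV[R]_n)
    (gamma sigma : 'M[R]_d) (gammaz sigmaz : 'M[R]_n)
    (hM : sym_pos_def M) (hMz : sym_pos_def Mz) (hbeta : 0 < beta)
    (hV : smooth V) (hxi : forall i, smooth (fun q => xi q i 0))
    (hgamma : sym_nonneg gamma) (hgammaz : sym_nonneg gammaz)
    (hsigma : sigma *m sigma^T = (2 / beta) *: gamma)
    (hsigmaz : sigmaz *m sigmaz^T = (2 / beta) *: gammaz)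
    (hHlip : lipschitz (hamiltonian_field M V)) (hxilip : lipschitz xi)
    (dT : R -> measure_display) (T : forall nu : R, measurableType (dT nu))
    (P : forall nu : R, probability (T nu) R)
    (F : forall nu : R, R -> set (set (T nu)))
    (W : forall nu : R, R -> T nu -> 'cV[R]_d)
    (Wz : forall nu : R, R -> T nu -> 'cV[R]_n)
    (q : forall nu : R, R -> T nu -> 'cV[R]_d)
    (z : forall nu : R, R -> T nu -> 'cV[R]_n)
    (p : forall nu : R, R -> T nu -> 'cV[R]_d)
    (pz lambda : forall nu : R, R -> T nu -> 'cV[R]_n)
    (hproc : forall nu : R, 0 < nu ->
       constrained_process (P nu) (F nu) M Mz beta V xi gamma sigma
         gammaz sigmaz nu (W nu) (Wz nu) (q nu) (z nu) (p nu) (pz nu)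
         (lambda nu))
    (dT0 : measure_display) (T0 : measurableType dT0) (P0 : probability T0 R)
    (F0 : R -> set (set T0)) (W0 q0 p0 : R -> T0 -> 'cV[R]_d)
    (hlang : langevin_process P0 F0 M V gamma sigma W0 q0 p0)
    (hinit : cvg_in_law setT P (fun nu w => (p nu 0 w, q nu 0 w))
                             P0 (fun w => (p0 0 w, q0 0 w))) :
  cvg_in_law (@continuous_paths R ('cV[R]_d * 'cV[R]_d)%type)
    P (fun nu w t => (p nu t w, q nu t w))
    P0 (fun w t => (p0 t w, q0 t w))
  /\
  cvg_in_law (@continuous_paths R ('cV[R]_d * 'cV[R]_d)%type)
    P (fun nu w t =>
         (M_nu M Mz xi nu (q nu t w) *m invmx M *m p nu t w, q nu t w))
    P0 (fun w t => (p0 t w, q0 t w)).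
Proof.
have [L L0 BL] := langevin_drift_lipschitz gamma hV hHlip.
have [hF0 hW0 [hq0 hp0] _ _] := hlang.
have hF nu (nu0 : 0 < nu) := cp_filtration (hproc nu nu0).
have hB nu (nu0 : 0 < nu) := cp_noise (hproc nu nu0).
have hq nu (nu0 : 0 < nu) := cp_q_adapted (hproc nu nu0).
have hp nu (nu0 : 0 < nu) := cp_p_adapted (hproc nu nu0).
have rp nu (nu0 : 0 < nu) := continuous_adapted_random_path (hF nu nu0) (hp nu nu0).
have rq nu (nu0 : 0 < nu) := continuous_adapted_random_path (hF nu nu0) (hq nu nu0).
pose good K S nu w := `|(p nu 0 w, q nu 0 w)| <= K /\
  forall t, 0 <= t <= S ->
    `|centered (fun t w => col_mx (W nu t w) (Wz nu t w)) w t| <= K.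
pose phi nu w k := picard (langevin_drift M V gamma) (p nu 0 w, q nu 0 w)
  (noise sigma (centered (W nu) w)) k.
(* One estimate for both claims; the bound r on the path is kept for comparing the two momenta. *)
have base K S : 0 <= K -> 0 <= S -> exists r C nu0 : R, [/\ 0 <= r, 0 <= C, 0 < nu0 &
    forall nu, 0 < nu -> nu < nu0 -> {ae P nu, forall w, good K S nu w ->
      forall t, 0 <= t <= S -> `|(p nu t w, q nu t w)| <= r /\
      forall k, `|(p nu t w, q nu t w) - phi nu w k t| <= C * ((2 ^+ k)^-1 + nu)}].
  move=> K0 S0.
  have [r [C [nu0 [r0 C0 nu00 H]]]] :=
    constrained_picard sigma gammaz sigmaz hM hMz hbeta hxi L0 BL K0 S0.
  exists r, C, nu0; split=> // nu nu_gt0 nu_lt.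
  have := constrained_process_path (hproc nu nu_gt0).
  apply: filterS => w [hpath W0w Wz0w] [y0K BK] t tS.
  rewrite /phi (centered_start0 W0w).
  apply: (H _ _ _ _ _ _ _ _ nu_gt0 nu_lt hpath y0K _ _ tS) => s sS.
  by have := BK s sS; rewrite /centered W0w Wz0w col_mx0 subr0.
have hX K S (K0 : 0 <= K) (S0 : 0 <= S) := langevin_picard L0 BL hlang K0 S0.
split.
  apply: (limit_law (F := F) (W := W) (q := q) (p := p) (y1 := p) (Wz := Wz)
    L0 BL hF hB hq hp rp hF0 hW0 hq0 hp0 hinit _ hX) => K S K0 S0.
  have [r [C [nu0 [r0 C0 nu00 H]]]] := base K S K0 S0.
  exists C, nu0; split=> // nu nu_gt0 nu_lt.
  apply: filterS (H nu nu_gt0 nu_lt) => w Hw xK BK k t tS.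
  by have [_] := Hw (conj xK BK) t tS; exact.
have ry nu (nu0 : 0 < nu) := random_path_effective_momentum M Mz hxi nu (rp nu nu0) (rq nu nu0).
apply: (limit_law (F := F) (W := W) (q := q) (p := p) (Wz := Wz)
  (y1 := fun nu t w => effective_momentum M Mz xi nu (p nu t w, q nu t w))
  L0 BL hF hB hq hp ry hF0 hW0 hq0 hp0 hinit _ hX) => K S K0 S0.
have [r [C [nu0 [r0 C0 nu00 H]]]] := base K S K0 S0.
have [C' C'0 H'] := effective_momentum_bound Mz hM hxi r.
(* [C] for the distance from (p, q) to the iterate, [C'] for changing p into [M_nu M^-1 p]. *)
exists (C + C'), (Num.min 1 nu0); split; rewrite ?addr_ge0 ?lt_min ?ltr01//.
move=> nu nu_gt0; rewrite lt_min => /andP[nu_lt1 nu_lt].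
apply: filterS (H nu nu_gt0 nu_lt) => w Hw xK BK k t tS.
have [yr /(_ k) Hk] := Hw (conj xK BK) t tS.
have Hm := H' nu (p nu t w, q nu t w) nu_gt0 (ltW nu_lt1) yr.
have k0 : 0 <= (2 ^+ k : R)^-1 by rewrite invr_ge0 exprn_ge0.
rewrite -(subrKA (p nu t w, q nu t w)) (le_trans (ler_normD _ _))//.
rewrite mulrDl addrC lerD// (@le_trans _ _ (C' * nu))//.
  by rewrite pair_norm_le /= subrr normr0 Hm mulr_ge0// ltW.
by rewrite ler_wpM2l// lerDr.
Qed.
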